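(* Assume $\mathsf{OCA}_{\mathrm T}$ and $\mathsf{MA}_{\aleph_1}(\sigma\text{-linked})$. Suppose that $\mathcal M_n$ and $\mathcal N_n$ ($n\in\mathbb N$) are countable sets, each of cardinality at least two, and $\Phi\colon\prod_n\mathcal M_n/\mathrm{Fin}\to\prod_n\mathcal N_n/\mathrm{Fin}$ is a coordinate-respecting function. Then $\Phi$ is of twisted product form.
   Context: $\mathrm{Fin}$ is the ideal of finite subsets of $\mathbb N$; $\prod_n\mathcal M_n/\mathrm{Fin}$ is the set of classes of $\prod_n\mathcal M_n$ under $a\sim b\iff\{n:a(n)\ne b(n)\}$ finite. For $S\subseteq\mathbb N$, $a=_S b$ means $\{n\in S:\tilde a(n)\ne\tilde b(n)\}$ is finite for representatives $\tilde a,\tilde b$ (depends only on $[S]\in\mathcal P(\mathbb N)/\mathrm{Fin}$). $\Phi$ is coordinate-respecting if there is a Boolean algebra isomorphism $\alpha\colon\mathcal P(\mathbb N)/\mathrm{Fin}\to\mathcal P(\mathbb N)/\mathrm{Fin}$ such that for all $a,b$ and $S$, $a=_S b$ implies $\Phi(a)=_{\alpha(S)}\Phi(b)$ (the paper uses ''coordinate-respecting'' in this isomorphic sense). $\Phi$ is of twisted product form if there are $f\colon\mathbb N\to\mathbb N$ and functions $h_n\colon\mathcal M_{f(n)}\to\mathcal N_n$ such that $a\mapsto(h_n(a(f(n))))_n$ lifts $\Phi$ (sends representatives of $x$ to representatives of $\Phi(x)$). $\mathsf{OCA}_{\mathrm T}$: for every separable metric space $X$ and every open $K_0\subseteq[X]^2$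 (unordered pairs of distinct points, topologized as symmetric subsets of $X^2$ minus the diagonal), either some uncountable $Y\subseteq X$ has $[Y]^2\subseteq K_0$, or $X=\bigcup_n X_n$ with $[X_n]^2\cap K_0=\emptyset$ for all $n$. $\mathsf{MA}_{\aleph_1}(\sigma\text{-linked})$: for every poset which is a countable union of sets of pairwise compatible elements and every family of $\aleph_1$ dense subsets, some filter meets all of them. *)

(* Defs.v *)
From HB Require Import structures.
From mathcomp Require Import all_boot all_order all_algebra.
From mathcomp Require Import all_classical all_reals all_analysis.

Set Implicit Arguments.
Unset Strict Implicit.
Unset Printing Implicit Defensive.

Local Open Scope classical_set_scope.
Local Open Scope quotient_scope.

Section PowFin.
Implicit Types A B C : set nat.

Definition set_eqfin : rel (set nat) := fun A B => `[< finite_set (A `+` B) >].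

Lemma set_eqfin_refl : reflexive set_eqfin.
Proof. by move=> A; apply/asboolP; rewrite setYK; exact: finite_set0. Qed.

Lemma set_eqfin_sym : symmetric set_eqfin.
Proof. by move=> A B; rewrite /set_eqfin setYC. Qed.

Lemma set_eqfin_trans : transitive set_eqfin.
Proof.
move=> B A C /asboolP AB /asboolP BC; apply/asboolP.
apply: (@sub_finite_set _ _ ((A `+` B) `|` (B `+` C))).
  move=> n /= [] [nX nY]; have [nB|nB] := pselect (B n); tauto.
by rewrite finite_setU.
Qed.

Canonical set_eqfin_equiv :=
  EquivRel set_eqfin set_eqfin_refl set_eqfin_sym set_eqfin_trans.

Definition pow_fin : Type := {eq_quot set_eqfin}.

HB.instance Definition _ := Choice.on pow_fin.
HB.instance Definition _ := EqQuotient.on pow_fin.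

Lemma pow_finP A B : \pi_pow_fin A = \pi_pow_fin B <-> finite_set (A `+` B).
Proof.
split; first by move=> /eqmodP /asboolP.
by move=> AB; apply/eqmodP; exact/asboolP.
Qed.

Definition pow_fin_meet (x y : pow_fin) : pow_fin :=
  \pi_pow_fin (repr x `&` repr y).
Definition pow_fin_join (x y : pow_fin) : pow_fin :=
  \pi_pow_fin (repr x `|` repr y).
Definition pow_fin_compl (x : pow_fin) : pow_fin := \pi_pow_fin (~` repr x).

Lemma repr_pi_eqfin A : finite_set (repr (\pi_pow_fin A) `+` A).
Proof. by apply/pow_finP; rewrite reprK. Qed.

Lemma pi_meet A B :
  pow_fin_meet (\pi_pow_fin A) (\pi_pow_fin B) = \pi_pow_fin (A `&` B).
Proof.
apply/pow_finP; set A' := repr _; set B' := repr _.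
apply: (@sub_finite_set _ _ ((A' `+` A) `|` (B' `+` B))).
  move=> n /=; case: (pselect (A n)); case: (pselect (B n));
  by case: (pselect (A' n)); case: (pselect (B' n)); tauto.
by rewrite finite_setU; split; exact: repr_pi_eqfin.
Qed.

Lemma pi_join A B :
  pow_fin_join (\pi_pow_fin A) (\pi_pow_fin B) = \pi_pow_fin (A `|` B).
Proof.
apply/pow_finP; set A' := repr _; set B' := repr _.
apply: (@sub_finite_set _ _ ((A' `+` A) `|` (B' `+` B))).
  move=> n /=; case: (pselect (A n)); case: (pselect (B n));
  by case: (pselect (A' n)); case: (pselect (B' n)); tauto.
by rewrite finite_setU; split; exact: repr_pi_eqfin.
Qed.

Lemma pi_compl A : pow_fin_compl (\pi_pow_fin A) = \pi_pow_fin (~` A).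
Proof.
apply/pow_finP; set A' := repr _.
apply: (@sub_finite_set _ _ (A' `+` A)); last exact: repr_pi_eqfin.
by move=> n /=; case: (pselect (A n)); case: (pselect (A' n)); tauto.
Qed.

Definition pow_fin_le (x y : pow_fin) : bool := pow_fin_meet x y == x.
Definition pow_fin_lt (x y : pow_fin) : bool := (y != x) && pow_fin_le x y.

Fact pow_fin_le_def x y : pow_fin_le x y = (pow_fin_meet x y == x).
Proof. by []. Qed.

Fact pow_fin_lt_def x y : pow_fin_lt x y = (y != x) && pow_fin_le x y.
Proof. by []. Qed.

Fact pow_fin_meetC : commutative pow_fin_meet.
Proof. by elim/quotW=> x; elim/quotW=> y; rewrite !pi_meet setIC. Qed.

Fact pow_fin_joinC : commutative pow_fin_join.
Proof. by elim/quotW=> x; elim/quotW=> y; rewrite !pi_join setUC. Qed.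

Fact pow_fin_meetA : associative pow_fin_meet.
Proof.
by elim/quotW=> x; elim/quotW=> y; elim/quotW=> z;
  rewrite (pi_meet y z) (pi_meet x y) !pi_meet setIA.
Qed.

Fact pow_fin_joinA : associative pow_fin_join.
Proof.
by elim/quotW=> x; elim/quotW=> y; elim/quotW=> z;
  rewrite (pi_join y z) (pi_join x y) !pi_join setUA.
Qed.

Fact pow_fin_joinKI : forall y x, pow_fin_meet x (pow_fin_join x y) = x.
Proof.
by elim/quotW=> y; elim/quotW=> x;
  rewrite (pi_join x y) pi_meet setUC setKU.
Qed.

Fact pow_fin_meetKU : forall y x, pow_fin_join x (pow_fin_meet x y) = x.
Proof.
by elim/quotW=> y; elim/quotW=> x;
  rewrite (pi_meet x y) pi_join setIC setKI.
Qed.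

Fact pow_fin_meetUl : left_distributive pow_fin_meet pow_fin_join.
Proof.
by elim/quotW=> x; elim/quotW=> y; elim/quotW=> z;
  rewrite (pi_join x y) (pi_meet x z) (pi_meet y z)
    pi_meet pi_join setIUl.
Qed.

Fact pow_fin_meetxx : idempotent_op pow_fin_meet.
Proof. by elim/quotW=> x; rewrite pi_meet setIid. Qed.

Fact pow_fin_display : Order.disp_t. Proof. exact: Order.Disp tt tt. Qed.

HB.instance Definition _ := Order.isMeetJoinDistrLattice.Build
  pow_fin_display pow_fin pow_fin_le_def pow_fin_lt_def
  pow_fin_meetC pow_fin_joinC pow_fin_meetA pow_fin_joinA
  pow_fin_joinKI pow_fin_meetKU pow_fin_meetUl pow_fin_meetxx.

Fact pow_fin_le0x (x : pow_fin) : (\pi_pow_fin set0 <= x)%O.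
Proof.
apply/eqP; move: x; elim/quotW=> x.
by rewrite [LHS]pi_meet set0I.
Qed.

Fact pow_fin_lex1 (x : pow_fin) : (x <= \pi_pow_fin setT)%O.
Proof.
apply/eqP; move: x; elim/quotW=> x.
by rewrite [LHS]pi_meet setIT.
Qed.

HB.instance Definition _ :=
  Order.hasBottom.Build pow_fin_display pow_fin pow_fin_le0x.
HB.instance Definition _ :=
  Order.hasTop.Build pow_fin_display pow_fin pow_fin_lex1.

Fact pow_fin_joinxC (x : pow_fin) :
  Order.join x (pow_fin_compl x) = Order.top.
Proof.
by move: x; elim/quotW=> x; rewrite pi_compl [LHS]pi_join setUv.
Qed.

Fact pow_fin_meetxC (x : pow_fin) :
  Order.meet x (pow_fin_compl x) = Order.bottom.
Proof.
by move: x; elim/quotW=> x; rewrite pi_compl [LHS]pi_meet setICr.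
Qed.

HB.instance Definition _ := Order.TBDistrLattice_hasComplement.Build
  pow_fin_display pow_fin pow_fin_joinxC pow_fin_meetxC.

End PowFin.

Definition boolean_isomorphism d (B : ctbDistrLatticeType d)
    d' (B' : ctbDistrLatticeType d') (f : B -> B') : Prop :=
  bijective f /\
  [/\ {morph f : x y / Order.meet x y},
      {morph f : x y / Order.join x y},
      {morph f : x / Order.compl x},
      f Order.bottom = Order.bottom &
      f Order.top = Order.top].

Section ReducedProduct.
Variable M : nat -> Type.

(* [{classic _}] only equips the product with a choice structure. *)
Definition seq_eqfin : rel {classic (forall n, M n)} :=
  fun a b => `[< finite_set [set n | a n <> b n] >].

Lemma seq_eqfin_refl : reflexive seq_eqfin.
Proof.
move=> a; apply/asboolP; apply: (@sub_finite_set _ _ set0) => //.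
Qed.

Lemma seq_eqfin_sym : symmetric seq_eqfin.
Proof.
move=> a b; apply/asboolP/asboolP; apply: sub_finite_set => n /= ab ba;
exact/ab/esym.
Qed.

Lemma seq_eqfin_trans : transitive seq_eqfin.
Proof.
move=> b a c /asboolP ab /asboolP bc; apply/asboolP.
apply: (@sub_finite_set _ _
    ([set n | a n <> b n] `|` [set n | b n <> c n])).
  move=> n /= ac; have [abn|abn] := pselect (a n = b n); last by left.
  by right; rewrite -abn.
by rewrite finite_setU.
Qed.

Canonical seq_eqfin_equiv :=
  EquivRel seq_eqfin seq_eqfin_refl seq_eqfin_sym seq_eqfin_trans.

Definition reduced_prod : Type := {eq_quot seq_eqfin}.

HB.instance Definition _ := Choice.on reduced_prod.
HB.instance Definition _ := EqQuotient.on reduced_prod.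

Definition class_fin (a : forall n, M n) : reduced_prod := \pi_reduced_prod a.

Lemma class_finP (a b : forall n, M n) :
  class_fin a = class_fin b <-> finite_set [set n | a n <> b n].
Proof.
split; first by move=> /eqmodP /asboolP.
by move=> ab; apply/eqmodP; exact/asboolP.
Qed.

Definition eq_on (S : pow_fin) (x y : reduced_prod) : Prop :=
  finite_set [set n | repr S n /\ repr x n <> repr y n].

(* Independence of the representatives chosen by [repr]. *)
Lemma eq_onP (S : set nat) (a b : forall n, M n) :
  eq_on (\pi_pow_fin S) (class_fin a) (class_fin b) <->
  finite_set [set n | S n /\ a n <> b n].
Proof.
have fS := repr_pi_eqfin S.
have /class_finP fa : class_fin (repr (class_fin a)) = class_fin a.
  by rewrite /class_fin reprK.
have /class_finP fb : class_fin (repr (class_fin b)) = class_fin b.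
  by rewrite /class_fin reprK.
rewrite /eq_on; move: fS fa fb.
move: (repr (\pi_pow_fin S)) (repr (class_fin a)) (repr (class_fin b)).
move=> S' a' b' fS fa fb.
have fU : finite_set ((S' `+` S) `|`
    ([set n | a' n <> a n] `|` [set n | b' n <> b n])).
  by rewrite finite_setU; split => //; rewrite finite_setU.
split=> fin.
- apply: (@sub_finite_set _ _ (((S' `+` S) `|`
    ([set n | a' n <> a n] `|` [set n | b' n <> b n])) `|`
    [set n | S' n /\ a' n <> b' n])); last by rewrite finite_setU.
  move=> n /= [Sn ab].
  have [?|?] := pselect (S' n); last by left; left; right.
  have [ea|?] := pselect (a' n = a n); last by left; right; left.
  have [eb|?] := pselect (b' n = b n); last by left; right; right.
  by right; rewrite ea eb.
- apply: (@sub_finite_set _ _ (((S' `+` S) `|`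
    ([set n | a' n <> a n] `|` [set n | b' n <> b n])) `|`
    [set n | S n /\ a n <> b n])); last by rewrite finite_setU.
  move=> n /= [Sn ab].
  have [?|?] := pselect (S n); last by left; left; left.
  have [ea|?] := pselect (a' n = a n); last by left; right; left.
  have [eb|?] := pselect (b' n = b n); last by left; right; right.
  by right; rewrite -ea -eb.
Qed.

End ReducedProduct.

Definition coordinate_respecting (M N : nat -> Type)
    (Phi : reduced_prod M -> reduced_prod N) : Prop :=
  exists2 alpha : pow_fin -> pow_fin, boolean_isomorphism alpha &
    forall (x y : reduced_prod M) (S : pow_fin),
      eq_on S x y -> eq_on (alpha S) (Phi x) (Phi y).

Definition twisted_product_form (M N : nat -> Type)
    (Phi : reduced_prod M -> reduced_prod N) : Prop :=
  exists (f : nat -> nat) (h : forall n, M (f n) -> N n),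
    forall a : forall n, M n,
      Phi (class_fin a) = class_fin (fun n => h n (a (f n))).

Definition separable (X : topologicalType) : Prop :=
  exists2 D : set X, countable D & dense D.

(* Subsets of $[X]^2$ are represented by symmetric subsets of
   $X^2 \setminus \Delta_X$; this one represents $[Y]^2$. *)
Definition distinct_pairs (X : Type) (Y : set X) : set (X * X) :=
  [set p | [/\ Y p.1, Y p.2 & p.1 <> p.2]].

Definition open_pairs (X : topologicalType) (K : set (X * X)) : Prop :=
  (forall x y, K (x, y) -> K (y, x)) /\
  exists2 U : set (X * X), open U & K = U `&` distinct_pairs setT.

Definition OCA_T (R : realType) : Prop :=
  forall X : metricType R, separable X ->
  forall K0 : set (X * X), open_pairs K0 ->
  (exists2 Y : set X, ~ countable Y & distinct_pairs Y `<=` K0) \/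
  (exists2 F : nat -> set X, \bigcup_n F n = setT &
     forall n, distinct_pairs (F n) `&` K0 = set0).

Definition has_card_aleph1 (I : Type) : Prop :=
  ~ countable [set: I] /\
  forall (T : Type) (A : set T), ~ countable A -> ([set: I] #<= A)%card.

Section Poset.
Variables (d : Order.disp_t) (P : porderType d).

Definition compatible (p q : P) : Prop := exists r, (r <= p)%O /\ (r <= q)%O.

Definition linked (L : set P) : Prop :=
  forall p q, L p -> L q -> compatible p q.

Definition sigma_linked : Prop :=
  exists2 L : nat -> set P, \bigcup_n L n = setT & forall n, linked (L n).

Definition poset_dense (D : set P) : Prop :=
  forall p, exists2 q, D q & (q <= p)%O.

Definition poset_filter (G : set P) : Prop :=
  [/\ G !=set0,
      forall p q, G p -> (p <= q)%O -> G q &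
      forall p q, G p -> G q -> exists2 r, G r & (r <= p)%O /\ (r <= q)%O].

End Poset.

(* As usual for forcing notions, posets are nonempty: the empty one has no
   filter at all. *)
Definition MA_aleph1_sigma_linked : Prop :=
  forall (d : Order.disp_t) (P : porderType d),
    [set: P] !=set0 -> sigma_linked P ->
  forall I : Type, has_card_aleph1 I ->
  forall D : I -> set P, (forall i, poset_dense (D i)) ->
  exists2 G : set P, poset_filter G & forall i, G `&` D i !=set0.

(* Main.v *)
Require Import Defs.
From HB Require Import structures.
From mathcomp Require Import all_boot all_order all_algebra.
From mathcomp Require Import all_classical all_reals all_analysis.
From mathcomp Require wochoice.

(* Write [F] for a lift of [Phi] and [alpha] for the given automorphism of
   P(N)/Fin.

   Uniformization.  Suppose that local data which conflict only openly are to
   be glued.  By OCA either countably many conflict-free families cover them,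
   which is what we want, or some uncountable family conflicts pairwise.  In
   the latter case OCA, applied to the product with the Cantor space, yields
   an uncountable subfamily in which close members have many conflicts, or
   one in which any two members have exactly the same number of them.  In both
   cases a sigma-linked forcing adds one sequence [c] that exhibits all the
   conflicts of an uncountable subfamily: conflicts arising from distinct
   pairs of close members can be chosen at disjoint locations.  The value of
   the global map at [c] then contradicts the conflicts.

   Automorphisms.  Applying OCA to pairs (z, a), where z is a branch of a tree
   on N and a is a subset of z, one finds a branch on whose subsets [alpha] is
   covered by countably many uniformly continuous functions.  A Baire category
   argument in the group of subsets of the branch turns them into a single
   continuous homomorphism, hence into a point map.  Uniformization applies to
   these local point maps, so [alpha] is induced by an almost injective [f].

   Maps over the identity.  After reindexing along [f], the values F(a)(n) and
   F(b)(n) agree for almost all n with a(n) = b(n).  OCA applied to pairs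
   (a, z), with z a branch of the tree of finite sequences, gives maps h_n on
   the set of immediate successors of some node.  Uniformization glues such
   local lifts when the coordinates are bounded; the general case follows
   from one more use of OCA, as any aleph_1 sequences are bounded modulo
   finite sets. *)

Set Implicit Arguments.
Unset Strict Implicit.
Unset Printing Implicit Defensive.

Import Order.TTheory GRing.Theory Num.Theory.
Local Open Scope classical_set_scope.
Local Open Scope quotient_scope.

(** * The open colouring axiom for coded spaces *)

Lemma uncountable_cover (T : Type) (C : countType) (Y : set T)
    (F : C -> set T) :
  ~ countable Y -> (forall y, Y y -> exists c, F c y) ->
  exists c, ~ countable (Y `&` F c).
Proof.
move=> Yunc YF; apply: contrapT => /forallNP H; apply: Yunc.
have -> : Y = \bigcup_(c in setT) (Y `&` F c).
  apply/seteqP; split=> [y Yy|y [c _ []]//].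
  by have [c Fc] := YF _ Yy; exists c.
apply: bigcup_countable => // c _; exact: contrapT (H c).
Qed.

Lemma uncountable_fiber (T : Type) (C : countType) (Y : set T) (f : T -> C) :
  ~ countable Y -> exists c, ~ countable (Y `&` [set y | f y = c]).
Proof.
by move=> Yunc; apply: (uncountable_cover (F := fun c => [set y | f y = c])) => // y; exists (f y).
Qed.

Lemma uncountable_two (T : Type) (Y : set T) :
  ~ countable Y -> exists x y, [/\ Y x, Y y & x <> y].
Proof.
move=> Yunc; apply: contrapT => H; apply: Yunc.
have [[y Yy]|/forallNP Y0] := pselect (exists y, Y y); last first.
  by have -> : Y = set0 by apply/seteqP; split=> // y /Y0.
apply: (@sub_countable _ _ Y [set y]) => //; apply: subset_card_le => x Yx /=.
by apply: contrapT => xy; apply: H; exists x, y.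
Qed.

(** The pigeonhole behind most contradictions below: [f] typically records a threshold together with
    finitely many values before it. *)
Lemma uncountable_collision (T : Type) (C : countType) (Y : set T)
    (f : T -> C) : ~ countable Y ->
  exists x y, [/\ Y x, Y y, x <> y & f x = f y].
Proof.
move=> /(@uncountable_fiber _ _ _ f)[c /uncountable_two[x [y [[Yx fx] [Yy fy] xy]]]].
by exists x, y; split=> //; rewrite fx fy.
Qed.

Definition agree (T : Type) (m : nat) (x y : nat -> T) : Prop :=
  forall i, (i < m)%N -> x i = y i.

Lemma agree_sym (T : Type) m (x y : nat -> T) : agree m x y -> agree m y x.
Proof. by move=> xy i /xy. Qed.

Lemma agree_trans (T : Type) m (y x z : nat -> T) :
  agree m x y -> agree m y z -> agree m x z.
Proof. by move=> xy yz i im; rewrite xy// yz. Qed.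

Lemma agree_le (T : Type) m n (x y : nat -> T) :
  (m <= n)%N -> agree n x y -> agree m x y.
Proof. by move=> mn xy i im; apply: xy; exact: leq_trans mn. Qed.

Lemma agree_mkseq (T : Type) m (x y : nat -> T) :
  agree m x y <-> mkseq x m = mkseq y m.
Proof.
split=> [xy|xy i im].
  by apply/eq_in_map => i; rewrite mem_iota => /andP[_ /xy].
by have := congr1 (fun s => nth (x 0%N) s i) xy; rewrite !nth_mkseq.
Qed.

Lemma first_difference (T : choiceType) (x y : nat -> T) : x <> y ->
  {d : nat | agree d x y /\ x d <> y d}.
Proof.
move=> xy; apply: cid.
have h : exists n, x n != y n.
  apply: contrapT => /forallNP h; apply: xy; apply/funext => n.
  by apply/eqP; apply: contrapT => /negP; exact: h.
case: (ex_minnP h) => n /eqP xyn nmin; exists n; split=> // i lin.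
by apply/eqP; apply: contrapT => /negP /nmin; rewrite leqNgt lin.
Qed.

Section CodedMetric.
Context (R : realType) (X : Type) (C : countType) (code : X -> nat -> C).
Hypothesis code_inj : injective code.

(** The ultrametric of the sequences over [C], pulled back along [code]; its balls are cylinders. *)
Definition coded_dist (x y : {classic X}) : R :=
  match pselect (code x = code y) with
  | left _ => 0%R
  | right xy => ((projT1 (first_difference xy)).+1%:R^-1)%R
  end.

Lemma coded_dist_lt (x y : X) (m : nat) :
  (coded_dist x y < m.+1%:R^-1)%R <-> agree m.+1 (code x) (code y).
Proof.
rewrite /coded_dist; case: pselect => [->|xy]; first by split=> // _; rewrite invr_gt0 ltr0n.
case: first_difference => d /= [dxy xyd].
rewrite ltf_pV2 ?posrE ?ltr0n// ltr_nat ltnS.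
split=> [md|mxy]; first exact: agree_le dxy.
by rewrite ltnNge; apply/negP => dm; apply: xyd; exact: mxy.
Qed.

Lemma coded_distxx x : coded_dist x x = 0%R.
Proof. by rewrite /coded_dist; case: pselect. Qed.

Lemma coded_dist_eq0 x y : coded_dist x y = 0%R -> x = y.
Proof.
rewrite /coded_dist; case: pselect => [/code_inj//|xy] /eqP.
by rewrite invr_eq0 pnatr_eq0.
Qed.

Lemma coded_dist_ge0 x y : (0 <= coded_dist x y)%R.
Proof. by rewrite /coded_dist; case: pselect => // xy; rewrite invr_ge0 ler0n. Qed.

(** Comparing agreement level by level yields both symmetry and the triangle inequality. *)
Lemma coded_dist_le (x y x' y' : X) :
  (forall m, agree m (code x) (code y) -> agree m (code x') (code y')) ->
  (coded_dist x' y' <= coded_dist x y)%R.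
Proof.
move=> h; rewrite {2}/coded_dist; case: pselect => [xy|xy].
  rewrite /coded_dist; case: pselect => // /[dup] xy' []; apply/funext => n.
  by apply: (h n.+1) => //; rewrite xy.
case: first_difference => -[|d] /= [dxy xyd].
  rewrite invr1 /coded_dist; case: pselect => // ?.
  by rewrite invf_le1 ?ltr0n// ler1n.
rewrite /coded_dist; case: pselect => [_|xy']; first by rewrite invr_ge0 ler0n.
case: first_difference => d' /= [dxy' xyd'].
rewrite lef_pV2 ?posrE ?ltr0n// ler_nat ltnS leqNgt; apply/negP => dd'.
by apply: xyd'; apply: (h d.+1).
Qed.

Lemma coded_dist_sym x y : coded_dist x y = coded_dist y x.
Proof. by apply/eqP; rewrite eq_le !coded_dist_le// => m; exact: agree_sym. Qed.

Lemma coded_dist_triangle y x z :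
  (coded_dist x z <= coded_dist x y + coded_dist y z)%R.
Proof.
have [xy|/ltW xy] := leP (coded_dist x y) (coded_dist y z).
- apply: (@le_trans _ _ (coded_dist y z)); last by rewrite lerDr coded_dist_ge0.
  apply: coded_dist_le => -[//|m] yz; have /coded_dist_lt/(le_lt_trans xy) := yz.
  by move=> /coded_dist_lt /agree_trans; exact.
- apply: (@le_trans _ _ (coded_dist x y)); last by rewrite lerDl coded_dist_ge0.
  apply: coded_dist_le => -[//|m] yz; have /coded_dist_lt/(le_lt_trans xy) := yz.
  by move=> /coded_dist_lt; exact: agree_trans yz.
Qed.

(** [code] may list values of a discontinuous map beside the point itself, so that a colouring which
    reads finitely many of these values becomes open. A countable dense set takes one point for each
    realised initial segment of a code. *)
Lemma oca_coded (oca : OCA_T R) (K : X -> X -> Prop) :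
  (forall x y, K x y -> K y x) ->
  (forall x, ~ K x x) ->
  (forall x y, K x y -> exists m, forall x' y',
     agree m (code x) (code x') -> agree m (code y) (code y') -> K x' y') ->
  (exists2 Y : set X, ~ countable Y &
     forall x y, Y x -> Y y -> x <> y -> K x y) \/
  (exists2 F : nat -> set X, (forall x, exists k, F k x) &
     forall k x y, F k x -> F k y -> ~ K x y).
Proof.
move=> Ksym Kirr Kopen.
pose mX := isMetric.Build R {classic X} coded_distxx coded_dist_eq0
  coded_dist_sym coded_dist_triangle.
pose T : metricType R := HB.pack {classic X} mX.
have ballE (x y : T) m : ball x (m.+1%:R^-1)%R y <-> agree m.+1 (code x) (code y).
  by rewrite ballEmdist; exact: coded_dist_lt.
have nbhs_agree (x : T) (A : set T) : nbhs x A ->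
    exists m, forall y, agree m (code x) (code y) -> A y.
  move=> /nbhs_ballP[e /= e0 xeA].
  have [m me] : exists m : nat, (m.+1%:R^-1 < e)%R.
    by exists (Num.truncn e^-1); rewrite invf_plt ?posrE ?ltr0n// truncnS_gt.
  exists m.+1 => y /ballE xy; apply: xeA; exact: le_ball (ltW me) _ xy.
have agree_nbhs (x : T) m : nbhs x [set y | agree m (code x) (code y)].
  apply/nbhs_ballP; exists (m.+1%:R^-1)%R; first by rewrite /= invr_gt0 ltr0n.
  by move=> y /ballE; exact: agree_le.
have [[x0 _]|X0] := pselect (exists x : X, True); last first.
  by right; exists (fun=> set0) => // x; case: X0; exists x.
have sepT : separable T.
  have /choice[pick pickP] (p : nat * seq C) : exists y : T, forall x : T,
      mkseq (code x) p.1 = p.2 -> mkseq (code y) p.1 = p.2.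
    have [[y py]|yp] := pselect (exists y : T, mkseq (code y) p.1 = p.2).
      by exists y.
    by exists x0 => x xp; case: yp; exists x.
  exists (range pick).
    by apply: (sub_countable (card_image_le _ _)); exact: countableP.
  move=> O [x Ox] oO; have [|m mO] := nbhs_agree x O.
    exact: open_nbhs_nbhs.
  exists (pick (m, mkseq (code x) m)); split; last by exists (m, mkseq (code x) m).
  by apply: mO; apply/agree_mkseq; rewrite (pickP (m, _) x).
have openK : @open_pairs T [set p | K p.1 p.2].
  split=> [x y /=|]; first exact: Ksym.
  exists [set p | K p.1 p.2]; last first.
    apply/seteqP; split=> [[x y] /= Kxy|? []//]; split=> //; split=> //= xy.
    by apply: (Kirr x); rewrite {2}xy.
  rewrite openE => -[x y] /= /Kopen[m mK].
  exists ([set x' | agree m (code x) (code x')],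
          [set y' | agree m (code y) (code y')]); first by split; exact: agree_nbhs.
  by move=> [x' y'] [/= xx' yy']; exact: mK.
have [[Y Yunc YK]|[F FT FK]] := oca T sepT _ openK.
  by left; exists Y => // x y Yx Yy xy; exact: (YK (x, y)).
right; exists F => [x|k x y Fx Fy Kxy].
  by have : [set: T] x by []; rewrite -FT => -[k _ Fkx]; exists k.
suff : (distinct_pairs (F k) `&` [set p | K p.1 p.2]) (x, y) by rewrite FK.
by split=> //; split=> //= xy; apply: (Kirr x); rewrite {2}xy.
Qed.

End CodedMetric.

Lemma oca_on (R : realType) (oca : OCA_T R) (X : Type) (C : countType)
    (code : X -> nat -> C) (Y : set X) (K : X -> X -> Prop) :
  injective code ->
  (forall x y, K x y -> K y x) -> (forall x, ~ K x x) ->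
  (forall x y, K x y -> exists m, forall x' y',
     agree m (code x) (code x') -> agree m (code y) (code y') -> K x' y') ->
  (exists2 Z : set X, Z `<=` Y /\ ~ countable Z &
     forall x y, Z x -> Z y -> x <> y -> K x y) \/
  (exists2 F : nat -> set X, (forall x, Y x -> exists k, F k x) &
     forall k x y, F k x -> F k y -> ~ K x y).
Proof.
move=> code_inj Ksym Kirr Kopen; pose S := {x | Y x}.
have S_inj : injective (sval : S -> X) by move=> [x Yx] [y Yy] /= xy; exact: eq_exist.
have code_inj' : injective (code \o (sval : S -> X)) by move=> x y /code_inj /S_inj.
have [|||[Z Zunc ZK]|[F FT FK]] :=
  @oca_coded R S C (code \o sval) code_inj' oca (fun x y => K (sval x) (sval y)).
- by move=> x y; exact: Ksym.
- by move=> x; exact: Kirr.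
- by move=> x y /Kopen[m mK]; exists m => x' y'; exact: mK.
- left; exists (sval @` Z); last first.
    by move=> _ _ [x Zx <-] [y Zy <-] xy; apply: ZK => // xy'; apply: xy; rewrite xy'.
  split=> [_ [x _ <-]|cZ]; first exact: svalP.
  apply: Zunc; apply: sub_countable cZ.
  by have := inj_card_eq (in2W S_inj : {in Z &, injective _}); rewrite card_eq_sym => /card_eqPle[].
- right; exists (fun k => sval @` F k) => [x Yx|k _ _ [x Fx <-] [y Fy <-]].
    by have [k Fk] := FT (exist _ x Yx); exists k; exists (exist _ x Yx).
  exact: FK Fx Fy.
Qed.

(** * Almost all integers, Baire category *)

Definition almost (P : nat -> Prop) : Prop :=
  exists m, forall n, (m <= n)%N -> P n.

Lemma almost_and (P Q : nat -> Prop) :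
  almost P -> almost Q -> almost (fun n => P n /\ Q n).
Proof.
move=> [m mP] [k kQ]; exists (maxn m k) => n.
by rewrite geq_max => /andP[/mP ? /kQ].
Qed.

Lemma almost_mono (P Q : nat -> Prop) :
  almost P -> (forall n, P n -> Q n) -> almost Q.
Proof. by move=> [m mP] PQ; exists m => n /mP /PQ. Qed.

Lemma almost_ge m : almost (fun n => (m <= n)%N).
Proof. by exists m. Qed.

Lemma notalmostP (P : nat -> Prop) :
  ~ almost P <-> forall m, exists2 n, (m <= n)%N & ~ P n.
Proof.
split=> [nP m|h [m mP]]; last by have [n /mP] := h m.
apply: contrapT => h; apply: nP; exists m => n mn.
by apply: contrapT => Pn; apply: h; exists n.
Qed.

Lemma almostP (P : nat -> Prop) : almost P <-> finite_set [set n | ~ P n].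
Proof.
split=> [[m mP]|fP].
  apply: (@sub_finite_set _ _ `I_m); last exact: finite_II.
  by move=> n /= nP; rewrite ltnNge; apply/negP => /mP.
apply: contrapT => /notalmostP h; have [B Bub] : exists B, forall n, ~ P n -> (n < B)%N.
  move: fP => /finite_seqP[s sE]; exists (\max_(i <- s) i).+1 => n nP; rewrite ltnS.
  apply: (@leq_bigmax_seq _ s xpredT id n) => //.
  by have : [set n | ~ P n] n by []; rewrite sE.
by have [n Bn /Bub] := h B; rewrite ltnNge Bn.
Qed.

Lemma infinite_geP (D : set nat) :
  infinite_set D <-> forall m, exists2 n, (m <= n)%N & D n.
Proof.
have -> : infinite_set D <-> ~ almost (fun n => ~ D n).
  rewrite almostP (_ : [set n | _] = D)//; apply/seteqP; split=> n /=.
    exact: contrapT.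
  by move=> Dn; apply.
by rewrite notalmostP; split=> h m; have [n mn Dn] := h m; exists n => //; exact: contrapT.
Qed.

(** Values are chosen along the enumeration [pickle], each above the previous one. *)
Lemma greedy_injection (C : countType) (D : C -> set nat) :
  (forall c, infinite_set (D c)) ->
  exists2 q : C -> nat, injective q & forall c, D c (q c).
Proof.
move=> Dinf.
have /choice[g gP] (p : nat * nat) : exists n, (p.2 <= n)%N /\
    forall c : C, unpickle p.1 = Some c -> D c n.
  case: unpickle => [c|]; last by exists p.2.
  by have /infinite_geP/(_ p.2)[n pn Dn] := Dinf c; exists n; split=> // _ [<-].
pose e := fix e n := g (n, if n is n'.+1 then (e n').+1 else 0).
have e_lt m n : (m < n)%N -> (e m < e n)%N.
  elim: n => // n IHn; rewrite ltnS leq_eqVlt => mn.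
  have en : (e n < e n.+1)%N by exact: (gP (n.+1, (e n).+1)).1.
  by case/predU1P: mn => [->//|/IHn]; move/ltn_trans; exact.
exists (e \o pickle) => [c c' /= ecc'|c].
  by apply: (pcan_inj pickleK); case: (ltngtP (pickle c) (pickle c')) => // /e_lt;
    rewrite ecc' ltnn.
rewrite /=; case E : (pickle c) => [|n] /=.
  by apply: (gP (0, 0)).2; rewrite /= -E pickleK.
by apply: (gP (n.+1, (e n).+1)).2; rewrite /= -E pickleK.
Qed.

(** Density in a cone, the basic open set of all sequences that agree with [x] below [m]. *)
Definition dense_at (T : Type) (X : set (nat -> T)) (x : nat -> T) (m : nat) :=
  forall y k, agree m x y -> exists2 z, X z & agree k y z.

Lemma dense_at_sub (T : Type) (X : set (nat -> T)) x m y k :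
  dense_at X x m -> (m <= k)%N -> agree m x y -> dense_at X y k.
Proof.
move=> Xx mk xy z l yz; apply: Xx; apply: agree_trans xy _.
exact: agree_le yz.
Qed.

(** Otherwise stems could be lengthened so as to leave the pieces one after another, and their limit
    [z] would lie in no piece. *)
Lemma baire (T : Type) (t0 : T) (C : countType) (X : C -> set (nat -> T)) :
  (forall x, exists c, X c x) -> exists c x m, dense_at (X c) x m.
Proof.
move=> Xcover; apply: contrapT => nodense.
have /choice[f fP] (p : nat * ((nat -> T) * nat)) :
    exists q : (nat -> T) * nat, [/\ (p.2.2 < q.2)%N, agree p.2.2 p.2.1 q.1 &
      forall c z, unpickle p.1 = Some c -> X c z -> ~ agree q.2 q.1 z].
  case: p => n [x m] /=; case: unpickle => [c|]; last by exists (x, m.+1).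
  have [[y [k [xy yk]]]|h] := pselect (exists y k, agree m x y /\
      forall z, X c z -> ~ agree k y z).
    exists (y, maxn k m.+1); split=> //=; first by rewrite leq_maxr.
    move=> _ z [<-] /yk kyz /(agree_le (leq_maxl k m.+1)); exact: kyz.
  case: nodense; exists c, x, m => y k xy; apply: contrapT => yk.
  by apply: h; exists y, k; split=> // z Xz yz; apply: yk; exists z.
pose a := fix a n := if n is n'.+1 then f (n', a n') else ((fun=> t0) , 0).
pose z i := (a i.+1).1 i.
have am n : (n <= (a n).2)%N.
  by elim: n => // n IHn; have [/= + _ _] := fP (n, a n); exact: leq_ltn_trans.
have aa n k : agree (a n).2 (a n).1 (a (n + k)%N).1 /\ ((a n).2 <= (a (n + k)%N).2)%N.
  elim: k => [|k [IHk1 IHk2]]; first by rewrite addn0.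
  have [/= lt ag _] := fP ((n + k)%N, a (n + k)%N); rewrite addnS; split=> /=.
    by apply: agree_trans IHk1 _; exact: agree_le ag.
  by apply: leq_trans IHk2 _; exact: ltnW.
have az n : agree (a n).2 (a n).1 z.
  move=> i ilt; rewrite /z; case: (leqP n i.+1) => [ni|/ltnW ni].
    by rewrite -(subnKC ni); apply: (aa n _).1.
  by rewrite -(subnKC ni); apply/esym; apply: (aa i.+1 _).1; exact: am.
have [c Xz] := Xcover z.
have [_ _ /(_ c z)] := fP (pickle c, a (pickle c)).
by rewrite /= pickleK => /(_ erefl Xz); apply; exact: (az (pickle c).+1).
Qed.

(** Some piece is nonmeager in every subcone of one cone. Otherwise, for every piece, every stem has
    a subcone in which the piece is covered by countably many nowhere dense sets. These sets,
    together with the rest of each piece outside the dense union of its subcones, would contradict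
    [baire]. *)
Lemma baire_nonmeager (T : countType) (t0 : T) (C D : countType)
    (X : C -> set (nat -> T)) : (forall x, exists c, X c x) ->
  exists c x m, forall y k, (m <= k)%N -> agree m x y ->
    forall W : D -> set (nat -> T),
      (forall z, X c z -> agree k y z -> exists d, W d z) ->
    exists d z l, [/\ (k <= l)%N, agree k y z & dense_at (W d) z l].
Proof.
move=> Xcover; apply: contrapT => H.
pose ofs (s : seq T) : nat -> T := nth t0 s.
have /choice[w wP] (p : C * seq T) : exists w : (nat -> T) * nat * (D -> set (nat -> T)),
    [/\ (size p.2 <= w.1.2)%N, agree (size p.2) (ofs p.2) w.1.1,
      forall z, X p.1 z -> agree w.1.2 w.1.1 z -> exists d, w.2 d z &
      forall d z l, (w.1.2 <= l)%N -> agree w.1.2 w.1.1 z ->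
        ~ dense_at (w.2 d) z l].
  apply: contrapT => /forallNP Hw; apply: H; exists p.1, (ofs p.2), (size p.2).
  move=> y k sk sy W WX; apply: contrapT => Wd; apply: (Hw (y, k, W)); split=> //=.
  by move=> d z l kl yz Wz; apply: Wd; exists d, z, l.
pose V (e : C * option (seq T * D)) : set (nat -> T) := fun z =>
  if e.2 is Some (s, d)
  then agree (w (e.1, s)).1.2 (w (e.1, s)).1.1 z /\ (w (e.1, s)).2 d z
  else X e.1 z /\ forall s, ~ agree (w (e.1, s)).1.2 (w (e.1, s)).1.1 z.
have [z|[c [[s d]|]] [x [m Vx]]] := @baire T t0 _ V.
- have [c Xz] := Xcover z.
  have [[s sz]|/forallNP sz] :=
      pselect (exists s, agree (w (c, s)).1.2 (w (c, s)).1.1 z); last first.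
    by exists (c, None).
  have [_ _ /(_ z Xz sz)[d wz] _] := wP (c, s).
  by exists (c, Some (s, d)).
- have [z [/= sz wz] xz] := Vx x m (fun i _ => erefl).
  have [_ _ _ /= nd] := wP (c, s).
  apply: (nd d z (maxn m (w (c, s)).1.2)) => //; first exact: leq_maxr.
  move=> y k zy; have [|z' [/= _ wz'] yz'] := Vx y k; last by exists z'.
  by apply: agree_trans xz _; apply: agree_le zy; exact: leq_maxl.
- have [sm sx _ _] := wP (c, mkseq x m).
  have [|z [/= _ /(_ (mkseq x m)) nz] yz] :=
    Vx (w (c, mkseq x m)).1.1 (w (c, mkseq x m)).1.2.
    move=> i im; rewrite -sx /= ?size_mkseq//.
    by rewrite /ofs nth_mkseq.
  exact: nz.
Qed.

(** * The first uncountable cardinal, Martin's axiom for preorders *)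

Lemma injective_card_le (T U : Type) (A : set T) (B : set U) (f : T -> U) :
  {in A &, injective f} -> (forall x, A x -> B (f x)) -> (A #<= B)%card.
Proof.
move=> /inj_card_eq finj fAB; move: finj; rewrite card_eq_sym => /card_eqPle[AfA _].
apply: card_le_trans AfA _; apply: subset_card_le => _ [x Ax <-]; exact: fAB.
Qed.

Lemma uncountable_cantor : ~ countable [set: nat -> bool].
Proof.
move=> /countable_injP[f finj].
have {}finj (x y : nat -> bool) : f x = f y -> x = y.
  by apply: finj; rewrite inE.
pose g n := xget (fun=> false) [set x | f x = n].
have gf x : g (f x) = x.
  by apply: finj; exact: (@xgetI _ (fun=> false) [set y | f y = f x] x).
pose d n := ~~ g n n.
have := congr1 (fun x => x (f d)) (gf d).
by rewrite {3}/d; case: (g _ _).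
Qed.

(* [I] carries the order type of the first uncountable ordinal. *)
Lemma aleph1_exists : exists (I : Type) (le : I -> I -> Prop),
  [/\ has_card_aleph1 I, forall i j, le i j \/ le j i &
      forall i, countable [set j | le j i]].
Proof.
pose T := {classic (nat -> bool)}.
have [Rel wo] := wochoice.well_ordering_principle T.
have min (A : set T) : A !=set0 -> exists2 z, A z & forall x, A x -> Rel z x.
  move=> [a Aa]; have [|z [[zA zmin] _]] := wo [pred x | `[< A x >]].
    by exists a; exact/asboolP.
  by exists z => [|x Ax]; [exact/asboolP|apply: zmin; exact/asboolP].
have total x y : Rel x y \/ Rel y x.
  have [|z zxy zmin] := min [set x; y]; first by exists x; left.
  by move: zxy zmin => [->|->] zmin; [left|right]; apply: zmin; [right|left].
have anti x y : Rel x y -> Rel y x -> x = y.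
  move=> xy yx; have refl z : Rel z z by case: (total z z).
  have [|z [_ zuniq]] := wo [pred t | (t == x) || (t == y)].
    by exists x; rewrite inE eqxx.
  have zx : z = x.
    by apply: zuniq; split=> [|t]; rewrite inE ?eqxx// => /orP[] /eqP ->.
  have zy : z = y.
    by apply: zuniq; split=> [|t]; rewrite inE ?eqxx ?orbT// => /orP[] /eqP ->.
  by rewrite -zx zy.
have trans y x z : Rel x y -> Rel y z -> Rel x z.
  move=> xy yz; have [|m mxyz mmin] := min [set x; y; z]; first by exists x; left; left.
  have mx : Rel m x by apply: mmin; left; left.
  have my : Rel m y by apply: mmin; left; right.
  have mz : Rel m z by apply: mmin; right.
  case: mxyz => [[mE|mE]|mE]; first by rewrite -mE.
    by rewrite (anti x y)// -mE.
  by rewrite -(anti y z yz) // -mE.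
have wf (P : T -> Prop) :
    (forall x, (forall y, ~ Rel x y -> P y) -> P x) -> forall x, P x.
  move=> IH; apply: contrapT => /existsNP[x Px].
  have [z Pz zmin] := min [set x | ~ P x] (ex_intro _ x Px).
  by apply: Pz; apply: IH => y yz; apply: contrapT => /zmin.
(* The points with countably many predecessors; were there only countably many, the least point
   outside [S] would belong to [S]. *)
pose S : set T := [set x | countable [set y | Rel y x]].
have Sunc : ~ countable S.
  move=> Sc; apply: uncountable_cantor.
  have [[x Sx]|/forallNP ST] := pselect (exists x, ~ S x); last first.
    by apply: sub_countable Sc; apply: subset_card_le => x _; exact: contrapT (ST x).
  have [z Sz zmin] := min [set x | ~ S x] (ex_intro _ x Sx).
  case: Sz; apply: (@sub_countable _ _ _ (S `|` [set z])).
    apply: subset_card_le => y /= yz; have [Sy|Sy] := pselect (S y); first by left.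
    by right; apply: anti yz _; exact: zmin.
  rewrite -bigcup2E; apply: bigcup_countable => // -[|[|i]] _.
  - exact: Sc.
  - exact: countable1.
  - exact: countable0.
pose I := {x : T | S x}; pose le (i j : I) := is_true (Rel (sval i) (sval j)).
exists I, le; split=> [|i j|i]; last 2 first.
- exact: total.
- apply: sub_countable (svalP i); apply: (injective_card_le (f := sval)) => //.
  by move=> [x Sx] [y Sy] _ _ /= xy; exact: eq_exist.
have Iunc : ~ countable [set: I].
  move=> Ic; apply: Sunc; apply: sub_countable Ic.
  apply: (card_le_trans (B := sval @` [set: I])); last exact: card_image_le.
  apply: subset_card_le => x Sx.
  by exists (exist (fun x => S x) x Sx).
split=> // U A Aunc.
have [a0 Aa0] : A !=set0.
  by apply/set0P/eqP => A0; apply: Aunc; rewrite A0.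
have pick (x : T) (p : T -> {classic U}) : S x ->
    exists a, A a /\ forall y, ~ Rel x y -> p y <> a.
  move=> Sx; apply: contrapT => /forallNP h; apply: Aunc.
  apply: sub_countable Sx; apply: (@card_le_trans _ _ _ (p @` [set y | Rel y x])).
    apply: subset_card_le => a Aa; apply: contrapT => pa; apply: (h a); split=> // y xy ya.
    by apply: pa; exists y => //=; case: (total x y).
  exact: card_image_le.
have wfR : well_founded (fun y x => ~ Rel x y).
  by move=> x; elim/wf: x => x IH; constructor.
(* Transfinite recursion for an injection into [A]: at a point [x] of [S] take a member of [A] not
   taken below [x], which exists because [x] has countably many predecessors. *)
pose step (x : T) (rec : forall y, ~ Rel x y -> {classic U}) : {classic U} :=
  xget (a0 : {classic U}) [set a : {classic U} | A a /\ forall y xy, rec y xy <> a].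
pose phi := Fix wfR _ step.
have phiE x : phi x = step x (fun y _ => phi y).
  rewrite /phi Fix_eq// => y p p' pp'; congr (step y _).
  by apply: functional_extensionality_dep => z; apply/funext => ?; exact: pp'.
have phiP x : S x -> A (phi x) /\ forall y, ~ Rel x y -> phi y <> phi x.
  move=> Sx; have [a aP] := pick x phi Sx.
  by rewrite phiE /step; case: xgetP => [b _ //|/(_ a)]; case.
apply: (injective_card_le (f := phi \o sval)) => [[x Sx] [y Sy] _ _ /= xy|[x Sx] _].
  apply: eq_exist; apply: contrapT => neq; have [xy'|yx'] := total x y.
    by apply: ((phiP y Sy).2 x) => // yx; apply: neq; exact: anti.
  by apply: ((phiP x Sx).2 y) => // yx; apply: neq; exact: anti.
by case: (phiP x Sx).
Qed.

(** Martin's axiom speaks of partial orders. Replacing [p] by its lower cone [down p] makes the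
    order antisymmetric, and inclusion still reflects [le]. *)
Lemma ma_preorder (ma : MA_aleph1_sigma_linked) (P : Type)
    (le : P -> P -> Prop) (C : countType) (L : C -> set P) (I : Type)
    (D : I -> set P) :
  (forall p, le p p) -> (forall q p r, le p q -> le q r -> le p r) ->
  (exists p : P, True) -> (forall p, exists c, L c p) ->
  (forall c p q, L c p -> L c q -> exists2 r, le r p & le r q) ->
  has_card_aleph1 I -> (forall i p, exists2 q, D i q & le q p) ->
  exists2 G : set P,
    forall p q, G p -> G q -> exists2 r, G r & le r p /\ le r q &
    forall i, exists2 p, G p & D i p.
Proof.
move=> le_refl le_trans [p0 _] Lcover Llinked hI Ddense.
pose down p : set P := [set q | le q p].
pose Q := {A : set P | exists p, A = down p}.
pose dn p : Q := exist _ (down p) (ex_intro _ p erefl).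
pose leQ (x y : {classic Q}) : bool := `[< sval x `<=` sval y >].
have leQP p q : leQ (dn p) (dn q) <-> le p q.
  split=> [/asboolP|pq]; first by apply; exact: le_refl.
  by apply/asboolP => r /= rp; exact: le_trans pq.
have dnP (x : Q) : exists p, x = dn p.
  by case: x => A [p Ap]; exists p; exact: eq_exist.
have leQ_refl : reflexive leQ by move=> x; exact/asboolP.
have leQ_anti : antisymmetric leQ.
  by move=> [A Ap] [B Bp] /andP[/asboolP /= AB /asboolP /= BA]; apply/eq_exist/seteqP.
have leQ_trans : transitive leQ.
  by move=> x y z /asboolP yx /asboolP xz; apply/asboolP; exact: subset_trans xz.
pose mQ := Order.Le_isPOrder.Build (Order.Disp tt tt) {classic Q}
  leQ_refl leQ_anti leQ_trans.
pose T : porderType (Order.Disp tt tt) := HB.pack {classic Q} mQ.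
have leTP p q : ((dn p : T) <= dn q)%O <-> le p q := leQP p q.
have sl : sigma_linked T.
  exists (fun n => [set x : T | exists c p, [/\ unpickle n = Some c, L c p & x = dn p]]).
    apply/seteqP; split=> // x _; have [p ->] := dnP x; have [c Lp] := Lcover p.
    by exists (pickle c) => //; exists c, p; rewrite pickleK.
  move=> n x y [c [p [nc Lp ->]]] [c' [q [nc' Lq ->]]].
  have [r rp rq] : exists2 r, le r p & le r q.
    by apply: (Llinked c) => //; move: nc'; rewrite nc => -[->].
  by exists (dn r); split; apply/leTP.
have dense i : poset_dense [set x : T | exists2 p, D i p & x = dn p].
  move=> x; have [p ->] := dnP x; have [q Dq qp] := Ddense i p.
  by exists (dn q); [exists q|apply/leTP].
have [|G [_ _ Gdir] GD] := ma _ T _ sl _ hI _ dense.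
  by exists (dn p0).
exists [set p | G (dn p)] => [p q Gp Gq|i].
  have [x Gx [xp xq]] := Gdir _ _ Gp Gq; have [r xr] := dnP x.
  by exists r; rewrite /= -?xr// -!leTP -xr.
by have [x [Gx [p Dp xp]]] := GD i; exists p => //=; rewrite -xp.
Qed.

(** * Forcing an uncountable homogeneous set *)

Lemma card_le_injective (J U : Type) (Y : set U) : ([set: J] #<= Y)%card ->
  exists2 phi : J -> U, injective phi & forall i, Y (phi i).
Proof.
move=> /card_leP[f]; exists (fun i => val (f (to_setT i))) => [i j|i].
  move=> /val_inj /(@inj _ _ _ f) ij.
  by have /(congr1 val) : to_setT i = to_setT j by apply: ij; rewrite inE.
exact: set_valP.
Qed.

Definition same_codes (W : Type) (C : countType) (code : W -> nat -> C) (l : nat)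
    (vs ws : seq W) : Prop :=
  map (fun w => mkseq (code w) l) vs = map (fun w => mkseq (code w) l) ws.

Section Forcing.
Context (W : choiceType) (C : countType) (code : W -> nat -> C) (Y : set W).
Context (Good : (nat -> nat) -> W -> W -> Prop).

Definition good_open : Prop := forall c w w', Good c w w' ->
  exists m, forall c' v v', agree m c c' ->
    agree m (code w) (code v) -> agree m (code w') (code v') -> Good c' v v'.

(** What remains to be done when two conditions with equal finite data are merged: pairs at
    different positions are decided already, so only pairs at equal positions need care. *)
Definition good_amalgam : Prop := forall (ws : seq W) (c : nat -> nat) L,
  uniq ws -> (forall w, w \in ws -> Y w) ->
  exists l, forall vs vs', same_codes code l vs ws -> same_codes code l vs' ws ->
    (forall v, v \in vs ++ vs' -> Y v) ->
  exists2 c', agree L c c' & forall v v', (v, v') \in zip vs vs' ->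
    v <> v' -> Good c' v v'.

(** Goodness has to survive a change of [c] from [L] on and a small change of the two points; the
    latter lets a condition swap members for close ones. *)
Definition decided (c : nat -> nat) (L : nat) (w w' : W) : Prop :=
  exists l, forall c' v v', agree L c c' -> agree l (code w) (code v) ->
    agree l (code w') (code v') -> Good c' v v'.

Lemma decided_le c L c' L' w w' :
  (L <= L')%N -> agree L c c' -> decided c L w w' -> decided c' L' w w'.
Proof.
move=> LL' cc' [l H]; exists l => d v v' cd; apply: H.
by apply: agree_trans cc' _; exact: agree_le cd.
Qed.

Lemma good_decided (Gopen : good_open) c w w' : Good c w w' ->
  exists L, decided c L w w'.
Proof. by move=> /Gopen[m H]; exists m, m. Qed.

Definition valid_condition (p : (nat -> nat) * nat * seq W) : Prop :=
  [/\ uniq p.2, p.2 != [::], forall w, w \in p.2 -> Y w &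
      forall w w', w \in p.2 -> w' \in p.2 -> w <> w' -> decided p.1.1 p.1.2 w w'].

Definition condition : Type := {p | valid_condition p}.

Definition condition_le (q p : condition) : Prop :=
  [/\ ((sval p).1.2 <= (sval q).1.2)%N, agree (sval p).1.2 (sval p).1.1 (sval q).1.1 &
      {subset (sval p).2 <= (sval q).2}].

Lemma condition_le_refl p : condition_le p p.
Proof. by split. Qed.

Lemma condition_le_trans q p r :
  condition_le p q -> condition_le q r -> condition_le p r.
Proof.
move=> [qp cqp Hqp] [rq crq Hrq]; split; first exact: leq_trans qp.
  by apply: agree_trans crq _; exact: agree_le cqp.
by move=> w /Hrq /Hqp.
Qed.

(* A condition together with a precision [l] such that two conditions with
   the same data up to [l] are compatible. *)
Definition condition_class (d : seq nat * nat * seq (seq C)) : set condition :=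
  fun p => let: (c, L, ws) := sval p in
  [/\ mkseq c L = d.1.1, [seq mkseq (code w) d.1.2 | w <- ws] = d.2,
      forall w w' v v', w \in ws -> w' \in ws -> w <> w' ->
        agree d.1.2 (code w) (code v) -> agree d.1.2 (code w') (code v') ->
        decided c L v v' &
      forall vs vs', same_codes code d.1.2 vs ws -> same_codes code d.1.2 vs' ws ->
        (forall v, v \in vs ++ vs' -> Y v) ->
      exists2 c', agree L c c' & forall v v', (v, v') \in zip vs vs' ->
        v <> v' -> Good c' v v'].

Lemma condition_class_cover (Gamalgam : good_amalgam) p :
  exists d, condition_class d p.
Proof.
case: p => -[[c L] ws] v; case: (v) => /= ws_uniq ws0 wsY ws_dec.
have [l0 l0P] := Gamalgam ws c L ws_uniq wsY.
have /choice[l1 l1P] (q : W * W) : exists l, q.1 \in ws -> q.2 \in ws -> q.1 <> q.2 ->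
    forall c' v v', agree L c c' -> agree l (code q.1) (code v) ->
    agree l (code q.2) (code v') -> Good c' v v'.
  have [[q1 q2 q12]|nq] := pselect [/\ q.1 \in ws, q.2 \in ws & q.1 <> q.2].
    by have [l lP] := ws_dec _ _ q1 q2 q12; exists l.
  by exists 0 => ? ? ?; case: nq.
pose l := maxn l0 (\max_(q <- allpairs pair ws ws) l1 q).
exists (mkseq c L, l, [seq mkseq (code w) l | w <- ws]); split=> //=.
  move=> w w' u u' ws_w ws_w' ww' wu wu'.
  have ll : (l1 (w, w') <= l)%N.
    rewrite leq_max; apply/orP; right; apply: leq_bigmax_seq => //.
    by apply/allpairsP; exists (w, w').
  exists (l1 (w, w')) => c' t t' cc' ut ut'.
  apply: (l1P (w, w')) => //=; first exact: agree_trans (agree_le ll wu) ut.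
  exact: agree_trans (agree_le ll wu') ut'.
have sim us : same_codes code l us ws -> same_codes code l0 us ws.
  move=> /(congr1 (map (take l0))); rewrite -!map_comp /same_codes.
  have tk u : take l0 (mkseq (code u) l) = mkseq (code u) l0.
    by rewrite /mkseq -map_take take_iota; have /minn_idPl -> : (l0 <= l)%N by exact: leq_maxl.
  by under eq_map do rewrite /= tk; under [RHS]eq_map do rewrite /= tk.
by move=> vs vs' /sim vsw /sim vsw'; exact: l0P.
Qed.

Lemma decided_sym (Gsym : forall c w w', Good c w w' -> Good c w' w) c L w w' :
  decided c L w w' -> decided c L w' w.
Proof. by move=> [l H]; exists l => d v v' cd wv wv'; apply/Gsym/H. Qed.

(** Amalgamation makes the pairs at equal positions good for an extension [c'], and openness decides
    them at a longer length [L']. Pairs at different positions are decided because each entry of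
    [ws1] is close to the corresponding entry of [ws]. *)
Lemma condition_class_linked (Gopen : good_open)
    (Gsym : forall c w w', Good c w w' -> Good c w' w) d p q :
  condition_class d p -> condition_class d q ->
  exists2 r, condition_le r p & condition_le r q.
Proof.
move: p q => [[[c L] ws] v] [[[c1 L1] ws1] v1].
have [/= us ws0 wsY ws_dec] := v; have [/= us1 _ wsY1 ws_dec1] := v1.
rewrite /condition_class /= => -[cd wsd cross am] [cd1 wsd1 _ _].
have sz : size ws1 = size ws.
  by have /(congr1 size) := etrans wsd1 (esym wsd); rewrite !size_map.
have L1E : L1 = L by have /(congr1 size) := etrans cd1 (esym cd); rewrite !size_mkseq.
subst L1; have cc1 : agree L c c1 by apply/agree_mkseq; rewrite cd cd1.
have wsim : same_codes code d.1.2 ws1 ws by rewrite /same_codes wsd wsd1.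
have [//|//||c' cc' c'P] := am ws ws1.
  by move=> w; rewrite mem_cat => /orP[/wsY|/wsY1].
have /choice[L2 L2P] (x : W * W) : exists L2, x \in zip ws ws1 -> x.1 <> x.2 ->
    decided c' L2 x.1 x.2.
  have [[xz x12]|nx] := pselect (x \in zip ws ws1 /\ x.1 <> x.2).
    have [|L2 L2P] := @good_decided Gopen c' x.1 x.2.
      by apply: c'P => //; case: x xz {x12}.
    by exists L2.
  by exists 0 => ? ?; case: nx.
pose L' := maxn L (\max_(x <- zip ws ws1) L2 x).
have LL' : (L <= L')%N by exact: leq_maxl.
have cross1 w w' : w \in ws -> w' \in ws1 -> w <> w' -> decided c' L' w w'.
  move=> wws w'ws1 ww'; set i := index w ws; set j := index w' ws1.
  have il : (i < size ws)%N by rewrite index_mem.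
  have jl : (j < size ws)%N by rewrite -sz index_mem.
  have wi : nth w ws i = w by rewrite nth_index.
  have wj : nth w ws1 j = w' by rewrite nth_index.
  have [ij|ij] := eqVneq i j.
    have wzip : (w, w') \in zip ws ws1.
      by rewrite -[w in (w, _)]wi -wj -ij -nth_zip// mem_nth// size_zip sz minnn.
    apply: decided_le (L2P _ wzip ww') => //.
    rewrite leq_max; apply/orP; right.
    by apply: (@leq_bigmax_seq _ _ xpredT L2).
  apply: (decided_le LL' cc'); apply: (cross w (nth w ws j)) => //.
  - exact: mem_nth.
  - by move=> wE; move/eqP: ij; apply; apply/eqP; rewrite -(nth_uniq w il jl us) wi -wE.
  - apply/agree_mkseq; move: wsim => /(congr1 (fun t => nth [::] t j)).
    by rewrite !(nth_map w) ?sz// wj => ->.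
have rP : valid_condition (c', L', undup (ws ++ ws1)).
  split=> /=.
  - exact: undup_uniq.
  - case: ws ws0 {us wsY ws_dec wsd cross am v sz wsim c'P L2P L' LL' cross1} => // w t _.
    by apply/eqP => h; have : w \in undup ((w :: t) ++ ws1);
      [rewrite mem_undup mem_head|rewrite h].
  - by move=> w; rewrite mem_undup mem_cat => /orP[/wsY|/wsY1].
  - move=> w w'; rewrite !mem_undup !mem_cat => /orP[w0|w1] /orP[w0'|w1'] ww'.
    + exact: (decided_le LL' cc') (ws_dec _ _ w0 w0' ww').
    + exact: cross1.
    + by apply: (decided_sym Gsym); apply: cross1 => // /esym.
    + apply: decided_le (ws_dec1 _ _ w1 w1' ww') => //.
      exact: agree_trans (agree_sym cc1) cc'.
exists (exist _ (c', L', undup (ws ++ ws1)) rP); split=> //=.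
- by move=> w w0; rewrite mem_undup mem_cat w0.
- exact: agree_trans (agree_sym cc1) cc'.
- by move=> w w0; rewrite mem_undup mem_cat w0 orbT.
Qed.

End Forcing.

Lemma countableU (T : Type) (A B : set T) :
  countable A -> countable B -> countable (A `|` B).
Proof.
move=> cA cB; rewrite -bigcup2E; apply: bigcup_countable => // -[|[|i]] _.
- exact: cA.
- exact: cB.
- exact: countable0.
Qed.

(** There are countably many cylinders, and those that meet [Y] in a countable set contribute
    countably many points each. *)
Lemma isolated_countable (J : Type) (C : countType) (code : J -> nat -> C)
    (Y : set J) : countable [set j | Y j /\
      exists n, countable (Y `&` [set k | agree n (code j) (code k)])].
Proof.
pose K (p : nat * seq C) := [set j | [/\ Y j, mkseq (code j) p.1 = p.2 &
  countable (Y `&` [set k | agree p.1 (code j) (code k)])]].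
apply: (@sub_countable _ _ _ (\bigcup_(p in setT) K p)).
  apply: subset_card_le => j [Yj [n jn]].
  by exists (n, mkseq (code j) n).
apply: bigcup_countable => // -[n s] _.
have [[j [_ js jn]]|/forallNP h] := pselect (exists j, K (n, s) j); last first.
  by have -> : K (n, s) = set0 by apply/seteqP; split=> // j /h.
apply: sub_countable jn; apply: subset_card_le => k [Yk ks _]; split=> //.
by apply/agree_mkseq; rewrite js ks.
Qed.

(** Conditions hold a finite part of [c] and finitely many members of the set to be built. The
    points indexed by [K] are discarded so that a member can be swapped for a close one of
    arbitrarily large index; this gives density, hence a set with unbounded indices. *)
Lemma force (ma : MA_aleph1_sigma_linked) (W : choiceType) (C : countType)
    (code : W -> nat -> C) (Y : set W) (Good : (nat -> nat) -> W -> W -> Prop) :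
  ~ countable Y -> good_open code Good -> good_amalgam code Y Good ->
  (forall c w w', Good c w w' -> Good c w' w) ->
  exists c, exists2 Z : set W, Z `<=` Y /\ ~ countable Z &
    forall w w', Z w -> Z w' -> w <> w' -> Good c w w'.
Proof.
move=> Yunc Gopen Gam Gsym.
have [I [le [hI le_total le_count]]] := aleph1_exists.
have [phi phi_inj phiY] := card_le_injective (hI.2 _ _ Yunc).
pose K := [set j | setT j /\ exists n,
  countable (setT `&` [set k | agree n (code (phi j)) (code (phi k))])].
have Kc : countable K by exact: isolated_countable.
have near j n i : ~ K j ->
    exists k, [/\ ~ K k, agree n (code (phi j)) (code (phi k)) & ~ le k i].
  move=> Kj; apply: contrapT => h; apply: Kj; split=> //; exists n.
  apply: sub_countable (countableU Kc (le_count i)); apply: subset_card_le => k [_ jk].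
  have [Kk|Kk] := pselect (K k); first by left.
  by right; apply: contrapT => ki; apply: h; exists k.
pose Y1 := [set w | exists2 j, ~ K j & w = phi j].
have Y1Y : Y1 `<=` Y by move=> _ [j _ ->].
have Gam1 : good_amalgam code Y1 Good.
  move=> ws c L us wsY1; have [|l lP] := Gam ws c L us.
    by move=> w /wsY1 /Y1Y.
  by exists l => vs vs' vw vw' vY1; apply: lP => // v /vY1 /Y1Y.
pose P := condition code Y1 Good.
pose D i : set P := fun p => exists j, ~ le j i /\ phi j \in (sval p).2.
have Ddense i p : exists2 q, D i q & condition_le q p.
  have [[[s l] cs] dp] := condition_class_cover Gam1 p.
  (* Two conditions of the same class are compatible, so it suffices to meet [D i] inside the class
     of [p]. *)
  suff [q Dq dq] : exists2 q, D i q & condition_class (s, l, cs) q.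
    have [r rp rq] := condition_class_linked Gopen Gsym dp dq.
    exists r => //; have [j [ji jq]] := Dq; exists j; split=> //.
    by case: rq => _ _; exact.
  move: p dp => [[[c L] ws] v]; have [/= us ws0 wsY1 ws_dec] := v.
  case: ws v us ws0 wsY1 ws_dec => // w0 ws v /= /andP[w0ws us] _ wsY1 ws_dec.
  rewrite {1}/condition_class /= => -[sE csE cross am].
  have [j0 Kj0 w0E] := wsY1 w0 (mem_head _ _).
  have [j [Kj j0j ji]] := near j0 l i Kj0; rewrite -w0E in j0j.
  (* The first member [w0] is replaced by the nearby [phi j], unless the latter already occurs among
     the other members. *)
  have [jws|jws] := boolP (phi j \in ws).
    exists (exist _ (c, L, w0 :: ws) v) => //.
    by exists j; split=> //=; rewrite inE jws orbT.
  have vq : valid_condition code Y1 Good (c, L, phi j :: ws).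
    split=> //=; first by rewrite jws.
      by move=> w; rewrite inE => /predU1P[->|wws]; [exists j|apply: wsY1; rewrite inE wws orbT].
    have jdec w : w \in ws -> decided code Good c L (phi j) w.
      move=> wws; apply: (cross w0 w) => //; first exact: mem_head.
        by rewrite inE wws orbT.
      by move=> w0w; move: w0ws; rewrite w0w wws.
    move=> w w'; rewrite !inE => /predU1P[->|wws] /predU1P[->|wws'] ww' //.
    - exact: jdec.
    - by apply: (decided_sym Gsym); exact: jdec.
    - by apply: ws_dec; rewrite ?inE ?wws ?wws' ?orbT.
  exists (exist _ _ vq); first by exists j; split=> //=; rewrite mem_head.
  have codej : mkseq (code (phi j)) l = mkseq (code w0) l.
    by apply/esym/agree_mkseq.
  rewrite /condition_class /=; split=> //.
  - by rewrite /= codej.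
  - pose back w := if w == phi j then w0 else w.
    have backP w : w \in phi j :: ws -> back w \in w0 :: ws /\
        agree l (code (back w)) (code w).
      rewrite /back !inE; case: eqP => /= [->|_ ->]; first by rewrite eqxx.
      by rewrite orbT.
    move=> w w' u u' /[dup] wq /backP[bw bw_ag] /[dup] wq' /backP[bw' bw_ag'] ww' wu wu'.
    apply: (cross (back w) (back w')) => //.
    + rewrite /back; case: eqP => [wj|wj]; case: eqP => [wj'|wj'] //.
      * by rewrite wj wj' in ww'.
      * by move=> w0w'; move: wq'; rewrite -w0w' inE (negPf w0ws) orbF => /eqP; rewrite w0w'.
      * by move=> w0w; move: wq; rewrite w0w inE (negPf w0ws) orbF -w0w => /eqP.
    + exact: agree_trans bw_ag wu.
    + exact: agree_trans bw_ag' wu'.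
  - have sim vs : same_codes code l vs (phi j :: ws) -> same_codes code l vs (w0 :: ws).
      by rewrite /same_codes /= codej.
    by move=> vs vs' /sim vw /sim vw'; exact: am.
have Iunc : ~ countable [set: I] by exact: hI.1.
have [j0 Kj0] : exists j, ~ K j.
  apply: contrapT => /forallNP h; apply: Iunc; apply: sub_countable Kc.
  by apply: subset_card_le => j _; exact: contrapT (h j).
have p0 : exists p : P, True.
  have v0 : valid_condition code Y1 Good ((fun=> 0), 0, [:: phi j0]).
    split=> //= [w|w w']; rewrite !inE => /eqP ->; first by exists j0.
    by move=> /eqP ->.
  by exists (exist _ _ v0).
have [G Gdir GD] := ma_preorder ma (@condition_le_refl _ _ _ _ _)
  (@condition_le_trans _ _ _ _ _) p0 (condition_class_cover Gam1)
  (condition_class_linked Gopen Gsym) hI Ddense.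
(* The filter is directed, so its finite parts of [c] fit together; a coordinate that no condition
   reaches gets the value 0. *)
have /choice[c cP] (n : nat) : exists v, forall p, G p ->
    (n < (sval p).1.2)%N -> (sval p).1.1 n = v.
  have [[p [Gp pn]]|h] := pselect (exists p, G p /\ (n < (sval p).1.2)%N); last first.
    by exists 0 => p Gp pn; case: h; exists p.
  exists ((sval p).1.1 n) => q Gq qn; have [r _ [[_ rp _] [_ rq _]]] := Gdir p q Gp Gq.
  by rewrite rp// rq.
exists c, [set w | exists2 p, G p & w \in (sval p).2]; last first.
  move=> w w' [p Gp wp] [q Gq wq] ww'; have [r Gr [[_ _ rp] [_ _ rq]]] := Gdir p q Gp Gq.
  have [_ _ _ rdec] := svalP r; have [l] := rdec _ _ (rp _ wp) (rq _ wq) ww'.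
  by apply=> // n nr; exact: cP.
split=> [w [p _ wp]|Zc]; first by have [_ _ pY _] := svalP p; exact/Y1Y/pY.
(* The indices of the members are cofinal in [I], whose initial segments are countable; countably
   many members would make [I] countable. *)
apply: Iunc.
have -> : [set: I] = \bigcup_(j in [set j | exists2 p, G p & phi j \in (sval p).2])
    [set i | le i j].
  apply/seteqP; split=> // i _; have [p Gp [j [ji jp]]] := GD i.
  by exists j; [exists p|case: (le_total i j)].
apply: bigcup_countable => [|j _]; last exact: le_count.
apply: sub_countable Zc; apply: (injective_card_le (f := phi)) => // j k _ _.
exact: phi_inj.
Qed.

(** * Uniformization of local data *)

Definition satisfies (c : nat -> nat) (t : seq (nat * nat)) : Prop :=
  forall p, p \in t -> c p.1 = p.2.

Definition override (c : nat -> nat) (t : seq (nat * nat)) (n : nat) : nat :=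
  if n \in unzip1 t then nth 0 (unzip2 t) (index n (unzip1 t)) else c n.

Lemma override_out c t n : n \notin unzip1 t -> override c t n = c n.
Proof. by rewrite /override => /negPf ->. Qed.

Lemma override_sat c t : uniq (unzip1 t) -> satisfies (override c t) t.
Proof.
move=> ut [n v] pt; rewrite /override /=.
have nt : n \in unzip1 t by apply/mapP; exists (n, v).
rewrite nt; set i := index (n, v) t.
have it : (i < size t)%N by rewrite index_mem.
have ni : nth 0 (unzip1 t) i = n by rewrite (nth_map (0, 0))// nth_index.
by rewrite -{1}ni index_uniq ?size_map// (nth_map (0, 0))// nth_index.
Qed.

Lemma same_codes_agree (W : Type) (C : countType) (code : W -> nat -> C) 
    (l : nat) (vs ws : seq W) (w0 : W) :
  same_codes code l vs ws -> size vs = size ws /\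
  forall i, (i < size ws)%N -> agree l (code (nth w0 vs i)) (code (nth w0 ws i)).
Proof.
move=> vw; have sz : size vs = size ws by have /(congr1 size) := vw; rewrite !size_map.
split=> // i iw; apply/agree_mkseq; have /(congr1 (fun t => nth [::] t i)) := vw.
by rewrite !(nth_map w0) ?sz.
Qed.

Section Conflicts.
Context (X : choiceType) (C : countType) (code : X -> nat -> C).
Context (Conf : X -> X -> nat -> Prop) (test : X -> X -> nat -> seq (nat * nat)).
(** [mu k] bounds the part of the codes that determines a conflict at [k] and its test; data that
    agree up to [nu i] have no test at location [i]. *)
Context (mu nu : nat -> nat).

(* [Conf x y k]: the local data [x] and [y] conflict at the label [k]; any
   [c : nat -> nat] which satisfies [test x y k] exhibits this conflict. *)
Record conflict_system : Prop := ConflictSystem {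
  code_inj : injective code;
  conf_sym : forall x y k, Conf x y k -> Conf y x k;
  conf_irr : forall x k, ~ Conf x x k;
  conf_stable : forall x y k x' y', Conf x y k ->
    agree (mu k) (code x) (code x') -> agree (mu k) (code y) (code y') ->
    Conf x' y' k /\ test x' y' k = test x y k;
  test_uniq : forall x y k, Conf x y k -> uniq (unzip1 (test x y k));
  test_size : forall x y k, (size (test x y k) <= 2)%N;
  test_thin : forall x y i ks, uniq ks ->
    (forall k, k \in ks -> Conf x y k /\ i \in unzip1 (test x y k)) ->
    (size ks <= 2)%N;
  test_far : forall x y k i, Conf x y k -> i \in unzip1 (test x y k) ->
    ~ agree (nu i) (code x) (code y);
  test_cross : forall x x' y y' k k' i, Conf x x' k -> Conf y y' k' ->
    i \in unzip1 (test x x' k) -> i \in unzip1 (test y y' k') ->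
    exists k'' a b, [/\ a = x \/ a = x', b = y \/ b = y', Conf a b k'' &
      ~ (agree (mu k'') (code x) (code x') /\ agree (mu k'') (code y) (code y'))];
  test_bounded : forall c, exists m : X -> nat, forall x y k,
    Conf x y k -> satisfies c (test x y k) -> (k < maxn (m x) (m y))%N }.

Hypothesis CS : conflict_system.

Definition many_conf (m : nat) (x y : X) : Prop :=
  exists2 ks : seq nat, uniq ks /\ size ks = m & forall k, k \in ks -> Conf x y k.

Lemma many_conf_sym m x y : many_conf m x y -> many_conf m y x.
Proof. by move=> [ks ksP ksC]; exists ks => // k /ksC /(conf_sym CS). Qed.

Lemma many_conf_irr m x : ~ many_conf m.+1 x x.
Proof. by move=> [[|k ks] [//= _ _]] /(_ k (mem_head _ _)) /(conf_irr CS). Qed.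

Lemma many_conf_le m n x y : (m <= n)%N -> many_conf n x y -> many_conf m x y.
Proof.
move=> mn [ks [uks sks] ksC]; exists (take m ks); last by move=> k /mem_take /ksC.
by rewrite take_uniq// size_takel// sks.
Qed.

Lemma many_conf_open m x y : many_conf m x y -> exists l, forall x' y',
  agree l (code x) (code x') -> agree l (code y) (code y') -> many_conf m x' y'.
Proof.
move=> [ks ksP ksC]; exists (\max_(k <- ks) mu k) => x' y' xx' yy'.
exists ks => // k kks; have kl : (mu k <= \max_(k <- ks) mu k)%N.
  exact: (@leq_bigmax_seq _ ks xpredT mu).
by have [] := conf_stable CS (ksC k kks) (agree_le kl xx') (agree_le kl yy').
Qed.

Lemma many_conf1 x y k : Conf x y k -> many_conf 1 x y.
Proof. by move=> xyk; exists [:: k] => // k'; rewrite inE => /eqP ->. Qed.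

Definition good_test (c : nat -> nat) (x y : X) : Prop :=
  exists2 k, Conf x y k & satisfies c (test x y k) \/ satisfies c (test y x k).

Lemma good_test_sym c x y : good_test c x y -> good_test c y x.
Proof. by move=> [k /(conf_sym CS) xyk [t|t]]; exists k => //; [right|left]. Qed.

Lemma good_test_open : good_open code good_test.
Proof.
move=> c x y [k xyk t].
pose b (t : seq (nat * nat)) := \max_(p <- t) p.1.+1.
have bP (s : seq (nat * nat)) m c' : (b s <= m)%N -> agree m c c' ->
    satisfies c s -> satisfies c' s.
  move=> sm cc' cs p ps; rewrite -cc' ?cs//; apply: leq_trans sm.
  exact: (@leq_bigmax_seq _ s xpredT (fun p => p.1.+1)).
exists (maxn (mu k) (maxn (b (test x y k)) (b (test y x k)))) => c' x' y'.
set m := maxn _ _ => cc' xx' yy'.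
have km : (mu k <= m)%N by exact: leq_maxl.
have [xyk' txy] := conf_stable CS xyk (agree_le km xx') (agree_le km yy').
have [_ tyx] := conf_stable CS (conf_sym CS xyk) (agree_le km yy') (agree_le km xx').
exists k => //; rewrite txy tyx; case: t => t; [left|right].
  by apply: bP cc' t; rewrite !leq_max leqnn orbT.
by apply: bP cc' t; rewrite !leq_max leqnn !orbT.
Qed.

(** [test_bounded] bounds the labels that [c] exhibits. If two members had the same bound and the
    same codes up to the precision of all labels below it, [conf_stable] would turn their conflict
    into a conflict of one datum with itself. *)
Lemma good_test_countable c (Z : set X) :
  (forall x y, Z x -> Z y -> x <> y -> good_test c x y) -> countable Z.
Proof.
move=> Zgood; apply: contrapT => Zunc; have [m mP] := test_bounded CS c.
pose l x := \max_(k < m x) mu k.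
pose f x := (m x, mkseq (code x) (l x)).
have [x [y [Zx Zy xy [mxy]]]] := uncountable_collision f Zunc.
have lxy : l x = l y by rewrite /l mxy.
rewrite -lxy => /agree_mkseq lag.
have [k xyk t] := Zgood x y Zx Zy xy.
have km : (k < m x)%N.
  case: t => /mP; first by move=> /(_ xyk); rewrite mxy maxnn.
  by move=> /(_ (conf_sym CS xyk)); rewrite mxy maxnn.
have kl : (mu k <= l x)%N by exact: (@leq_bigmax _ (fun i : 'I__ => mu i) (Ordinal km)).
by have [/(conf_irr CS)] :=
  conf_stable CS xyk (fun i _ => erefl) (agree_le kl (agree_sym lag)).
Qed.

(** By [test_thin] a location occurs in the tests of at most two labels, so [B] spoils at most
    [2 * size B] of them. *)
Lemma avoid_locations x y (B : seq nat) ks :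
  uniq ks -> (forall k, k \in ks -> Conf x y k) -> (2 * size B < size ks)%N ->
  exists2 k, k \in ks & ~~ has (mem B) (unzip1 (test x y k)).
Proof.
move=> uks ksC szB; apply: contrapT => h.
have {h} : forall k, k \in ks -> has (mem B) (unzip1 (test x y k)).
  by move=> k kks; apply: contrapT => /negP kB; apply: h; exists k.
move: szB; rewrite ltnNge => /negP + hB; apply.
elim: B ks uks ksC hB => [|b B IH] ks uks ksC hB.
  by case: ks uks ksC hB => // k ks _ _ /(_ k (mem_head _ _)) /hasP[].
rewrite -(count_predC (fun k => b \in unzip1 (test x y k)) ks) mulnS leq_add//.
  rewrite -size_filter; apply: (test_thin CS (x := x) (y := y) (i := b)).
    exact: filter_uniq.
  by move=> k; rewrite mem_filter => /andP[kb /ksC].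
rewrite -size_filter; apply: IH; first exact: filter_uniq.
  by move=> k; rewrite mem_filter => /andP[_ /ksC].
move=> k; rewrite mem_filter => /andP[/= kb /hB /hasP[i ik]].
rewrite /= inE => /predU1P[ib|iB]; first by rewrite -ib ik in kb.
by apply/hasP; exists i.
Qed.

(** The pairs are treated one by one; each adds at most two locations to those already fixed. *)
Lemma many_tests (ps : seq (X * X)) (c : nat -> nat) (B : seq nat) m :
  (forall p, p \in ps -> many_conf m p.1 p.2) ->
  (2 * (size B + 2 * size ps) < m)%N ->
  exists2 c', forall n, n \in B -> c' n = c n &
    forall p, p \in ps -> good_test c' p.1 p.2.
Proof.
elim: ps c B => [|[x y] ps IH] c B psm; first by exists c.
move=> szm; have [ks [uks sks] ksC] := psm _ (mem_head _ _).
have [|k kks kB] := @avoid_locations x y B ks uks ksC.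
  by rewrite sks; apply: leq_ltn_trans szm; rewrite leq_mul2l leq_addr.
set t := test x y k in kB.
have [||c' c'B c'ps] := IH (override c t) (B ++ unzip1 t).
- by move=> p pps; apply: psm; rewrite inE pps orbT.
- apply: leq_ltn_trans szm; rewrite leq_mul2l /= size_cat size_map mulnS addnA.
  by rewrite leq_add2r leq_add2l (test_size CS).
exists c' => [n nB|p].
  rewrite c'B ?mem_cat ?nB// override_out//; apply: contra kB => nt.
  by apply/hasP; exists n.
rewrite inE => /predU1P[->|]; last exact: c'ps.
exists k; first exact: ksC; left=> p' p't.
rewrite c'B; last by rewrite mem_cat orbC map_f.
exact: override_sat (test_uniq CS (ksC k kks)) _ p't.
Qed.

Lemma uniq_unzip1_fun (t : seq (nat * nat)) n u v :
  uniq (unzip1 t) -> (n, u) \in t -> (n, v) \in t -> u = v.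
Proof.
by move=> /(override_sat (fun=> 0)) ct /ct /= <- /ct /= <-.
Qed.

(** At precision [l], the list [K (w, w')] contains all conflicts of any pair in [Y] close to two
    distinct entries [w], [w'] of [ws], since there are exactly [m.+1] of them. If the tests of two
    corresponding pairs clashed, [test_cross] would supply a conflict outside this list. *)
Lemma exact_amalgam (Y : set X) m :
  (forall x y, Y x -> Y y -> x <> y -> many_conf m.+1 x y /\ ~ many_conf m.+2 x y) ->
  good_amalgam code Y good_test.
Proof.
move=> Yexact ws c L uws wsY.
have /choice[K KP] (q : X * X) : exists ks : seq nat, Y q.1 -> Y q.2 -> q.1 <> q.2 ->
    [/\ uniq ks, size ks = m.+1 & forall k, k \in ks -> Conf q.1 q.2 k].
  have [[q1 q2 q12]|nq] := pselect [/\ Y q.1, Y q.2 & q.1 <> q.2].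
    by have [[ks [uks sks] ksC] _] := Yexact _ _ q1 q2 q12; exists ks.
  by exists [::] => ? ? ?; case: nq.
pose k0 (x y : X) := head 0 (K (x, y)).
have k0P x y : Y x -> Y y -> x <> y -> Conf x y (k0 x y).
  move=> Yx Yy xy; have [_ + +] := KP (x, y) Yx Yy xy; rewrite /k0.
  by case: (K _) => //= k ks _; apply; rewrite mem_head.
pose lK := \max_(q <- allpairs pair ws ws) \max_(k <- K q) mu k.
(* The part with [nu] keeps all tests at locations from [L] on. *)
pose l := maxn lK (\max_(i < L) nu i).
have lKP w w' k : w \in ws -> w' \in ws -> k \in K (w, w') -> (mu k <= l)%N.
  move=> ww ww' kK; rewrite leq_max; apply/orP; left.
  apply: (@leq_trans (\max_(k <- K (w, w')) mu k)).
    exact: (@leq_bigmax_seq _ (K (w, w')) xpredT mu).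
  apply: (@leq_bigmax_seq _ _ xpredT (fun q => \max_(k <- K q) mu k)) => //.
  by apply/allpairsP; exists (w, w').
exists l => vs vs' vw vw' vY.
have [[x0 _]|X0] := pselect (exists x : X, True); last first.
  by exists c => // v; case: X0; exists v.
have [szv av] := same_codes_agree x0 vw; have [szv' av'] := same_codes_agree x0 vw'.
have zipP v v' : (v, v') \in zip vs vs' -> exists i,
    [/\ (i < size ws)%N, v = nth x0 vs i & v' = nth x0 vs' i].
  move=> /(nthP (x0, x0))[i]; rewrite size_zip szv szv' minnn => iw.
  by rewrite nth_zip ?szv ?szv'// => -[<- <-]; exists i.
have vY1 i : (i < size ws)%N -> Y (nth x0 vs i).
  by move=> iw; apply: vY; rewrite mem_cat mem_nth ?szv.
have vY2 i : (i < size ws)%N -> Y (nth x0 vs' i).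
  by move=> iw; apply: vY; rewrite mem_cat orbC mem_nth ?szv'.
have vv' i : (i < size ws)%N -> agree l (code (nth x0 vs i)) (code (nth x0 vs' i)).
  by move=> iw; apply: agree_trans (av i iw) (agree_sym (av' i iw)).
pose t v v' := test v v' (k0 v v').
have t_far v v' n u : (v, v') \in zip vs vs' -> v <> v' -> (n, u) \in t v v' ->
    (L <= n)%N.
  move=> /zipP[i [iw vE v'E]] vv nu_t; rewrite leqNgt; apply/negP => nL.
  have vC : Conf v v' (k0 v v') by apply: k0P => //; rewrite ?vE ?v'E; auto.
  apply: (test_far CS vC (i := n)); first by apply/mapP; exists (n, u).
  rewrite vE v'E; apply: agree_le (vv' i iw); rewrite leq_max; apply/orP; right.
  exact: (@leq_bigmax _ (fun i : 'I_L => nu i) (Ordinal nL)).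
have t_disj v v' w w' n u u' : (v, v') \in zip vs vs' -> v <> v' ->
    (w, w') \in zip vs vs' -> w <> w' ->
    (n, u) \in t v v' -> (n, u') \in t w w' -> u = u'.
  move=> /zipP[i [iw vE v'E]] nvv /zipP[j [jw wE w'E]] nww tu tu'.
  have vC : Conf v v' (k0 v v') by apply: k0P => //; rewrite ?vE ?v'E; auto.
  have wC : Conf w w' (k0 w w') by apply: k0P => //; rewrite ?wE ?w'E; auto.
  have [ij|ij] := eqVneq i j.
    move: wE w'E tu'; rewrite -ij -vE -v'E => -> -> tu'.
    exact: uniq_unzip1_fun (test_uniq CS vC) tu tu'.
  have [||k [a [b [aE bE ab_k nag]]]] := test_cross CS vC wC (i := n).
    by apply/mapP; exists (n, u).
    by apply/mapP; exists (n, u').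
  have wij : nth x0 ws i <> nth x0 ws j.
    by move=> /eqP; rewrite nth_uniq// (negPf ij).
  have Yi : Y (nth x0 ws i) by apply: wsY; exact: mem_nth.
  have Yj : Y (nth x0 ws j) by apply: wsY; exact: mem_nth.
  have [uK sK KC] := KP (nth x0 ws i, nth x0 ws j) Yi Yj wij.
  have kl k' : k' \in K (nth x0 ws i, nth x0 ws j) -> (mu k' <= l)%N.
    by apply: lKP; exact: mem_nth.
  have aw : agree l (code (nth x0 ws i)) (code a).
    apply: agree_sym; case: aE => ->; [rewrite vE|rewrite v'E]; auto.
  have bw : agree l (code (nth x0 ws j)) (code b).
    apply: agree_sym; case: bE => ->; [rewrite wE|rewrite w'E]; auto.
  have abC k' : k' \in K (nth x0 ws i, nth x0 ws j) -> Conf a b k'.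
    move=> k'K; have k'l := kl k' k'K.
    by have [] := conf_stable CS (KC k' k'K) (agree_le k'l aw) (agree_le k'l bw).
  (* A label in the list is excluded because close data agree up to its precision; any other label
     would be one conflict too many. *)
  have [kK|kK] := boolP (k \in K (nth x0 ws i, nth x0 ws j)).
    exfalso; apply: nag; have k'l := kl k kK.
    by split; apply: agree_le k'l _; [rewrite vE v'E|rewrite wE w'E]; exact: vv'.
  have Ya : Y a by case: aE => ->; [rewrite vE|rewrite v'E]; auto.
  have Yb : Y b by case: bE => ->; [rewrite wE|rewrite w'E]; auto.
  have ab : a <> b by move=> ab; apply: (conf_irr CS (x := b) (k := k)); rewrite -{1}ab.
  have [_ []] := Yexact a b Ya Yb ab.
  exists (k :: K (nth x0 ws i, nth x0 ws j)); first by rewrite /= kK sK.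
  by move=> k'; rewrite inE => /predU1P[->|/abC].
have /choice[c' c'P] (n : nat) : exists u, ((n < L)%N -> c n = u) /\
    forall v v' u', (v, v') \in zip vs vs' -> v <> v' -> (n, u') \in t v v' -> u = u'.
  have [nL|Ln] := ltnP n L.
    by exists (c n); split=> // v v' u' vz vv /(t_far _ _ _ _ vz vv); rewrite leqNgt nL.
  have [[u [v [v' [vz nvv tu]]]]|h] := pselect (exists u v v',
      [/\ (v, v') \in zip vs vs', v <> v' & (n, u) \in t v v']).
    by exists u; split=> // w w' u' wz nww; exact: t_disj vz nvv wz nww tu.
  by exists 0; split=> // v v' u' vz nvv tu; case: h; exists u', v, v'.
exists c' => [n nL|v v' vz nvv]; first exact: (c'P n).1.
have [i [iw vE v'E]] := zipP _ _ vz.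
exists (k0 v v'); first by apply: k0P => //; rewrite ?vE ?v'E; auto.
by left=> -[n u] tu; exact: (c'P n).2 vz nvv tu.
Qed.

Definition code_pair (W : Type) (x_ : W -> X) (z_ : W -> nat -> bool) (w : W)
  (n : nat) : C * bool := (code (x_ w) n, z_ w n).

Lemma agree_code_pair (W : Type) (x_ : W -> X) (z_ : W -> nat -> bool) l w w' :
  agree l (code_pair x_ z_ w) (code_pair x_ z_ w') <->
  agree l (code (x_ w)) (code (x_ w')) /\ agree l (z_ w) (z_ w').
Proof.
split=> [ww'|[ww1 ww2] i il]; last by rewrite /code_pair ww1// ww2.
by split=> i il; have [] := ww' i il.
Qed.

(** Two members that are close in the Cantor coordinate first differ there at a level no less than
    [l], and so have enough conflicts for [many_tests]. *)
Lemma many_amalgam (W : choiceType) (x_ : W -> X) (z_ : W -> nat -> bool)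
    (Y : set W) :
  (forall w w', Y w -> Y w' -> w <> w' ->
    exists2 d, z_ w d <> z_ w' d & many_conf d.+1 (x_ w) (x_ w')) ->
  good_amalgam (code_pair x_ z_) Y (fun c w w' => good_test c (x_ w) (x_ w')).
Proof.
move=> Ymany ws c L uws wsY; pose l := (2 * (L + 2 * size ws))%N.
exists l => vs vs' vw vw' vY.
have [[w0 _]|W0] := pselect (exists w : W, True); last first.
  by exists c => // v; case: W0; exists v.
have [szv av] := same_codes_agree w0 vw; have [szv' av'] := same_codes_agree w0 vw'.
have zipP v v' : (v, v') \in zip vs vs' ->
    [/\ Y v, Y v' & agree l (code_pair x_ z_ v) (code_pair x_ z_ v')].
  move=> /(nthP (w0, w0))[i]; rewrite size_zip szv szv' minnn => iw.
  rewrite nth_zip ?szv ?szv'// => -[<- <-]; split.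
  - by apply: vY; rewrite mem_cat mem_nth ?szv.
  - by apply: vY; rewrite mem_cat orbC mem_nth ?szv'.
  - exact: agree_trans (av i iw) (agree_sym (av' i iw)).
pose ps := [seq (x_ p.1, x_ p.2) | p <- [seq p <- zip vs vs' | p.1 != p.2]].
have [||c' c'c c'ps] := @many_tests ps c (iota 0 L) l.+1.
- move=> p /mapP[[v v']]; rewrite mem_filter /= => /andP[/eqP vv vz] ->.
  have [Yv Yv' /agree_code_pair[_ ag]] := zipP v v' vz.
  have [d dv] := Ymany v v' Yv Yv' vv; apply: many_conf_le.
  by rewrite ltnS leqNgt; apply/negP => /ag.
- rewrite ltnS size_iota leq_mul2l leq_add2l leq_mul2l /= size_map.
  by rewrite (leq_trans (size_subseq (filter_subseq _ _)))// size_zip szv szv' minnn.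
exists c' => [n nL|v v' vz vv]; first by rewrite c'c// mem_iota.
apply: (c'ps (x_ v, x_ v')); apply/mapP; exists (v, v') => //.
by rewrite mem_filter vz andbT; exact/eqP.
Qed.

Lemma conflict_free_cover (R : realType) (oca : OCA_T R)
    (ma : MA_aleph1_sigma_linked) :
  exists2 F : nat -> set X, (forall x, exists k, F k x) &
    forall n x y k, F n x -> F n y -> ~ Conf x y k.
Proof.
have [|||[Y Yunc YC]|[F Fcov FC]] :=
  @oca_coded R X C code (code_inj CS) oca (fun x y => exists k, Conf x y k).
- by move=> x y [k /(conf_sym CS) yx]; exists k.
- by move=> x [k /(conf_irr CS)].
- move=> x y [k xyk]; exists (mu k) => x' y' xx' yy'; exists k.
  by have [] := conf_stable CS xyk xx' yy'.
- exfalso; have good_countable (Z : set X) c : ~ countable Z ->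
      (forall x y, Z x -> Z y -> x <> y -> good_test c x y) -> False.
    by move=> Zunc /good_test_countable.
  pose W : choiceType := {classic (X * (nat -> bool))}.
  pose cp := code_pair (fst : W -> X) snd.
  have code_pair_inj : injective cp.
    move=> [x z] [x' z'] /= h; congr pair.
      by apply: (code_inj CS); apply/funext => n; have := congr1 (fun f => (f n).1) h.
    by apply/funext => n; have := congr1 (fun f => (f n).2) h.
  (* The closer the Cantor coordinates are, the more conflicts are asked for. *)
  pose K (w w' : W) := exists d, [/\ agree d w.2 w'.2, w.2 d <> w'.2 d &
    many_conf d.+1 w.1 w'.1].
  have [|||[Z [ZY Zunc] ZK]|[F Fcov FK]] :=
      @oca_on R oca W _ cp [set w : W | Y w.1] K code_pair_inj.
  + move=> w w' [d [/agree_sym ww' wd /many_conf_sym cd]].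
    by exists d; split=> // /esym.
  + by move=> w [d []].
  + move=> w w' [d [ww' wd /many_conf_open[l lP]]].
    exists (maxn d.+1 l) => v v' wv wv'; exists d.
    have /agree_code_pair[_ wv2] := agree_le (leq_maxl _ _) wv.
    have /agree_code_pair[_ wv2'] := agree_le (leq_maxl _ _) wv'.
    have /agree_code_pair[wv1 _] := agree_le (leq_maxr _ _) wv.
    have /agree_code_pair[wv1' _] := agree_le (leq_maxr _ _) wv'.
    split; last exact: lP.
      apply: agree_trans (agree_le (leqnSn d) (agree_sym wv2)) _.
      exact: agree_trans ww' (agree_le (leqnSn d) wv2').
    by rewrite -wv2// -wv2'.
  + have [|||c [Z' [_ Z'unc] Z'c]] := @force ma W _ cp Z
        (fun c w w' => good_test c w.1 w'.1) Zunc.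
    * move=> c w w' /good_test_open[m mP]; exists m => c' v v' cc'.
      by move=> /agree_code_pair[wv _] /agree_code_pair[wv' _]; exact: mP.
    * apply: many_amalgam => w w' Zw Zw' ww'.
      by have [d [_ dw dC]] := ZK w w' Zw Zw' ww'; exists d.
    * by move=> c w w'; exact: good_test_sym.
    * have fst_inj w w' : Z' w -> Z' w' -> w.1 = w'.1 -> w = w'.
        move=> Zw Zw' ww'; apply: contrapT => /(Z'c w w' Zw Zw')[k].
        by rewrite ww' => /(conf_irr CS).
      apply: (good_countable (fst @` Z') c); last first.
        by move=> _ _ [w Zw <-] [w' Zw' <-] ww'; apply: Z'c => // wE; rewrite wE in ww'.
      move=> cZ; apply: Z'unc; apply: sub_countable cZ.
      have /inj_card_eq : {in Z' &, injective fst}.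
        by move=> w w'; rewrite !inE => Zw Zw'; exact: fst_inj.
      by rewrite card_eq_sym => /card_eqPle[].
  (* By Baire category, uncountably many [y] share a piece that is dense over one stem [s]. Two of
     them with more than [size s] conflicts could be given Cantor coordinates in this piece that
     split exactly at [size s]. *)
  + have bounded_conf : exists m, exists2 Y' : set X, Y' `<=` Y /\ ~ countable Y' &
        forall x y, Y' x -> Y' y -> x <> y -> ~ many_conf m x y.
      pose cls (p : nat * seq bool) : set X := [set y | exists2 z,
        dense_at [set z' | F p.1 (y, z')] z (size p.2) & mkseq z (size p.2) = p.2].
      have [|[k s] Y'unc] := @uncountable_cover _ _ Y cls Yunc.
        move=> y Yy; have [|k [z [m zm]]] :=
          @baire bool false _ (fun k => [set z | F k ((y, z) : W)]).
          by move=> z; exact: Fcov.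
        by exists (k, mkseq z m), z; rewrite size_mkseq.
      exists (size s).+1, (Y `&` cls (k, s)); first by split=> // x [].
      move=> x y [Yx [z /= zd zs]] [Yy [z' /= zd' zs']] xy xyC.
      set m := size s in zd zs zd' zs' xyC.
      have zz' : agree m z z' by apply/agree_mkseq; rewrite zs zs'.
      pose u (b : bool) i := if (i < m)%N then z i else b.
      have zu b : agree m z (u b) by move=> i im; rewrite /u im.
      have [v Fv uv] := zd (u false) m.+1 (zu false).
      have [v' Fv' uv'] := zd' (u true) m.+1 (agree_trans (agree_sym zz') (zu true)).
      apply: (FK k (x, v) (y, v') Fv Fv'); exists m; split=> //=.
        apply: agree_trans (agree_le (leqnSn m) (agree_sym uv)) _.
        apply: agree_trans (agree_sym (zu false)) _.
        exact: agree_trans (zu true) (agree_le (leqnSn m) uv').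
      by rewrite -uv// -uv'// /u ltnn.
    have bounded_b : exists m, `[< exists2 Y' : set X, Y' `<=` Y /\ ~ countable Y' &
        forall x y, Y' x -> Y' y -> x <> y -> ~ many_conf m x y >].
      by have [m mP] := bounded_conf; exists m; exact/asboolP.
    (* Take the least bound. It is neither 0 nor 1, as members of [Y] conflict pairwise. If it is
       [m.+2], minimality leaves only an uncountable set in which any two members have exactly
       [m.+1] conflicts. *)
    case: (ex_minnP bounded_b) => -[|[|m]] /asboolP[Y' [Y'Y Y'unc] Y'm] mmin.
    * have [x [y [Yx Yy xy]]] := uncountable_two Y'unc.
      by apply: (Y'm x y Yx Yy xy); exists [::].
    * have [x [y [Yx Yy xy]]] := uncountable_two Y'unc.
      have [k /many_conf1] := YC x y (Y'Y _ Yx) (Y'Y _ Yy) xy.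
      exact: Y'm.
    * have [|||[Z [ZY Zunc] ZC]|[G Gcov GC]] :=
        @oca_on R oca X C code Y' (many_conf m.+1) (code_inj CS).
      - by move=> x y; exact: many_conf_sym.
      - by move=> x; exact: many_conf_irr.
      - by move=> x y; exact: many_conf_open.
      - have [|c [Z' [_ Z'unc] Z'c]] := force ma Zunc good_test_open _ good_test_sym.
          apply: (@exact_amalgam Z m) => x y Zx Zy xy; split; first exact: ZC.
          by apply: Y'm => //; exact: ZY.
        exact: good_countable Z'unc Z'c.
      - have [k Zunc] := uncountable_cover Y'unc Gcov.
        suff : (m.+2 <= m.+1)%N by rewrite ltnn.
        apply: mmin; apply/asboolP; exists (Y' `&` G k).
          by split=> // x [/Y'Y].
        by move=> x y [_ Gx] [_ Gy] _; exact: GC Gx Gy.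
- by exists F => // n x y k Fx Fy xyk; apply: (FC n x y) => //; exists k.
Qed.

End Conflicts.

(** * Coordinate-respecting maps over the identity *)

Definition coherent (F : (nat -> nat) -> nat -> nat) : Prop :=
  forall a b, almost (fun n => a n = b n -> F a n = F b n).

Definition allowed (S : nat -> set nat) (a : nat -> nat) : Prop :=
  forall n, S n (a n).

Definition lifted_by (F : (nat -> nat) -> nat -> nat) (S : nat -> set nat)
    (A : set nat) (h : nat -> nat -> nat) : Prop :=
  forall a, allowed S a -> almost (fun n => A n -> F a n = h n (a n)).

Lemma injective_unbounded (q : nat -> nat) m : injective q ->
  exists i, (m <= q i)%N.
Proof.
move=> qinj; apply: contrapT => /forallNP h.
have qm i : (q i < m)%N by rewrite ltnNge; apply/negP/h.
pose q' (i : 'I_m.+1) : 'I_m := Ordinal (qm i).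
have : injective q' by move=> i j /(congr1 val) /= /qinj; exact: val_inj.
by move=> /leq_card; rewrite !card_ord ltnn.
Qed.

(** Each piece determines a candidate [h]. Were all candidates to fail, a sequence interleaving the
    counterexamples [a_ c] along disjoint sets would lie in some [A c] while copying infinitely many
    errors of [a_ c], against coherence. *)
Lemma lift_of_cover F S (C : countType) (A : C -> set (nat -> nat))
    (B : C -> set nat) a0 : coherent F -> allowed S a0 ->
  (forall a, allowed S a -> exists c, A c a) ->
  (forall c a b n, A c a -> A c b -> B c n -> a n = b n -> F a n = F b n) ->
  exists c h, lifted_by F S (B c) h.
Proof.
move=> Fcoh Sa0 Acov AB; apply: contrapT => nolift.
have [c0 _] := Acov a0 Sa0.
have /choice[h hP] (p : C * nat * nat) : exists u, forall a, A p.1.1 a ->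
    B p.1.1 p.1.2 -> a p.1.2 = p.2 -> F a p.1.2 = u.
  have [[a [Aa Bn an]]|na] := pselect (exists a,
      [/\ A p.1.1 a, B p.1.1 p.1.2 & a p.1.2 = p.2]).
    by exists (F a p.1.2) => b Ab _ bn; apply: AB Ab Aa Bn _; rewrite bn.
  by exists 0 => a Aa Bn an; case: na; exists a.
have /choice[a_ aP] (c : C) : exists a, allowed S a /\
    infinite_set [set n | B c n /\ F a n <> h (c, n, a n)].
  apply: contrapT => /forallNP na; apply: nolift; exists c, (fun n v => h (c, n, v)).
  move=> a Sa; apply/almostP; apply: contrapT => inf; apply: (na a); split=> //.
  apply: sub_infinite_set inf => n /= /not_implyP[Bn Fn].
  by split.
have [q qinj qP] := @greedy_injection (C * nat)%type
  (fun p => [set n | B p.1 n /\ F (a_ p.1) n <> h (p.1, n, a_ p.1 n)])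
  (fun p => (aP p.1).2).
have /choice[s sP] (n : nat) : exists c, forall c' i, n = q (c', i) -> c = c'.
  have [[c [i ni]]|nq] := pselect (exists c i, n = q (c, i)).
    by exists c => c' i'; rewrite ni => /qinj [].
  by exists c0 => c' i' nq'; case: nq; exists c', i'.
pose a n := a_ (s n) n.
have [|c Aca] := Acov a; first by move=> n; exact: (aP _).1.
have [m mP] := Fcoh a (a_ c).
have [i im] : exists i, (m <= q (c, i))%N.
  by apply: injective_unbounded => i j /qinj [].
have [/= Bn] := qP (c, i); apply.
have an : a (q (c, i)) = a_ c (q (c, i)) by rewrite /a (sP _ c i).
by rewrite -mP// -an; exact: (hP (c, _, _)).
Qed.

(** The injection [q] places the tree of finite sequences on the integers, and the lift is found on
    the set of immediate successors of a node. The last entry of a node codes the set [D k] in which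
    the node is placed, so that such a set of successors meets every [D k] infinitely often. *)
Lemma local_lift (R : realType) (oca : OCA_T R) F S (D : nat -> set nat) a0 :
  coherent F -> allowed S a0 -> (forall k, infinite_set (D k)) ->
  exists A h, lifted_by F S A h /\ forall k, infinite_set (A `&` D k).
Proof.
move=> Fcoh Sa0 Dinf.
pose D' i : set nat := if unpickle i is Some p then D (p : nat * nat).1 else D 0.
have [q qinj qD] := @greedy_injection (seq nat) (fun t => D' (last 0 t))
  (fun t => ltac:(rewrite /D'; case: (unpickle _) => [?|]; exact: Dinf)).
pose X := ((nat -> nat) * (nat -> nat))%type.
pose code (x : X) n := (x.1 n, F x.1 n, x.2 n).
have code_inj : injective code.
  move=> [a z] [b w] h; congr pair; apply/funext => n.
    by have := congr1 (fun f => (f n).1.1) h.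
  by have := congr1 (fun f => (f n).2) h.
(* On the common nodes, those of length at most [d], the sequences agree while their images
   somewhere differ. *)
pose K (x y : X) := exists d, [/\ agree d x.2 y.2, x.2 d <> y.2 d,
  (forall i, (i <= d)%N -> x.1 (q (mkseq x.2 i)) = y.1 (q (mkseq x.2 i))) &
  exists2 i, (i <= d)%N & F x.1 (q (mkseq x.2 i)) <> F y.1 (q (mkseq x.2 i))].
have [|||[Z [ZS Zunc] ZK]|[G Gcov GK]] :=
  @oca_on R oca X _ code [set x | allowed S x.1] K code_inj.
- move=> x y [d [xy xyd eq [i id neq]]]; exists d.
  have mk j : (j <= d)%N -> mkseq y.2 j = mkseq x.2 j.
    by move=> jd; apply/agree_mkseq; apply: agree_le jd (agree_sym xy).
  split; [exact: agree_sym|exact/nesym| |].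
    by move=> j jd; rewrite mk// eq.
  by exists i => //; rewrite mk//; exact/nesym.
- by move=> x [d []].
- move=> x y [d [xy xyd eq [i id neq]]].
  pose l := maxn d.+1 (\max_(i < d.+1) (q (mkseq x.2 i)).+1).
  have dl : (d.+1 <= l)%N by exact: leq_maxl.
  have ql j : (j <= d)%N -> (q (mkseq x.2 j) < l)%N.
    move=> jd; rewrite leq_max; apply/orP; right.
    have jd' : (j < d.+1)%N by [].
    exact: (@leq_bigmax _ (fun i : 'I_d.+1 => (q (mkseq x.2 i)).+1) (Ordinal jd')).
  exists l => x' y' xx' yy'; exists d.
  have e1 (u u' : X) n : agree l (code u) (code u') -> (n < l)%N ->
      [/\ u.1 n = u'.1 n, F u.1 n = F u'.1 n & u.2 n = u'.2 n].
    by move=> uu' nl; have [-> -> ->] := uu' n nl.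
  have mk j : (j <= d)%N -> mkseq x'.2 j = mkseq x.2 j.
    move=> jd; apply/esym/agree_mkseq => k kj.
    by have [] := e1 _ _ k xx' (leq_trans (leq_trans kj jd) (ltnW dl)).
  split.
  + move=> k kd; have kl : (k < l)%N by exact: ltn_trans dl.
    by have [_ _ <-] := e1 _ _ k xx' kl; have [_ _ <-] := e1 _ _ k yy' kl; exact: xy.
  + by have [_ _ <-] := e1 _ _ d xx' dl; have [_ _ <-] := e1 _ _ d yy' dl.
  + move=> j jd; rewrite mk//.
    have [<- _ _] := e1 _ _ _ xx' (ql j jd); have [<- _ _] := e1 _ _ _ yy' (ql j jd).
    exact: eq.
  + exists i => //; rewrite mk//.
    by have [_ <- _] := e1 _ _ _ xx' (ql i id); have [_ <- _] := e1 _ _ _ yy' (ql i id).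
(* [c] follows [x.1] along the branch of every [x] in [Z]; agreement on the common nodes makes this
   consistent. *)
- exfalso; have /choice[c cP] (n : nat) : exists v, S n v /\
      forall x i, Z x -> n = q (mkseq x.2 i) -> x.1 n = v.
    have [[x [i [Zx ni]]]|h] := pselect (exists x i, Z x /\ n = q (mkseq x.2 i)); last first.
      by exists (a0 n); split=> // x i Zx ni; case: h; exists x, i.
    exists (x.1 n); split=> [|y j Zy nj]; first exact: ZS.
    apply: contrapT => xyn; have xy : x <> y by move=> xy; rewrite xy in xyn.
    have [d [xyd xyd' eq _]] := ZK _ _ Zx Zy xy.
    have /qinj ij : q (mkseq x.2 i) = q (mkseq y.2 j) by rewrite -ni -nj.
    have sij : i = j by have := congr1 size ij; rewrite !size_mkseq.
    have id : (i <= d)%N.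
      rewrite leqNgt; apply/negP => di; apply: xyd'.
      by move: ij; rewrite -sij => /agree_mkseq; exact.
    by apply: xyn; rewrite ni -eq.
  have /choice[m mP] (x : X) : exists m, forall n, (m <= n)%N ->
      x.1 n = c n -> F x.1 n = F c n by exact: Fcoh.
  have [x [y [Zx Zy xy [mxy Fxy]]]] :=
    uncountable_collision (fun x : X => (m x, mkseq (F x.1) (m x))) Zunc.
  have [d [xyd _ eq [i id neq]]] := ZK x y Zx Zy xy.
  have xi : mkseq x.2 i = mkseq y.2 i.
    by apply/agree_mkseq; exact: agree_le xyd.
  set n := q _ in neq.
  have xn : x.1 n = c n by apply: (cP _).2 Zx erefl.
  have yn : y.1 n = c n by rewrite /n xi; apply: (cP _).2 Zy erefl.
  have [nm|mn] := ltnP n (m x).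
    by apply: neq; move: Fxy; rewrite -mxy => /agree_mkseq; exact.
  by apply: neq; rewrite !mP// -mxy.
(* By category, [a] is in one piece together with a dense set of branches through some node [s]; the
   values of [a] on the nodes up to [s] are recorded too. *)
pose A (t : nat * seq nat * seq nat) : set (nat -> nat) := [set a | exists2 z,
  dense_at [set z | G t.1.1 (a, z)] z (size t.1.2) &
  mkseq z (size t.1.2) = t.1.2 /\
  mkseq (fun i => a (q (take i t.1.2))) (size t.1.2).+1 = t.2].
pose B (t : nat * seq nat * seq nat) : set nat := [set n | exists i, n = q (rcons t.1.2 i)].
have [a Sa|t a b n Aa Ab [i ->] ab|[[k s] th] [h Bh]] :=
    @lift_of_cover F S _ A B a0 Fcoh Sa0.
- have [|k [z [l zd]]] := @baire nat 0 _ (fun k => [set z | G k (a, z)]).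
    by move=> z; exact: Gcov.
  exists (k, mkseq z l, mkseq (fun i => a (q (take i (mkseq z l)))) l.+1), z => /=;
    by rewrite size_mkseq.
- case: t Aa Ab ab => -[k s] th [z /= zd [zs zt]] [w /= wd [ws wt]] ab.
  set l := size s in zd zs zt wd ws wt.
  (* Both branches pass through [rcons s i] and leave it in the directions 0 and 1, so that the
     colouring compares the images at this node. *)
  pose u e j := if (j < l)%N then z j else if j == l then i else e.
  have zu e : agree l z (u e) by move=> j jl; rewrite /u jl.
  have wu e : agree l w (u e).
    by apply: agree_trans _ (zu e); apply/agree_mkseq; rewrite zs ws.
  have [z' Gz uz] := zd (u 0) l.+2 (zu 0).
  have [w' Gw uw] := wd (u 1) l.+2 (wu 1).
  have uE e j : (j <= l)%N -> mkseq (u e) j = take j s.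
    move=> jl; rewrite -zs /mkseq -map_take take_iota (minn_idPl jl).
    by apply/agree_mkseq; exact: agree_le jl (agree_sym (zu e)).
  have uEl e : mkseq (u e) l.+1 = rcons s i.
    by rewrite /mkseq -[l.+1]addn1 iotaD map_cat cats1 /= add0n -/(mkseq _ l)
      uE// take_size /u ltnn eqxx.
  apply: contrapT => nF; apply: (GK k (a, z') (b, w') Gz Gw); exists l.+1 => /=.
  have z'E j : (j <= l.+1)%N -> mkseq z' j = mkseq (u 0) j.
    by move=> jl; apply/agree_mkseq; apply: agree_sym; apply: agree_le uz; exact: leqW.
  split.
  + move=> j jl; rewrite -uz ?ltnS ?(ltnW jl)// -uw ?ltnS ?(ltnW jl)//.
    rewrite /u; case: (ltnP j l) => // lj.
    have -> : j = l by apply/eqP; rewrite eqn_leq lj andbT -ltnS.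
    by rewrite eqxx.
  + by rewrite -uz// -uw// /u ltnNge leqnSn /= gtn_eqF.
  + move=> j; rewrite leq_eqVlt => /predU1P[->|]; first by rewrite z'E// uEl.
    rewrite ltnS => jl; rewrite z'E ?uE//; last exact: leqW.
    by move: zt; rewrite -wt => /agree_mkseq; apply.
  + by exists l.+1 => //; rewrite z'E// uEl.
exists (B (k, s, th)), h; split=> // k'; apply/infinite_geP => m.
have [|j mj] := @injective_unbounded (fun j => q (rcons s (pickle (k', j)))) m.
  by move=> j j' /qinj /rcons_inj [] /(pcan_inj pickleK) [].
exists (q (rcons s (pickle (k', j)))) => //; split; first by exists (pickle (k', j)).
by have := qD (rcons s (pickle (k', j))); rewrite /D' last_rcons pickleK.
Qed.

(** * Gluing local lifts below a bound *)

Section BoundedLift.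
Context (F : (nat -> nat) -> nat -> nat) (g : nat -> nat).

Definition below (n : nat) : set nat := [set v | (v <= g n)%N].

(* A partial lift is a domain together with a lift on it, normalized so as to
   be determined by finitely many values at each coordinate. *)
Definition partial_lift : Type := {x : (nat -> bool) * (nat -> nat -> nat) |
  (forall n v, ~ (x.1 n /\ (v <= g n)%N) -> x.2 n v = 0) /\
  lifted_by F below [set n | x.1 n] x.2}.

Definition pl_dom (x : partial_lift) : nat -> bool := (sval x).1.
Definition pl_fun (x : partial_lift) : nat -> nat -> nat := (sval x).2.

Definition pl_code (x : {classic partial_lift}) n : bool * seq nat :=
  (pl_dom x n, mkseq (pl_fun x n) (g n).+1).

Definition pl_conf (x y : {classic partial_lift}) (n : nat) : Prop :=
  [/\ pl_dom x n, pl_dom y n & exists2 v, (v <= g n)%N & pl_fun x n v <> pl_fun y n v].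

(** The test asks for the first value at which the two lifts differ; as [iota] starts at 0, the
    position found is that value. *)
Definition pl_test (x y : {classic partial_lift}) (n : nat) : seq (nat * nat) :=
  [:: (n, find (fun v => pl_fun x n v != pl_fun y n v) (iota 0 (g n).+1))].

Lemma pl_agree m x y n :
  agree m (pl_code x) (pl_code y) -> (n < m)%N -> pl_dom x n = pl_dom y n /\
  forall v, (v <= g n)%N -> pl_fun x n v = pl_fun y n v.
Proof.
move=> xy /xy xyn; split=> [|v vg]; first exact: (congr1 fst xyn).
by have /agree_mkseq := congr1 snd xyn; apply.
Qed.

Lemma pl_test_value x y n : pl_conf x y n -> exists v, [/\ (v <= g n)%N,
  pl_fun x n v <> pl_fun y n v & pl_test x y n = [:: (n, v)]].
Proof.
move=> [_ _ [v vg xyv]]; set p := fun v => pl_fun x n v != pl_fun y n v.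
have hp : has p (iota 0 (g n).+1).
  by apply/hasP; exists v; [rewrite mem_iota|exact/eqP].
exists (find p (iota 0 (g n).+1)); split=> //.
  by have := hp; rewrite has_find size_iota.
have := nth_find 0 hp; rewrite nth_iota ?add0n => [/eqP//|].
by have := hp; rewrite has_find size_iota.
Qed.

Lemma pl_conflicts : conflict_system pl_code pl_conf pl_test succn succn.
Proof.
have sym x y n : pl_conf x y n -> pl_conf y x n.
  by move=> [xn yn [v vg xyv]]; split=> //; exists v => //; exact/nesym.
have far x y n : pl_conf x y n -> ~ agree n.+1 (pl_code x) (pl_code y).
  by move=> [_ _ [v vg xyv]] /pl_agree/(_ (ltnSn n))[_ xy]; apply: xyv; exact: xy.
split=> //.
- move=> x y xy; have ag n := pl_agree (m := n.+1) (fun i _ => congr1 (@^~ i) xy) (ltnSn n).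
  case: x y xy ag => [[d f] [fn fl]] [[e h] [hn hl]] xy ag; apply: eq_exist.
  have de : d = e by apply/funext => n; exact: (ag n).1.
  congr pair => //; apply/funext => n; apply/funext => v.
  have [vg|vg] := leqP v (g n); first exact: (ag n).2.
  have nvg : ~ (v <= g n)%N by rewrite leqNgt vg.
  by rewrite [f n v]fn ?[h n v]hn// => -[].
- by move=> x n [_ _ []].
- move=> x y n x' y' [xn yn [v vg xyv]] xx' yy'.
  have [xd xf] := pl_agree xx' (ltnSn n); have [yd yf] := pl_agree yy' (ltnSn n).
  split; first by split; rewrite -?xd -?yd//; exists v => //; rewrite -xf// -yf.
  congr [:: (n, _)]; apply: eq_in_find => u; rewrite mem_iota ltnS => /andP[_ ug].
  by rewrite xf// yf.
- move=> x y i ks uks ksi; apply: (@leq_trans (size [:: i])) => //.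
  apply: uniq_leq_size => // k /ksi[_].
  by rewrite !inE eq_sym.
- by move=> x y n i xyn; rewrite inE => /eqP ->; exact: far.
- move=> x x' y y' k k' i xx' yy'; rewrite !inE /= => /eqP -> /eqP kk'.
  rewrite -kk' in yy'; have nag := far _ _ _ xx'.
  have [v [vg xv _]] := pl_test_value xx'; have [xk x'k _] := xx'; have [yk _ _] := yy'.
  (* [x] and [x'] differ at [v], hence [y] differs there from one of them. *)
  have [xy|xy] := eqVneq (pl_fun x k v) (pl_fun y k v).
    exists k, x', y; split; [by right|by left| |by case].
    by split=> //; exists v => //; rewrite -xy; exact/nesym.
  by exists k, x, y; split; [left|left| |case] => //; split=> //; exists v => //; exact/eqP.
(* Truncating [c] by [g] keeps the tested values, which lie below [g], and makes both lifts compute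
   [F c']; past their thresholds they cannot disagree there. *)
- move=> c; pose c' n := minn (c n) (g n).
  have Sc' : allowed below c' by move=> n; exact: geq_minr.
  have /choice[m mP] (x : partial_lift) : exists m, forall n, (m <= n)%N ->
      pl_dom x n -> F c' n = pl_fun x n (c' n) by exact: (svalP x).2.
  exists m => x y k xyk; have [v [vg xyv ->]] := pl_test_value xyk.
  move=> /(_ (k, v) (mem_head _ _)) /= ck; rewrite ltnNge; apply/negP.
  rewrite geq_max => /andP[xk yk]; have [xd yd _] := xyk.
  have c'k : c' k = v by rewrite /c' ck; exact/minn_idPl.
  by apply: xyv; rewrite -c'k -!mP.
Qed.

(** The members of a conflict-free family extend to one candidate. If every candidate fails, a local
    lift that meets all the error sets infinitely often still belongs to some family, and so
    corrects infinitely many errors of its candidate. *)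
Lemma bounded_lift (R : realType) (oca : OCA_T R) (ma : MA_aleph1_sigma_linked) :
  coherent F -> exists h, lifted_by F below setT h.
Proof.
move=> Fcoh; have [G Gcov GC] := conflict_free_cover pl_conflicts oca ma.
apply: contrapT => /forallNP nolift.
have /choice[h hP] (p : nat * nat * nat) : exists u, forall x, G p.1.1 x ->
    pl_dom x p.1.2 -> (p.2 <= g p.1.2)%N -> pl_fun x p.1.2 p.2 = u.
  have [[x [Gx xn pg]]|nx] := pselect (exists x,
      [/\ G p.1.1 x, pl_dom x p.1.2 & (p.2 <= g p.1.2)%N]).
    exists (pl_fun x p.1.2 p.2) => y Gy yn _; apply: contrapT => yx.
    by apply: (GC _ y x p.1.2 Gy Gx); split=> //; exists p.2.
  by exists 0 => x Gx xn pg; case: nx; exists x.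
have /choice[a aP] (k : nat) : exists a, allowed below a /\
    infinite_set [set n | F a n <> h (k, n, a n)].
  apply: contrapT => /forallNP na; apply: (nolift (fun n v => h (k, n, v))).
  move=> a Sa; suff : almost (fun n => F a n = h (k, n, a n)) by move/almost_mono; apply.
  by apply/almostP; apply: contrapT => inf; exact: (na a).
have S0 : allowed below (fun=> 0) by [].
have [A [f [Af Ainf]]] := local_lift oca Fcoh S0 (fun k => (aP k).2).
pose d n := `[< A n >]; pose f' n v := if d n && (v <= g n)%N then f n v else 0.
have xP : (forall n v, ~ (d n /\ (v <= g n)%N) -> f' n v = 0) /\
    lifted_by F below [set n | d n] f'.
  split=> [n v nv|b Sb]; first by rewrite /f'; case: ifP => // /andP.
  have /almost_mono := Af b Sb; apply => n + /= dn => -> //; last exact/asboolP.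
  by rewrite /f' dn Sb.
pose x : partial_lift := exist _ (d, f') xP.
have [k Gx] := Gcov x; have [Sa _] := aP k.
have [m mP] := xP.2 (a k) Sa.
have /infinite_geP/(_ m)[n mn [An]] := Ainf k; apply.
have dn : d n by exact/asboolP.
rewrite (mP n mn dn); apply: (hP (k, n, a k n) x) => //; exact: Sa.
Qed.

End BoundedLift.

(** Conditions consist of a finite stem and finitely many functions to be dominated beyond it;
    conditions with the same stem are compatible. *)
Lemma dominated_uncountable (ma : MA_aleph1_sigma_linked) (Z : set (nat -> nat)) :
  ~ countable Z -> exists g, exists2 Y : set (nat -> nat), Y `<=` Z /\ ~ countable Y &
    forall a, Y a -> almost (fun n => (a n <= g n)%N).
Proof.
move=> Zunc; have [I [le [hI _ _]]] := aleph1_exists.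
have [phi phi_inj phiZ] := card_le_injective (hI.2 _ _ Zunc).
(* Through [e] the sets [D i] also force the stems to become arbitrarily long, so that one index set
   serves both purposes. *)
have [e einj] : exists e : nat -> I, injective e.
  have : infinite_set [set: I] by move=> /finite_set_countable; exact: hI.1.
  by move=> /infiniteP /card_le_injective[e einj _]; exists e.
pose P := (seq nat * seq {classic (nat -> nat)})%type.
pose ple (q p : P) := [/\ exists t, q.1 = p.1 ++ t, {subset p.2 <= q.2} &
  forall i a, a \in p.2 -> (size p.1 <= i < size q.1)%N -> (a i <= nth 0 q.1 i)%N].
have ple_refl p : ple p p.
  split=> // [|i a _]; first by exists [::]; rewrite cats0.
  by case: ltnP => // /leq_gtF ->.
have ple_trans q p r : ple p q -> ple q r -> ple p r.
  move=> [[t pq] qp qpi] [[u qr] rq rqi]; split.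
  - by exists (u ++ t); rewrite pq qr catA.
  - by move=> a /rq /qp.
  - move=> i a ar /andP[ri ip]; have [iq|qi] := ltnP i (size q.1).
      by rewrite pq nth_cat iq; apply: rqi; rewrite ?ri.
    by apply: qpi; [exact: rq|rewrite qi].
pose D i : set P := fun p => (phi i : {classic (nat -> nat)}) \in p.2 /\
  forall n, e n = i -> (n < size p.1)%N.
have Ddense i p : exists2 q, D i q & ple q p.
  have [n en] : exists n, forall n', e n' = i -> n' = n.
    have [[n ni]|ne] := pselect (exists n, e n = i).
      by exists n => n'; rewrite -ni => /einj.
    by exists 0 => n' ne'; case: ne; exists n'.
  pose t := mkseq (fun j => \max_(a <- p.2) (a : nat -> nat) (size p.1 + j)%N) n.+1.
  exists (p.1 ++ t, (phi i : {classic (nat -> nat)}) :: p.2).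
    split=> /= [|n' /en ->]; first exact: mem_head.
    by rewrite size_cat size_mkseq addnS ltnS leq_addl.
  split=> /= [|a ap|j a ap /andP[pj jp]]; first by exists t.
    by rewrite inE ap orbT.
  rewrite nth_cat ltnNge pj /= nth_mkseq ?subnKC//.
    exact: (@leq_bigmax_seq _ p.2 xpredT (fun a => (a : nat -> nat) j)).
  by rewrite ltn_subLR// -[n.+1](size_mkseq (fun j => \max_(a <- p.2) (a : nat -> nat) (size p.1 + j)%N))
    -size_cat.
have [|p|s p q ps qs|G Gdir GD] := @ma_preorder ma P ple (seq nat)
    (fun s => [set p | p.1 = s]) I D ple_refl ple_trans _ _ _ hI Ddense.
- by exists ([::], [::]).
- by exists p.1.
- move: ps qs => /= ps qs; exists (s, p.2 ++ q.2); split=> /=.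
  + by exists [::]; rewrite cats0.
  + by move=> a ap; rewrite mem_cat ap.
  + by move=> i a _; rewrite ps; case: ltnP => // /leq_gtF ->.
  + by exists [::]; rewrite cats0.
  + by move=> a aq; rewrite mem_cat aq orbT.
  + by move=> i a _; rewrite qs; case: ltnP => // /leq_gtF ->.
have /choice[g gP] (n : nat) : exists v, forall p, G p -> (n < size p.1)%N ->
    nth 0 p.1 n = v.
  have [p Gp [_ /(_ n erefl) np]] := GD (e n); exists (nth 0 p.1 n) => q Gq nq.
  have [r _ [[[t rp] _ _] [[u rq] _ _]]] := Gdir p q Gp Gq.
  by have := congr1 (nth 0 ^~ n) (etrans (esym rp) rq); rewrite /= !nth_cat np nq.
exists g, (range phi); last first.
  move=> _ [i _ <-]; have [p Gp [ip _]] := GD i.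
  exists (size p.1) => n pn; have [q Gq [_ /(_ n erefl) nq]] := GD (e n).
  have [r Gr [[_ _ rp] [[t rq] _ _]]] := Gdir p q Gp Gq.
  have nr : (n < size r.1)%N by rewrite rq size_cat ltn_addr.
  by rewrite -(gP n r Gr nr); apply: rp => //; rewrite pn.
split=> [_ [i _ <-] //|cphi]; apply: (hI.1); apply: sub_countable cphi.
by apply: (injective_card_le (f := phi)) => [i j _ _ /phi_inj//|i _]; exists i.
Qed.

Theorem coherent_lift (R : realType) (oca : OCA_T R) (ma : MA_aleph1_sigma_linked) F :
  coherent F -> exists h : nat -> nat -> nat,
    forall a, almost (fun n => F a n = h n (a n)).
Proof.
move=> Fcoh; pose code (a : nat -> nat) n := (a n, F a n).
have code_inj : injective code.
  by move=> a b ab; apply/funext => n; have := congr1 (fun f => (f n).1) ab.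
have [|||[Z Zunc ZK]|[G Gcov GK]] :=
  @oca_coded R _ _ code code_inj oca (fun a b => exists2 n, a n = b n & F a n <> F b n).
- by move=> a b [n ab Fab]; exists n => //; exact/nesym.
- by move=> a [n _].
- move=> a b [n ab Fab]; exists n.+1 => a' b' aa' bb'; exists n.
    by have [<- _] := aa' n (ltnSn n); have [<- _] := bb' n (ltnSn n).
  by have [_ <-] := aa' n (ltnSn n); have [_ <-] := bb' n (ltnSn n).
(* An uncountable family of conflicting sequences can be thinned to one bounded modulo finite sets.
   There [bounded_lift] forbids a conflict between two members with equal thresholds and equal
   initial images. *)
- have [g [Y [YZ Yunc] Yg]] := dominated_uncountable ma Zunc.
  have [h hP] := bounded_lift g oca ma Fcoh.
  have /choice[m mP] a : exists m, Y a -> forall n, (m <= n)%N -> F a n = h n (a n).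
    have [Ya|nYa] := pselect (Y a); last by exists 0.
    pose b n := minn (a n) (g n).
    have Sb : allowed (below g) b by move=> n; exact: geq_minr.
    have [m mP] := almost_and (Yg a Ya) (almost_and (Fcoh a b) (hP b Sb)).
    exists m => _ n /mP[ag [Fab Fb]].
    have ab : a n = b n by rewrite /b (minn_idPl ag).
    by rewrite Fab// Fb// -ab.
  have [a [b [Ya Yb ab [mab Fab]]]] :=
    uncountable_collision (fun a => (m a, mkseq (F a) (m a))) Yunc.
  have [n abn] := ZK a b (YZ _ Ya) (YZ _ Yb) ab; case.
  have [nm|mn] := ltnP n (m a).
    by move: Fab; rewrite -mab => /agree_mkseq; exact.
  by rewrite !mP// -?mab// abn.
- have [|||c [h hP]] := @lift_of_cover F (fun=> setT) nat G (fun=> setT) (fun=> 0) Fcoh.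
  + by move=> n.
  + by move=> a _; exact: Gcov.
  + by move=> c a b n Ga Gb _ ab; apply: contrapT => Fab; apply: (GK c a b Ga Gb); exists n.
  exists h => a; have /almost_mono := hP a (fun n => I); apply => n; exact.
Qed.

(** * Local triviality of automorphisms of P(N)/Fin *)

Notation bitfun := (nat -> bool).

Definition xorf (a b : bitfun) : bitfun := fun i => a i (+) b i.
Definition andf (a b : bitfun) : bitfun := fun i => a i && b i.
Definition notf (a : bitfun) : bitfun := fun i => ~~ a i.

Lemma xorfK a b : xorf (xorf a b) b = a.
Proof. by apply/funext => i; rewrite /xorf addbK. Qed.

Lemma agree_xorf m a b a' b' : agree m a a' -> agree m b b' ->
  agree m (xorf a b) (xorf a' b').
Proof. by move=> aa' bb' i im; rewrite /xorf aa'// bb'. Qed.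

Definition zero_below (j : nat) (u : bitfun) : Prop := agree j (fun=> false) u.

Lemma zero_below_xorf j a b : agree j a b -> zero_below j (xorf a b).
Proof. by move=> ab i ij; rewrite /xorf ab// addbb. Qed.

Lemma agree_xorf_zero m a u : zero_below m u -> agree m a (xorf a u).
Proof. by move=> u0 i im; rewrite /xorf -u0// addbF. Qed.

(** * From uniformly continuous pieces to a continuous homomorphism *)

Section LocalHomomorphism.
Context (B : bitfun) (beta : bitfun -> bitfun) (C : countType) (X : C -> set bitfun).

(* On every cone where a piece of the cover is dense, [beta] restricted to
   this piece is uniformly continuous. *)
Definition uniformly_continuous_pieces : Prop :=
  forall k x m, dense_at (X k) x m -> forall n, B n ->
  exists N, forall a b, X k a -> X k b -> agree m x a -> agree m x b ->
    agree N a b -> beta a n = beta b n.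

Hypothesis Xcover : forall a, exists k, X k a.
Hypothesis Xuc : uniformly_continuous_pieces.
Hypothesis beta_xor : forall a b,
  almost (fun n => B n -> beta (xorf a b) n = beta a n (+) beta b n).

Definition continuous_on (x : bitfun) (m : nat) (G : bitfun -> bitfun) : Prop :=
  forall n, B n -> exists N, forall r r', agree m x r -> agree m x r' ->
    agree N r r' -> G r n = G r' n.

(** The [n]-th value at [r] is read off from a point of [X k] close enough to [r] for this
    coordinate. *)
Lemma continuous_extension k x m : dense_at (X k) x m ->
  exists G, continuous_on x m G /\
    forall a n, X k a -> agree m x a -> B n -> G a n = beta a n.
Proof.
move=> Xd; have /choice[N NP] (n : nat) : exists N, B n -> forall a b,
    X k a -> X k b -> agree m x a -> agree m x b -> agree N a b -> beta a n = beta b n.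
  have [Bn|nB] := boolP (B n); last by exists 0.
  by have [N NP] := Xuc Xd Bn; exists N.
have /choice[p pP] (q : bitfun * nat) : exists p, agree m x q.1 ->
    X k p /\ agree q.2 q.1 p.
  have [xq|nxq] := pselect (agree m x q.1); last by exists x.
  by have [p Xp qp] := Xd q.1 q.2 xq; exists p.
have pag r n : agree m x r ->
    [/\ X k (p (r, maxn m (N n))), agree m x (p (r, maxn m (N n))) &
        agree (N n) r (p (r, maxn m (N n)))].
  move=> xr; have [Xp rp] := pP (r, maxn m (N n)) xr; split=> //.
    exact: agree_trans xr (agree_le (leq_maxl _ _) rp).
  exact: agree_le (leq_maxr _ _) rp.
exists (fun r n => beta (p (r, maxn m (N n))) n); split=> [n Bn|a n Xa xa Bn].
  exists (N n) => r r' xr xr' rr'.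
  have [Xp xp rp] := pag r n xr; have [Xp' xp' rp'] := pag r' n xr'.
  apply: NP => //; apply: agree_trans (agree_sym rp) _.
  exact: agree_trans rr' rp'.
have [Xp xp ap] := pag a n xa; apply: NP => //; exact: agree_sym.
Qed.

Let ofs (s : seq bool) : bitfun := nth false s.

Lemma agree_ofs (a : bitfun) m : agree m a (ofs (mkseq a m)).
Proof. by move=> i im; rewrite /ofs nth_mkseq. Qed.

(* Fix a piece that is nonmeager everywhere in a cone and let [G] extend
   [beta] there.  For every [a], a Baire category argument writes [beta a] as
   the sum of [G r] and of a continuous function of [r + a]; within one of
   countably many classes the latter function is the same. *)
Lemma additive_classes : exists x m G, continuous_on x m G /\
  forall y k, (m <= k)%N -> agree m x y ->
  exists (A : (C * nat * seq bool * seq bool)%type -> set bitfun) z l e,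
    (forall a, exists t, A t a) /\
    forall t a b, A t a -> A t b -> [/\ (k <= l t)%N, agree k y (z t),
      agree (l t) a b & forall r n, agree (l t) (z t) r -> (e t <= n)%N -> B n ->
        beta a n (+) beta b n = G r n (+) G (xorf r (xorf a b)) n].
Proof.
have [c [x [m nonmeager]]] := @baire_nonmeager bool false C (C * nat)%type X Xcover.
have Xd : dense_at (X c) x m.
  move=> y k xy; have [|_ [z [l [kl yz zd]]]] :=
    nonmeager y (maxn m k) (leq_maxl _ _) xy (fun=> X c).
    by move=> z Xz _; exists (c, 0).
  have [w Xw zw] := zd z l (fun i _ => erefl).
  exists w => //; apply: agree_trans (agree_le (leq_maxr m k) yz) _.
  exact: agree_le (leq_trans (leq_maxr m k) kl) zw.
have [G [Gcont Gbeta]] := continuous_extension Xd.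
have /choice[GE GEP] (p : C * seq bool) : exists E,
    dense_at (X p.1) (ofs p.2) (size p.2) -> continuous_on (ofs p.2) (size p.2) E /\
    forall a n, X p.1 a -> agree (size p.2) (ofs p.2) a -> B n -> E a n = beta a n.
  have [d|nd] := pselect (dense_at (X p.1) (ofs p.2) (size p.2)).
    by have [E EP] := continuous_extension d; exists E.
  by exists (fun=> x).
exists x, m, G; split=> // y k mk xy.
pose z (t : C * nat * seq bool * seq bool) := ofs t.1.2.
pose l (t : C * nat * seq bool * seq bool) := size t.1.2.
pose e (t : C * nat * seq bool * seq bool) := t.1.1.2.
pose A (t : C * nat * seq bool * seq bool) : set bitfun := [set a |
  [/\ (k <= l t)%N, agree k y (z t), mkseq a (l t) = t.2 &
    forall r n, agree (l t) (z t) r -> (e t <= n)%N -> B n ->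
      beta a n = G r n (+)
        GE (t.1.1.1, mkseq (xorf (z t) (ofs t.2)) (l t)) (xorf r a) n]].
exists A, z, l, e; split=> [a|t a b [klt yz at_ ha] [_ _ bt hb]]; last first.
  have ab : agree (l t) a b by apply/agree_mkseq; rewrite at_ bt.
  split=> // r n zr en Bn.
  have zr' : agree (l t) (z t) (xorf r (xorf a b)).
    by apply: agree_trans zr _; apply: agree_xorf_zero; exact: zero_below_xorf.
  rewrite (ha r n)// (hb (xorf r (xorf a b)) n)//.
  have -> : xorf (xorf r (xorf a b)) b = xorf r a.
    by apply/funext => i; rewrite /xorf addbA addbK.
  by rewrite addbACA addbb addbF.
(* With [a] fixed, [r] is sorted by the piece of [xorf r a] and by a threshold from which [beta a]
   is the sum of [beta r] and [beta (xorf r a)]. *)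
pose W (d : C * nat) : set bitfun := [set r | [/\ X c r, X d.1 (xorf r a) &
  forall n, (d.2 <= n)%N -> B n -> beta a n = beta r n (+) beta (xorf r a) n]].
have [r Xr _|[k' e'] [w [l' [kl' yw Wd]]]] := nonmeager y k mk xy W.
  have [k' Xk'] := Xcover (xorf r a); have [m' mP] := beta_xor (xorf r a) r.
  exists (k', m'); split=> // n mn Bn; rewrite -addbC -mP//; congr beta.
  by apply/funext => i; rewrite /xorf addbAC addbb.
pose t : C * nat * seq bool * seq bool := (k', e', mkseq w l', mkseq a l').
have lt : l t = l' by rewrite /l size_mkseq.
have wz : agree l' w (z t) by exact: agree_ofs.
exists t; split; rewrite ?lt//; first exact: agree_trans yw (agree_le kl' wz).
set s := mkseq _ _; have ss : size s = l' by rewrite size_mkseq.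
have sE : agree l' (ofs s) (xorf w a).
  move=> i il; rewrite /ofs nth_mkseq//; apply: agree_xorf il; first exact: agree_sym.
  by rewrite /t /=; apply: agree_sym; exact: agree_ofs.
have sd : dense_at (X k') (ofs s) (size s).
  move=> v j; rewrite ss => sv.
  have [|r [_ Xr _] vr] := Wd (xorf v a) j.
    rewrite -[w](xorfK _ a); apply: agree_xorf => //.
    exact: agree_trans (agree_sym sE) sv.
  exists (xorf r a) => //; rewrite -[v](xorfK _ a); exact: agree_xorf.
have [Econt Ebeta] := GEP (k', s) sd; rewrite /= ss in Econt Ebeta.
move=> r n zr en Bn.
have [N1 N1P] := Gcont n Bn; have [N2 N2P] := Econt n Bn.
have wr : agree l' w r by exact: agree_trans wz zr.
have [r' [Xr' Xra' hr'] rr'] := Wd r (maxn l' (maxn N1 N2)) wr.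
have xr : agree m x r.
  apply: agree_trans xy _; apply: agree_trans (agree_le mk yw) _.
  exact: agree_le (leq_trans mk kl') wr.
have rr'l : agree l' r r' by exact: agree_le (leq_maxl _ _) rr'.
have xr' : agree m x r' by apply: agree_trans xr (agree_le (leq_trans mk kl') rr'l).
rewrite hr'// -Gbeta// -(Ebeta (xorf r' a))//; last first.
  by apply: agree_trans sE _; apply: agree_xorf => //; exact: agree_trans wr rr'l.
congr (_ (+) _).
  by apply: N1P => //; apply: agree_sym; apply: agree_le rr'; rewrite !leq_max leqnn orbT.
apply: N2P.
- by apply: agree_trans sE _; apply: agree_xorf => //; exact: agree_trans wr rr'l.
- by apply: agree_trans sE _; exact: agree_xorf.
- apply: agree_xorf => //; apply: agree_sym; apply: agree_le rr'.
  by rewrite !leq_max leqnn !orbT.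
Qed.

(** [H u] is the increment of [G] from [z t] to its sum with [u]. It does not depend on the base
    point, since continuity and density turn each of its coordinates into one of [beta a (+) beta b]
    with [a], [b] in one class; hence it is additive. *)
Lemma homomorphism_lift : exists (j e : nat) (H : bitfun -> bitfun),
  [/\ forall u v n, zero_below j u -> zero_below j v -> (e <= n)%N -> B n ->
        H (xorf u v) n = H u n (+) H v n,
      forall n, (e <= n)%N -> B n -> exists N, forall u v,
        zero_below j u -> zero_below j v -> agree N u v -> H u n = H v n &
      exists (A : (C * nat * seq bool * seq bool)%type -> set bitfun) E,
        (forall a, exists t, A t a) /\
        forall t a b, A t a -> A t b -> zero_below j (xorf a b) /\
          forall n, (E t <= n)%N -> B n -> beta a n (+) beta b n = H (xorf a b) n].
Proof.
have [x [m [G [Gcont classes]]]] := additive_classes.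
have [A [z [l [e [Acov AP]]]]] := classes x m (leqnn m) (fun i _ => erefl).
have [t [w [j0 wd0]]] := baire false Acov.
pose j := maxn j0 (l t).
have {wd0} wd : dense_at (A t) w j by apply: dense_at_sub wd0 (leq_maxl _ _) _.
have lj : (l t <= j)%N by exact: leq_maxr.
have [a0 Aa0 _] := wd w 0 (fun i _ => erefl).
have [ml xz _ _] := AP t a0 a0 Aa0 Aa0.
have zshift r u : agree (l t) (z t) r -> zero_below j u -> agree (l t) (z t) (xorf r u).
  move=> zr u0; apply: agree_trans zr _; apply: agree_xorf_zero; exact: agree_le u0.
have xcone r : agree (l t) (z t) r -> agree m x r.
  by move=> zr; apply: agree_trans xz _; exact: agree_le zr.
have Gindep r r' u n : agree (l t) (z t) r -> agree (l t) (z t) r' ->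
    zero_below j u -> (e t <= n)%N -> B n ->
    G r n (+) G (xorf r u) n = G r' n (+) G (xorf r' u) n.
  move=> zr zr' u0 en Bn; have [N NP] := Gcont n Bn.
  have [a Aa wa] := wd w (maxn N j) (fun i _ => erefl).
  have [b Ab wb] := wd (xorf w u) (maxn N j) (agree_xorf_zero w u0).
  have ab : agree (maxn N j) u (xorf a b).
    by move=> i ij; rewrite /xorf -wa// -wb// /xorf addbA addbb.
  have ab0 : zero_below j (xorf a b).
    by apply: agree_trans u0 _; exact: agree_le (leq_maxr _ _) ab.
  have [_ _ _ abP] := AP t a b Aa Ab.
  have Gu s : agree (l t) (z t) s -> G (xorf s u) n = G (xorf s (xorf a b)) n.
    move=> zs; apply: NP; [exact/xcone/zshift|exact/xcone/zshift|].
    by apply: agree_xorf => //; exact: agree_le (leq_maxl _ _) ab.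
  by rewrite !Gu// -!abP.
pose H u n := G (z t) n (+) G (xorf (z t) u) n.
have HP r u n : agree (l t) (z t) r -> zero_below j u -> (e t <= n)%N -> B n ->
    G r n (+) G (xorf r u) n = H u n by move=> zr u0 en Bn; exact: Gindep.
have zz : agree (l t) (z t) (z t) by [].
exists j, (e t), H; split.
- move=> u v n u0 v0 en Bn; rewrite -(HP (xorf (z t) u) v n (zshift _ _ zz u0) v0 en Bn).
  rewrite /H addbA addbK; congr (_ (+) G _ n).
  by apply/funext => i; rewrite /xorf addbA.
- move=> n en Bn; have [N NP] := Gcont n Bn; exists N => u v u0 v0 uv.
  rewrite /H; congr (_ (+) _); apply: NP; [exact/xcone/zshift|exact/xcone/zshift|].
  exact: agree_xorf.
have mj : (m <= j)%N by exact: leq_trans lj.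
(* A second use of the classes, now with length [j]: members of one class differ only from [j] on,
   where the properties of [H] hold. *)
have [A' [z' [l' [e' [A'cov A'P]]]]] := classes (z t) j mj xz.
exists A', (fun s => maxn (e t) (e' s)); split=> // s a b Aa Ab.
have [jl zz' ab abP] := A'P s a b Aa Ab.
have ab0 : zero_below j (xorf a b) by apply: zero_below_xorf; exact: agree_le ab.
split=> // n; rewrite geq_max => /andP[en e'n] Bn.
by rewrite (abP (z' s) n)// HP//; exact: agree_le zz'.
Qed.

End LocalHomomorphism.

Definition unbounded (a : bitfun) : Prop := forall m, exists2 n, (m <= n)%N & a n.

Definition point (p : nat) : bitfun := fun i => i == p.

(** The pairs are picked in successive disjoint intervals, and [Q] collects their first entries. *)
Lemma separating_set (R : nat -> nat -> nat -> Prop) :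
  (forall k, exists p q n, [/\ (k <= p)%N, (k <= q)%N, (k <= n)%N, R p q n & p <> q]) ->
  exists Q : bitfun, forall k, exists p q n,
    [/\ [/\ (k <= p)%N, (k <= q)%N & (k <= n)%N], R p q n, Q p & ~~ Q q].
Proof.
move=> many; have /choice[s sP] (k : nat) : exists x : nat * nat * nat,
    [/\ (k <= x.1.1)%N, (k <= x.1.2)%N, (k <= x.2)%N, R x.1.1 x.1.2 x.2 & x.1.1 <> x.1.2].
  by have [p [q [n h]]] := many k; exists (p, q, n).
pose k := fix k i := if i is i'.+1
  then (maxn (s (k i')).1.1 (s (k i')).1.2).+1 else 0.
pose p i := (s (k i)).1.1; pose q i := (s (k i)).1.2; pose n i := (s (k i)).2.
have kS i : (p i < k i.+1)%N /\ (q i < k i.+1)%N.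
  by rewrite /= !ltnS leq_maxl leq_maxr.
have kp i : (k i <= p i)%N by have [] := sP (k i).
have kq i : (k i <= q i)%N by have [] := sP (k i).
have k_le i i' : (i < i')%N -> (k i.+1 <= k i')%N.
  elim: i' => // i' IH; rewrite ltnS leq_eqVlt => /predU1P[->//|/IH].
  by move=> /leq_trans; apply; apply: leq_trans (kp i') (ltnW (kS i').1).
have k_ge i : (i <= k i)%N.
  by elim: i => // i IH; apply: leq_ltn_trans IH _; exact: leq_ltn_trans (kp i) (kS i).1.
exists (fun x => `[< exists i, x = p i >]) => i; exists (p i), (q i), (n i).
have [_ _ kn Rn pq] := sP (k i); split=> //.
- split; [exact: leq_trans (k_ge i) (kp i)|exact: leq_trans (k_ge i) (kq i)|].
  exact: leq_trans (k_ge i) kn.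
- by apply/asboolP; exists i.
apply/negP => /asboolP[i' qp].
case: (ltngtP i i') => [ii'|i'i|ii']; last by apply: pq; rewrite -/(q i) qp -ii'.
  have := leq_trans (kS i).2 (leq_trans (k_le _ _ ii') (kp i')).
  by rewrite qp ltnn.
have := leq_trans (kS i').1 (leq_trans (k_le _ _ i'i) (kq i)).
by rewrite qp ltnn.
Qed.

(** * From a continuous homomorphism to a point map *)

Section LocalPointMap.
Context (B : bitfun) (beta : bitfun -> bitfun) (T : countType).
Context (A : T -> set bitfun) (E : T -> nat) (H : bitfun -> bitfun) (j e : nat).

Hypothesis beta_xor : forall a b,
  almost (fun n => B n -> beta (xorf a b) n = beta a n (+) beta b n).
Hypothesis beta_sub : forall a b : bitfun, (forall i, a i -> b i) ->
  almost (fun n => beta a n -> beta b n).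
Hypothesis beta_disj : forall a, almost (fun n => ~ (beta a n /\ beta (notf a) n)).
Hypothesis beta_unbounded : forall a, unbounded a -> unbounded (beta a).
Hypothesis beta_onto : forall N : bitfun, unbounded N -> (forall n, N n -> B n) ->
  exists2 a, unbounded a & almost (fun n => beta a n -> N n).
Hypothesis H_xor : forall u v n, zero_below j u -> zero_below j v ->
  (e <= n)%N -> B n -> H (xorf u v) n = H u n (+) H v n.
Hypothesis H_cont : forall n, (e <= n)%N -> B n -> exists N, forall u v,
  zero_below j u -> zero_below j v -> agree N u v -> H u n = H v n.
Hypothesis A_cover : forall a, exists t, A t a.
Hypothesis A_lift : forall t a b, A t a -> A t b -> zero_below j (xorf a b) /\
  forall n, (E t <= n)%N -> B n -> beta a n (+) beta b n = H (xorf a b) n.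

(** When [a] is sorted by the class of [andf a Q], category gives [a], [b] in one class whose traces
    on [Q] differ by [u] up to any given level. So [H u n] is the sum of two values of [beta] at
    subsets of [Q]. *)
Lemma lift_sub (Q : bitfun) : exists j' e', forall (u : bitfun) n,
  (forall i, u i -> Q i) ->
  zero_below j' u -> (e' <= n)%N -> B n -> H u n -> beta Q n.
Proof.
have QA a : exists t : T * nat, A t.1 (andf a Q) /\
    forall n, (t.2 <= n)%N -> beta (andf a Q) n -> beta Q n.
  have [t At] := A_cover (andf a Q).
  have [|m mP] := @beta_sub (andf a Q) Q; first by move=> i /andP[].
  by exists (t, m).
have [[t m] [w [k wd]]] := baire false QA.
exists (maxn j k), (maxn e (maxn (E t) m)) => u n uQ u0.
rewrite !geq_max => /and3P[en En mn] Bn Hu.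
have [N NP] := H_cont en Bn; set l := maxn N (maxn j k).
have [a [/= Aa aQ] wa] := wd w l (fun i _ => erefl).
have [|b [/= Ab bQ] wb] := wd (xorf w u) l.
  by apply: agree_xorf_zero; exact: agree_le (leq_maxr _ _) u0.
have [ab0 abH] := A_lift Aa Ab.
have uab : agree l u (xorf (andf a Q) (andf b Q)).
  move=> i il; rewrite /xorf /andf -wa// -wb// /xorf.
  by have := uQ i; case: (u i); case: (w i); case: (Q i) => // /(_ isT).
have uj : zero_below j u by exact: agree_le (leq_maxl _ _) u0.
move: Hu; rewrite (NP u (xorf (andf a Q) (andf b Q)))//; last first.
  exact: agree_le (leq_maxl _ _) uab.
rewrite -abH//.
have [an _|_] := boolP (beta (andf a Q) n); first exact: aQ mn an.
by move=> /(bQ n mn).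
Qed.

Lemma zero_below_point k p : (k <= p)%N -> zero_below k (point p).
Proof. by move=> kp i ik; rewrite /point ltn_eqF//; exact: leq_trans kp. Qed.

Lemma point_sub p (Q : bitfun) : Q p -> forall i, point p i -> Q i.
Proof. by move=> Qp i /eqP ->. Qed.

(** Otherwise a set [Q] separates infinitely many such pairs [p], [q], and some large [n] lies in
    both [beta Q] and [beta (notf Q)]. *)
Lemma almost_one_point : exists j' e', forall n p q, (e' <= n)%N -> B n ->
  (j' <= p)%N -> (j' <= q)%N -> H (point p) n -> H (point q) n -> p = q.
Proof.
apply: contrapT => /forallNP many.
have [k|Q sepQ] := @separating_set
  (fun p q n => [/\ B n, H (point p) n & H (point q) n]).
  apply: contrapT => nx; apply: (many k); exists k.
  by move=> n p q kn Bn kp kq Hp Hq; apply: contrapT => pq; apply: nx; exists p, q, n.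
have [j1 [e1 R1]] := lift_sub Q; have [j2 [e2 R2]] := lift_sub (notf Q).
have [m mP] := beta_disj Q.
have [p [q [n [[kp kq kn] [Bn Hp Hq] Qp Qq]]]] :=
  sepQ (maxn (maxn j1 j2) (maxn m (maxn e1 e2))).
move: kp kq kn; rewrite !geq_max => /andP[/andP[j1p _] _] /andP[/andP[_ j2q] _].
move=> /and4P[_ mn e1n e2n]; apply: (mP n mn); split.
  apply: (R1 (point p) n) => //; [exact: point_sub|exact: zero_below_point].
apply: (R2 (point q) n) => //; [exact: point_sub|exact: zero_below_point].
Qed.

(** By continuity only a finite part of [u] matters, and this part is a sum of points. *)
Lemma H_zero k u n : (j <= k)%N -> zero_below k u -> (e <= n)%N -> B n ->
  (forall p, (k <= p)%N -> ~~ H (point p) n) -> H u n = false.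
Proof.
move=> jk u0 en Bn Hp; have [N NP] := H_cont en Bn.
pose cut (N : nat) : bitfun := fun i => (i < N)%N && u i.
have cut0 M : zero_below j (cut M).
  by move=> i ij; rewrite /cut -u0 ?andbF//; exact: leq_trans jk.
have uj : zero_below j u by exact: agree_le u0.
rewrite (NP u (cut N))//; last by move=> i iN; rewrite /cut iN.
have z0 : zero_below j (fun=> false) by [].
elim: N {NP} => [|M IH].
  have -> : cut 0 = xorf (cut 0) (cut 0) by apply/funext => i; rewrite /xorf addbb.
  by rewrite H_xor// addbb.
have [uM|uM] := boolP (u M).
  have kM : (k <= M)%N by rewrite leqNgt; apply/negP => /u0; rewrite uM.
  have -> : cut M.+1 = xorf (cut M) (point M).
    apply/funext => i; rewrite /xorf /cut /point ltnS leq_eqVlt.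
    by case: eqVneq => [->|]; rewrite ?ltnn ?uM ?addbF.
  rewrite H_xor ?IH//; first exact/negbTE/Hp.
  exact: zero_below_point (leq_trans jk kM).
rewrite -IH; congr H; apply/funext => i; rewrite /cut ltnS leq_eqVlt.
by case: eqVneq => [->|//]; rewrite (negPf uM) ltnn.
Qed.

(** If there were infinitely many exceptional [n], surjectivity would give an infinite [a] with
    [beta a] almost contained in the set of them. Two subsets of [a] in one class have an infinite
    symmetric difference [u] that vanishes below [k]. Then [H u] vanishes at exceptional points,
    although [beta u] is infinite and almost contained in their set. *)
Lemma almost_some_point k : (j <= k)%N ->
  almost (fun n => B n -> exists2 p, (k <= p)%N & H (point p) n).
Proof.
move=> jk; apply: contrapT => /notalmostP bad.
pose N (n : nat) : bool := `[< [/\ B n, (e <= n)%N &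
  forall p, (k <= p)%N -> ~~ H (point p) n] >].
have [|n /asboolP[]//|a a_unb aN] := @beta_onto N.
  move=> m; have [n mn /not_implyP[Bn np]] := bad (maxn m e).
  exists n; first exact: leq_trans (leq_maxl _ _) mn.
  apply/asboolP; split=> // [|p kp]; first exact: leq_trans (leq_maxr _ _) mn.
  by apply/negP => Hp; apply: np; exists p.
have /(@greedy_injection (nat * nat)%type)[q qinj qa] :
    forall c : nat * nat, infinite_set [set n | a n].
  by move=> _; apply/infinite_geP => m; have [n] := a_unb m; exists n.
(* [q] provides disjoint infinite columns inside [a], and [z] selects columns; distinct selections
   differ on an infinite set. *)
pose sub (z : bitfun) (n : nat) : bool := `[< exists i i', n = q (i, i') /\ z i >].
have sub_q z i i' : sub z (q (i, i')) = z i.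
  apply/asboolP/idP => [[i1 [i1' [/qinj[-> _]]]]//|zi].
  by exists i, i'.
have sub_a z i : sub z i -> a i by move=> /asboolP[i1 [i1' [-> _]]]; exact: qa.
have /choice[t tP] z : exists t, A t (sub z) by exact: A_cover.
have [z [w [_ _ zw [tzw]]]] :=
  uncountable_collision (fun z => (t z, mkseq (sub z) k)) uncountable_cantor.
move=> /agree_mkseq zwk; pose u := xorf (sub z) (sub w).
have [d [_ zd]] := first_difference zw.
have u_unb : unbounded u.
  move=> m; have [|i mi] := @injective_unbounded (fun i => q (d, i)) m.
    by move=> i i' /qinj[].
  exists (q (d, i)) => //; rewrite /u /xorf !sub_q.
  by case: (z d) (w d) zd => -[].
have uk : zero_below k u by exact: zero_below_xorf.
have := tP w; rewrite -tzw => Aw; have [_ uH] := A_lift (tP z) Aw.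
have [|m1 m1P] := @beta_sub u a.
  move=> i; rewrite /u /xorf => ui; apply: contraT => /negP nai.
  move: ui; case: (boolP (sub z i)) => [/sub_a//|_].
  by case: (boolP (sub w i)) => [/sub_a|].
have [m2 m2P] := aN; have [m3 m3P] := beta_xor (sub z) (sub w).
have [n] := beta_unbounded u_unb (maxn (maxn m1 m2) (maxn m3 (E (t z)))).
rewrite !geq_max => /andP[/andP[n1 n2] /andP[n3 nE]] bn.
have /asboolP[Bn en Hn] := m2P n n2 (m1P n n1 bn).
by move: bn; rewrite m3P// uH// (H_zero jk uk).
Qed.

(** For large [n] in [B], [f n] is the only large [p] with [H (point p) n]. By [lift_sub] for [a]
    and for its complement, [beta a n] tells whether this [p] lies in [a]. *)
Lemma point_map : exists f : nat -> nat, forall a,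
  almost (fun n => B n -> beta a n = a (f n)).
Proof.
have [j2 [e2 one]] := almost_one_point.
have /choice[f fP] (n : nat) : exists p, forall p', (e2 <= n)%N -> B n ->
    (j2 <= p')%N -> H (point p') n -> p = p'.
  have [[p [en Bn jp Hp]]|np] := pselect (exists p,
      [/\ (e2 <= n)%N, B n, (j2 <= p)%N & H (point p) n]).
    by exists p => p' _ _ jp' Hp'; exact: (one n).
  by exists 0 => p' en Bn jp' Hp'; case: np; exists p'.
exists f => a; have [j3 [e3 R3]] := lift_sub a.
have [j4 [e4 R4]] := lift_sub (notf a); have [m mP] := beta_disj a.
pose k := maxn (maxn j j2) (maxn j3 j4).
have [|m' m'P] := @almost_some_point k; first by rewrite /k !leq_max leqnn.
exists (maxn (maxn e2 e3) (maxn e4 (maxn m m'))) => n.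
rewrite !geq_max => /andP[/andP[n2 n3] /and3P[n4 nm nm']] Bn.
have [p] := m'P n nm' Bn; rewrite !geq_max => /andP[/andP[_ j2p] /andP[j3p j4p]] Hp.
rewrite (fP n p)//; have [ap|ap] := boolP (a p).
  apply: (R3 (point p) n) => //; [exact: point_sub|exact: zero_below_point].
apply/negP => bn; apply: (mP n nm); split=> //.
apply: (R4 (point p) n) => //; [exact: point_sub|exact: zero_below_point].
Qed.

End LocalPointMap.

(* [F] and [G] lift mutually inverse automorphisms of P(N)/Fin. *)
Record fin_iso (F G : bitfun -> bitfun) : Prop := FinIso {
  fi_ext : forall a b, almost (fun n => a n = b n) -> almost (fun n => F a n = F b n);
  fi_and : forall a b, almost (fun n => F (andf a b) n = F a n && F b n);
  fi_not : forall a, almost (fun n => F (notf a) n = ~~ F a n);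
  fi_FG : forall a, almost (fun n => F (G a) n = a n);
  fi_GF : forall a, almost (fun n => G (F a) n = a n) }.

Section FinIso.
Context (F G : bitfun -> bitfun) (FG : fin_iso F G).

Lemma fi_xor a b : almost (fun n => F (xorf a b) n = F a n (+) F b n).
Proof.
have -> : xorf a b = notf (andf (notf (andf a (notf b))) (notf (andf (notf a) b))).
  by apply/funext => i; rewrite /xorf /notf /andf; case: (a i); case: (b i).
have := almost_and (fi_not FG (andf (notf (andf a (notf b))) (notf (andf (notf a) b))))
  (almost_and (fi_and FG (notf (andf a (notf b))) (notf (andf (notf a) b)))
  (almost_and (almost_and (fi_not FG (andf a (notf b))) (fi_not FG (andf (notf a) b)))
  (almost_and (almost_and (fi_and FG a (notf b)) (fi_and FG (notf a) b))
  (almost_and (fi_not FG a) (fi_not FG b))))).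
move=> /almost_mono; apply => n [-> [-> [[-> ->] [[-> ->] [-> ->]]]]].
by case: (F a n); case: (F b n).
Qed.

Lemma fi_sub (a b : bitfun) : (forall i, a i -> b i) -> almost (fun n => F a n -> F b n).
Proof.
move=> ab; have /almost_mono := fi_and FG a b; apply => n.
have -> : andf a b = a by apply/funext => i; rewrite /andf; case: (a i) (ab i) => // ->.
by move=> -> /andP[].
Qed.

Lemma fi_disj (a b : bitfun) : (forall i, ~ (a i /\ b i)) -> almost (fun n => ~ (F a n /\ F b n)).
Proof.
move=> ab; have := almost_and (@fi_sub a (notf b) _) (fi_not FG b).
have h i : a i -> notf b i by move=> ai; apply/negP => bi; exact: (ab i).
by move=> /(_ h) /almost_mono; apply => n [Fab Fb] [/Fab]; rewrite Fb => /negP.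
Qed.

Lemma not_unbounded (a : bitfun) : ~ unbounded a <-> almost (fun n => a n = false).
Proof.
split=> [na|[m mP] /(_ m)[n /mP ->]//].
apply: contrapT => /notalmostP h; apply: na => m; have [n mn an] := h m.
by exists n => //; case: (a n) an.
Qed.

Lemma fi_zero : almost (fun n => F (fun=> false) n = false).
Proof.
have := almost_and (fi_and FG (fun=> false) (notf (fun=> false))) (fi_not FG (fun=> false)).
move=> /almost_mono; apply => n [+ Fn].
have -> : andf (fun=> false) (notf (fun=> false)) = (fun=> false) by [].
by rewrite Fn andbN.
Qed.

Lemma fi_bounded a : almost (fun n => a n = false) -> almost (fun n => F a n = false).
Proof.
move=> a0; have /almost_mono := almost_and (@fi_ext _ _ FG a (fun=> false) a0) fi_zero.
by apply => n [->].
Qed.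

End FinIso.

Lemma fin_iso_sym F G : fin_iso F G ->
  (forall a b, almost (fun n => a n = b n) -> almost (fun n => G a n = G b n)) ->
  fin_iso G F.
Proof.
move=> FG Gext; split=> //.
- move=> a b.
  have h : almost (fun n => andf a b n = F (andf (G a) (G b)) n).
    have /almost_mono := almost_and (fi_and FG (G a) (G b))
      (almost_and (fi_FG FG a) (fi_FG FG b)).
    by apply => n [-> [-> ->]].
  have /almost_mono := almost_and (Gext _ _ h) (fi_GF FG (andf (G a) (G b))).
  by apply => n [-> ->].
- move=> a; have h : almost (fun n => notf a n = F (notf (G a)) n).
    by have /almost_mono := almost_and (fi_not FG (G a)) (fi_FG FG a); apply => n [-> ->].
  have /almost_mono := almost_and (Gext _ _ h) (fi_GF FG (notf (G a))).
  by apply => n [-> ->].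
- exact: fi_GF.
- exact: fi_FG.
Qed.

Lemma fi_unbounded F G a : fin_iso F G -> fin_iso G F -> unbounded a -> unbounded (F a).
Proof.
move=> FG GF ua; apply: contrapT => /not_unbounded /(fi_bounded GF) GFa.
suff : ~ unbounded a by [].
apply/not_unbounded; have /almost_mono := almost_and GFa (fi_GF FG a).
by apply => n [<- ->].
Qed.

(** * Branches of the binary tree and local triviality *)

Section TreeLocal.
Context (F G : bitfun -> bitfun) (FG : fin_iso F G) (GF : fin_iso G F).
Context (q : seq bool -> nat) (qinj : injective q).

(** [z] determines a branch of the tree and [a] selects levels on it. Distinct branches share only
    the nodes up to their splitting, hence are almost disjoint. *)
Definition branch (z a : bitfun) : bitfun :=
  fun x => `[< exists2 i, x = q (mkseq z i) & a i >].

Let top : bitfun := fun=> true.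

Lemma branch_q z a i : branch z a (q (mkseq z i)) = a i.
Proof.
apply/asboolP/idP => [[i' /qinj ii' ai']|ai]; last by exists i.
by have := congr1 size ii'; rewrite !size_mkseq => ->.
Qed.

Lemma branch_xor z a b : branch z (xorf a b) = xorf (branch z a) (branch z b).
Proof.
apply/funext => x; have [[i ->]|nx] := pselect (exists i, x = q (mkseq z i)).
  by rewrite /xorf !branch_q.
have nb c : branch z c x = false by apply/asboolPn => -[i xi _]; apply: nx; exists i.
by rewrite /xorf !nb.
Qed.

Lemma branch_sub z (a b : bitfun) : (forall i, a i -> b i) ->
  forall x, branch z a x -> branch z b x.
Proof. by move=> ab x /asboolP[i -> ai]; rewrite branch_q ab. Qed.

Lemma branch_unbounded z a : unbounded (branch z a) <-> unbounded a.
Proof.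
split=> ua; last first.
  move=> m; have [L LP] : exists L, forall i, (L <= i)%N -> (m <= q (mkseq z i))%N.
    have /choice[g gP] (v : nat) : exists i, forall i', q (mkseq z i') = v -> i' = i.
      have [[i iv]|ni] := pselect (exists i, q (mkseq z i) = v).
        exists i => i'; rewrite -iv => /qinj /(congr1 size); rewrite !size_mkseq.
        exact.
      by exists 0 => i' iv; case: ni; exists i'.
    exists (\max_(v < m) g v).+1 => i Li; rewrite leqNgt; apply/negP => im.
    have := @leq_bigmax _ (fun v : 'I_m => g v) (Ordinal im); rewrite /= -(gP _ i erefl).
    by rewrite leqNgt Li.
  by have [i Li ai] := ua L; exists (q (mkseq z i)); [exact: LP|rewrite branch_q].
apply: contrapT => /not_unbounded[m mP].
have [x mx /asboolP[i xi ai]] := ua (\max_(i < m) q (mkseq z i)).+1.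
have [im|mi] := ltnP i m; last by rewrite mP in ai.
have := @leq_bigmax _ (fun v : 'I_m => q (mkseq z v)) (Ordinal im).
by rewrite /= -xi leqNgt mx.
Qed.

Lemma branch_restrict z (x : bitfun) :
  andf x (branch z top) = branch z (fun i => x (q (mkseq z i))).
Proof.
apply/funext => y; have [[i ->]|ny] := pselect (exists i, y = q (mkseq z i)).
  by rewrite /andf !branch_q andbT.
have nb c : branch z c y = false by apply/asboolPn => -[i yi _]; apply: ny; exists i.
by rewrite /andf !nb andbF.
Qed.

Let code (x : bitfun * bitfun) (n : nat) : bool * bool * bool * bool :=
  (x.1 n, x.2 n, F (branch x.1 top) n, F (branch x.1 x.2) n).

Let conf (x y : bitfun * bitfun) : Prop := exists d, [/\ agree d x.1 y.1, x.1 d <> y.1 d,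
  agree d.+1 x.2 y.2 & exists n, [/\ F (branch x.1 top) n, F (branch y.1 top) n &
    F (branch x.1 x.2) n <> F (branch y.1 y.2) n]].

(** For an uncountable homogeneous [Z], the union [c] of its sets [branch z a] cuts out exactly
    [branch z a] on the branch of [z], because second entries agree up to the splitting level. So
    [F c] determines all [F (branch z a)] modulo finite sets. *)
Lemma branch_cover (R : realType) (oca : OCA_T R) : exists P : nat -> set (bitfun * bitfun),
  (forall x, exists k, P k x) /\ forall k x y, P k x -> P k y -> ~ conf x y.
Proof.
have code_inj : injective code.
  move=> [z a] [w b] h; congr pair; apply/funext => n.
    by have := congr1 (fun f => (f n).1.1.1) h.
  by have := congr1 (fun f => (f n).1.1.2) h.
have [|||[Z Zunc ZK]|[P Pcov PK]] := @oca_coded R _ _ code code_inj oca conf.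
- move=> x y [d [xy xyd ab [n [xn yn neq]]]]; exists d; split.
  + exact: agree_sym.
  + exact/nesym.
  + exact: agree_sym.
  + by exists n; split=> //; exact/nesym.
- by move=> x [d []].
- move=> x y [d [xy xyd ab [n [xn yn neq]]]].
  exists (maxn d.+1 n.+1) => x' y' xx' yy'.
  have e (u u' : bitfun * bitfun) i : agree (maxn d.+1 n.+1) (code u) (code u') ->
      (i < d.+1)%N -> u.1 i = u'.1 i /\ u.2 i = u'.2 i.
    move=> uu' id; have il : (i < maxn d.+1 n.+1)%N by rewrite leq_max id.
    by have [-> -> _ _] := uu' i il.
  have en (u u' : bitfun * bitfun) : agree (maxn d.+1 n.+1) (code u) (code u') ->
      F (branch u.1 top) n = F (branch u'.1 top) n /\
      F (branch u.1 u.2) n = F (branch u'.1 u'.2) n.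
    move=> uu'; have nl : (n < maxn d.+1 n.+1)%N by rewrite leq_max leqnn orbT.
    by have [_ _ -> ->] := uu' n nl.
  exists d; split.
  + move=> i id; have id' : (i < d.+1)%N by exact: ltnW.
    by rewrite -(e _ _ i xx' id').1 -(e _ _ i yy' id').1; exact: xy.
  + by rewrite -(e _ _ d xx' (ltnSn d)).1 -(e _ _ d yy' (ltnSn d)).1.
  + by move=> i id; rewrite -(e _ _ i xx' id).2 -(e _ _ i yy' id).2; exact: ab.
  + by exists n; rewrite -(en _ _ xx').1 -(en _ _ xx').2 -(en _ _ yy').1 -(en _ _ yy').2.
- exfalso; pose c : bitfun := fun x => `[< exists2 p, Z p & branch p.1 p.2 x >].
  have cZ p : Z p -> andf c (branch p.1 top) = branch p.1 p.2.
    move=> Zp; rewrite branch_restrict; congr branch; apply/funext => i.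
    apply/asboolP/idP => [[p' Zp' /asboolP[i' /qinj ii' p'i']]|pi]; last first.
      by exists p => //; rewrite branch_q.
    have ieq : i = i' by have := congr1 size ii'; rewrite !size_mkseq.
    rewrite -ieq in ii' p'i'; have [pp'|pp'] := pselect (p = p'); first by rewrite pp'.
    have [d [_ pd ab _]] := ZK p p' Zp Zp' pp'; rewrite ab// ltnS leqNgt.
    by apply/negP => di; apply: pd; have /agree_mkseq := ii'; exact.
  have /choice[m mP] p : exists m, Z p -> forall n, (m <= n)%N ->
      F (branch p.1 p.2) n = F c n && F (branch p.1 top) n.
    have [Zp|nZp] := pselect (Z p); last by exists 0.
    have [m mP] := fi_and FG c (branch p.1 top).
    by exists m => _ n /mP; rewrite cZ.
  have [x [y [Zx Zy xy [mxy Fxy]]]] :=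
    uncountable_collision (fun p => (m p, mkseq (F (branch p.1 p.2)) (m p))) Zunc.
  have [d [_ _ _ [n [xn yn]]]] := ZK x y Zx Zy xy; apply.
  have [nm|mn] := ltnP n (m x).
    by move: Fxy; rewrite -mxy => /agree_mkseq; exact.
  by rewrite !mP -?mxy// xn yn.
- by exists P.
Qed.

Lemma branch_lift (R : realType) (oca : OCA_T R) : exists z (f : nat -> nat), forall a,
  almost (fun n => F (branch z top) n -> F a n = a (f n)).
Proof.
have [P [Pcov PK]] := branch_cover oca.
pose piece z k : set bitfun := [set a | P k (z, a)].
pose zcode (z : bitfun) n := (z n, F (branch z top) n).
pose Y (t : nat * seq bool) : set bitfun :=
  [set z | dense_at (piece z t.1) (nth false t.2) (size t.2)].
(* Outside a countable set, [z] is a limit of other members of each [Y t] containing it, in the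
   topology that also sees the image of the branch. *)
have [z good] : exists z, forall t, Y t z -> forall n,
    exists2 w, Y t w & z <> w /\ agree n (zcode z) (zcode w).
  apply: contrapT => /forallNP bad; apply: uncountable_cantor.
  pose isolated t := [set z | Y t z /\ exists n,
    countable (Y t `&` [set w | agree n (zcode z) (zcode w)])].
  apply: (@sub_countable _ _ _ (\bigcup_(t in setT) isolated t)); last first.
    by apply: bigcup_countable => // t _; exact: isolated_countable.
  apply: subset_card_le => z _; have /existsNP[t /not_implyP[Yz /existsNP[n nz]]] := bad z.
  exists t => //; split=> //; exists n.
  apply: (@sub_countable _ _ _ [set z]) => //; apply: subset_card_le => w [Yw zw] /=.
  by apply: contrapT => wz; apply: nz; exists w => //; split=> //; exact/nesym.
pose beta a := F (branch z a).
have [|||j [e [H [Hxor Hcont [A [E [Acov AE]]]]]]] :=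
  @homomorphism_lift (F (branch z top)) beta _ (piece z).
- by move=> a; exact: Pcov.
- move=> k x m xd n Bn; pose t := (k, mkseq x m).
  have dt (w : bitfun) : dense_at (piece w k) x m <-> Y t w.
    rewrite /Y /= size_mkseq; split=> wd y l xy; apply: wd; apply: agree_trans xy.
      by move=> i im; rewrite nth_mkseq.
    by move=> i im; rewrite nth_mkseq.
  have [w /dt wd [zw zwn]] := good t ((dt z).1 xd) (maxn m n.+1).
  have [d [zwd zd]] := first_difference zw.
  have wn : F (branch w top) n.
    have nl : (n < maxn m n.+1)%N by rewrite leq_max leqnn orbT.
    by have [_ <-] := zwn n nl.
  (* [a] and [b] agree with [c] up to and including the level where [z] and [w] split, so neither
     may conflict with [(w, c)]: both images at [n] equal [F (branch w c) n]. *)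
  exists d.+1 => a b Pa Pb xa xb ab.
  have [c Pc ac] := wd a d.+1 xa.
  have F_c a' : piece z k a' -> agree d.+1 a' c -> beta a' n = F (branch w c) n.
    move=> Pa' a'c; apply: contrapT => neq; apply: (PK k (z, a') (w, c)) => //.
    by exists d; split=> //; exists n.
  by rewrite (F_c a)// (F_c b)//; exact: agree_trans (agree_sym ab) ac.
- move=> a b; have /almost_mono := fi_xor FG (branch z a) (branch z b).
  by rewrite -branch_xor; apply.
have [|||||||||f fP] := @point_map (F (branch z top)) beta _ A E H j e => //.
- move=> a b; have /almost_mono := fi_xor FG (branch z a) (branch z b).
  by rewrite -branch_xor; apply.
- by move=> a b ab; apply: (fi_sub FG); exact: branch_sub.
- move=> a; apply: (fi_disj FG) => x [/asboolP[i -> ai]].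
  by rewrite branch_q /notf ai.
- by move=> a ua; apply: (fi_unbounded FG GF); apply/branch_unbounded.
- move=> N uN NB; pose a i := G N (q (mkseq z i)).
  have betaN : almost (fun n => beta a n = N n && F (branch z top) n).
    have := almost_and (fi_and FG (G N) (branch z top)) (fi_FG FG N).
    rewrite branch_restrict => /almost_mono; apply => n [Fa FN].
    by rewrite /beta Fa FN.
  exists a; last by have /almost_mono := betaN; apply => n -> /andP[].
  apply/(branch_unbounded z); apply: contrapT => /not_unbounded /(fi_bounded FG) a0.
  suff : ~ unbounded N by [].
  apply/not_unbounded; have /almost_mono := almost_and a0 betaN.
  by apply => n [Fa0]; rewrite /beta Fa0 => /esym; case: (N n) (NB n) => // ->.
exists z, (fun n => q (mkseq z (f n))) => a.
pose b i := a (q (mkseq z i)).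
have := almost_and (fi_and FG a (branch z top)) (fP b).
rewrite branch_restrict -/b -/(beta b) => /almost_mono; apply => n [h fb] Fn.
by move: h; rewrite fb// Fn andbT.
Qed.

End TreeLocal.

(** * Global triviality of automorphisms of P(N)/Fin *)

Section GlobalPointMap.
Context (F G : bitfun -> bitfun) (FG : fin_iso F G) (GF : fin_iso G F).

(** Nodes of length [pickle (k, j)] are placed in [D k], so every branch meets every [D k]
    infinitely often. *)
Lemma local_point_map (R : realType) (oca : OCA_T R) (D : nat -> bitfun) :
  (forall k, unbounded (D k)) -> exists A (f : nat -> nat),
    (forall a, almost (fun n => F A n -> F a n = a (f n))) /\
    forall k, unbounded (andf A (D k)).
Proof.
move=> Dunb; pose D' i : bitfun := if unpickle i is Some p then D (p : nat * nat).1 else D 0.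
have [|q qinj qD] := @greedy_injection (seq bool) (fun t => [set n | D' (size t) n]).
  move=> t; apply/infinite_geP; rewrite /D'; case: (unpickle _) => [p|]; exact: Dunb.
have [z [f fP]] := branch_lift FG GF qinj oca.
exists (branch q z (fun=> true)), f; split=> // k m.
have [j mj] : exists j : nat, (m <= q (mkseq z (pickle (k, j))))%N.
  apply: (@injective_unbounded (fun j => q (mkseq z (pickle (k, j)))) m) => j j'.
  move=> /qinj /(congr1 size); rewrite !size_mkseq.
  by move=> /(pcan_inj pickleK) [].
exists (q (mkseq z (pickle (k, j)))) => //; rewrite /andf (branch_q qinj) /=.
by have := qD (mkseq z (pickle (k, j))); rewrite /D' /= size_mkseq pickleK.
Qed.

(** [G] inverts [F], so that on [F A] the value [b n] is almost always determined by [f n]; a set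
    separating infinitely many pairs with equal images would be a counterexample. *)
Lemma lift_injective (A : bitfun) (f : nat -> nat) :
  (forall a, almost (fun n => F A n -> F a n = a (f n))) ->
  exists m, forall n n', (m <= n)%N -> (m <= n')%N -> F A n -> F A n' ->
    f n = f n' -> n = n'.
Proof.
move=> fP; have dual b : almost (fun n => F A n -> b n = G b (f n)).
  have /almost_mono := almost_and (fP (G b)) (fi_FG FG b).
  by apply => n [h <-] /h.
apply: contrapT => /forallNP many.
have [k|Q sepQ] := @separating_set
  (fun n n' _ => [/\ F A n, F A n' & f n = f n']).
  apply: contrapT => nx; apply: (many k) => n n' kn kn' An An' ff'.
  by apply: contrapT => nn'; apply: nx; exists n, n', k.
have [m mP] := dual Q; have [n [n' [_ [[mn mn' _] [An An' ff'] Qn Qn']]]] :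
    exists n n' i, [/\ [/\ (m <= n)%N, (m <= n')%N & (m <= i)%N],
      [/\ F A n, F A n' & f n = f n'], Q n & ~~ Q n'] by exact: sepQ.
by move: Qn'; rewrite mP// -ff' -mP// Qn.
Qed.

(* A local lift is a pair of mutually inverse partial injections of N, one
   lifting [F] and the other one lifting [G].  Both are stored together: an
   even label 2n stands for n in the domain of the lift of [F], an odd one
   2n+1 for n in the domain of the lift of [G], and the value 0 stands for
   undefined, p+1 for p. *)
Definition local_lift_spec (x : bool -> nat -> nat) : Prop :=
  (forall b n p, x b n = p.+1 -> x (~~ b) p = n.+1) /\
  (forall a, almost (fun n => forall p, x false n = p.+1 -> F a n = a p) /\
             almost (fun n => forall p, x true n = p.+1 -> G a n = a p)).

Definition local_lifts : Type := {x | local_lift_spec x}.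

Definition ll_val (x : local_lifts) (k : nat) : nat := sval x (odd k) k./2.

Definition ll_code (x : {classic local_lifts}) (n : nat) : nat * nat :=
  (sval x false n, sval x true n).

Definition ll_conf (x y : {classic local_lifts}) (k : nat) : Prop :=
  [/\ 0 < ll_val x k, 0 < ll_val y k & ll_val x k <> ll_val y k]%N.

Definition ll_loc (k v : nat) : nat := (odd k + v.-1.*2)%N.

(** The set coded by [c] has to contain the value of [x] at [k] and to omit that of [y]; the two
    lifts would then predict different values of its image at the coordinate of [k]. *)
Definition ll_test (x y : {classic local_lifts}) (k : nat) : seq (nat * nat) :=
  [:: (ll_loc k (ll_val x k), 1); (ll_loc k (ll_val y k), 0)].

Lemma ll_loc_half k v : (ll_loc k v)./2 = v.-1.
Proof. by rewrite /ll_loc half_bit_double. Qed.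

Lemma ll_loc_odd k v : odd (ll_loc k v) = odd k.
Proof. by rewrite /ll_loc oddD odd_double addbF oddb. Qed.

(** The label under which the inverse lift stores the point at location [i]. *)
Definition ll_dual (i : nat) : nat := (~~ odd i + i./2.*2)%N.

Lemma ll_dualP (x : local_lifts) k : (0 < ll_val x k)%N ->
  ll_val x (ll_dual (ll_loc k (ll_val x k))) = k./2.+1.
Proof.
case E : (ll_val x k) => [//|p] _; rewrite /ll_dual /ll_val.
rewrite ll_loc_half ll_loc_odd /= oddD odd_double addbF oddb half_bit_double.
exact: (svalP x).1 E.
Qed.

Lemma ll_dual_val (x : local_lifts) k v : (0 < v)%N ->
  ll_val x (ll_dual (ll_loc k v)) = k./2.+1 -> ll_val x k = v.
Proof.
rewrite /ll_dual /ll_val ll_loc_half ll_loc_odd oddD odd_double addbF oddb.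
by rewrite half_bit_double => v0 /((svalP x).1); rewrite negbK prednK.
Qed.

Lemma ll_agree x y k : agree k./2.+1 (ll_code x) (ll_code y) -> ll_val x k = ll_val y k.
Proof. by move=> /(_ k./2 (ltnSn _))[]; rewrite /ll_val; case: (odd k). Qed.

(** Lifts carry their inverses: a datum that sends a label to location [i] returns this label at
    [ll_dual i]. This bounds the labels tested at [i], and it turns a clash between tests at two
    different labels into a conflict at [ll_dual i]. *)
Lemma ll_conflicts : conflict_system ll_code ll_conf ll_test
  (fun k => k./2.+1) (fun i => (ll_dual i)./2.+1).
Proof.
have code_val (x y : local_lifts) : ll_code x = ll_code y -> x = y.
  move=> xy; case: x y xy => [x xP] [y yP] xy; apply: eq_exist; apply/funext => b.
  apply/funext => n; have := congr1 (@^~ n) xy; rewrite /ll_code /= => -[].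
  by case: b.
have far x y k : ll_conf x y k -> ~ agree k./2.+1 (ll_code x) (ll_code y).
  by move=> [_ _ xyk] /ll_agree.
have far_loc x k i : (0 < ll_val x k)%N -> i = ll_loc k (ll_val x k) ->
    ll_val x (ll_dual i) = k./2.+1 /\ odd i = odd k.
  by move=> xk ->; rewrite ll_dualP// ll_loc_odd.
have in_test x y k i : ll_conf x y k -> i \in unzip1 (ll_test x y k) ->
    exists z, [/\ z = x \/ z = y, (0 < ll_val z k)%N & i = ll_loc k (ll_val z k)].
  move=> [xk yk _]; rewrite !inE => /orP[]/eqP ->; first by exists x; split=> //; left.
  by exists y; split=> //; right.
have loc_far x y k i : ll_conf x y k -> i \in unzip1 (ll_test x y k) ->
    ~ agree (ll_dual i)./2.+1 (ll_code x) (ll_code y).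
  move=> xyk /(in_test _ _ _ _ xyk)[z [zxy zk iz]] /ll_agree xyi.
  have [zi _] := far_loc z k i zk iz; have [_ _ neq] := xyk; apply: neq.
  have val w : w = x \/ w = y -> ll_val w k = ll_val z k.
    move=> wxy; apply: ll_dual_val => //; rewrite -iz -zi.
    by case: zxy => ->; case: wxy => ->.
  by rewrite !val; auto.
split.
- exact: code_val.
- by move=> x y k [xk yk xyk]; split=> //; exact/nesym.
- by move=> x k [_ _].
- move=> x y k x' y' [xk yk xyk] /ll_agree xx' /ll_agree yy'.
  by rewrite /ll_conf /ll_test -xx' -yy'.
- move=> x y k [xk yk xyk]; rewrite /= andbT inE; apply/negP => /eqP h.
  apply: xyk; have := congr1 half h; rewrite !ll_loc_half.
  by case: (ll_val x k) xk (ll_val y k) yk => // p _ [//|p'] _ /= ->.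
- by [].
- move=> x y i ks uks ksi.
  pose lab z := (odd i + (ll_val z (ll_dual i)).-1.*2)%N.
  apply: (@leq_trans (size [:: lab x; lab y])) => //; apply: uniq_leq_size => // k.
  move=> /ksi[xyk /(in_test _ _ _ _ xyk)[z [zxy zk iz]]].
  have [zi ik] := far_loc z k i zk iz.
  have -> : k = lab z by rewrite /lab zi ik odd_double_half.
  by case: zxy => ->; rewrite !inE eqxx ?orbT.
- exact: loc_far.
- move=> x x' y y' k k' i xx' yy' ik ik'.
  have [kk'|kk'] := eqVneq k k'.
    rewrite -kk' in yy'; have [xk x'k neq] := xx'; have [yk _ _] := yy'.
    have [xy|xy] := eqVneq (ll_val x k) (ll_val y k).
      exists k, x', y; split; [by right|by left| |by case=> /(far _ _ _ xx')].
      by split=> //; rewrite -xy; exact/nesym.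
    exists k, x, y; split; [by left|by left| |by case=> /(far _ _ _ xx')].
    by split=> //; exact/eqP.
  have [a [axx' ak ia]] := in_test _ _ _ _ xx' ik.
  have [b [byy' bk' ib]] := in_test _ _ _ _ yy' ik'.
  have [ai oi] := far_loc a k i ak ia; have [bi oi'] := far_loc b k' i bk' ib.
  exists (ll_dual i), a, b; split=> //.
    rewrite /ll_conf ai bi; split=> // -[half]; move/eqP: kk'; apply.
    by rewrite -[k]odd_double_half -[k']odd_double_half -oi -oi' half.
  by move=> [/(loc_far _ _ _ _ xx' ik)].
- move=> c; pose a (b : bool) : bitfun := fun p => c (b + p.*2)%N == 1.
  have /choice[m mP] (x : local_lifts) : exists m, forall n, (m <= n)%N ->
      (forall p, sval x false n = p.+1 -> F (a false) n = a false p) /\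
      (forall p, sval x true n = p.+1 -> G (a true) n = a true p).
    have [h0 _] := (svalP x).2 (a false); have [_ h1] := (svalP x).2 (a true).
    by have [m mP] := almost_and h0 h1; exists m.
  (* Labels are about twice their coordinates, hence the doubling. *)
  exists (fun x => (m x).*2) => x y k xyk ck; have [xk yk _] := xyk.
  rewrite ltnNge geq_max; apply/negP => /andP[mx my].
  have {}mx : (m x <= k./2)%N by rewrite -[m x]doubleK half_leq.
  have {}my : (m y <= k./2)%N by rewrite -[m y]doubleK half_leq.
  have ax : a (odd k) (ll_val x k).-1 = true.
    by rewrite /a (ck (ll_loc k (ll_val x k), 1))// inE eqxx.
  have ay : a (odd k) (ll_val y k).-1 = false.
    by rewrite /a (ck (ll_loc k (ll_val y k), 0))// !inE eqxx orbT.
  have vx : sval x (odd k) k./2 = (ll_val x k).-1.+1 by rewrite prednK.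
  have vy : sval y (odd k) k./2 = (ll_val y k).-1.+1 by rewrite prednK.
  have [x0 x1] := mP x _ mx; have [y0 y1] := mP y _ my.
  case: (odd k) ax ay vx vy => ax ay vx vy.
    by have := x1 _ vx; rewrite (y1 _ vy) ax ay.
  by have := x0 _ vx; rewrite (y0 _ vy) ax ay.
Qed.

(** A conflict-free family determines one candidate for [f]. If every candidate fails, a local point
    map chosen to meet all the failure sets, made injective by dropping finitely many coordinates,
    belongs to some family and agrees with its candidate. *)
Theorem iso_point_map (R : realType) (oca : OCA_T R) (ma : MA_aleph1_sigma_linked) :
  exists f : nat -> nat, forall a, almost (fun n => F a n = a (f n)).
Proof.
have [P Pcov PC] := conflict_free_cover ll_conflicts oca ma.
apply: contrapT => /forallNP nof.
have /choice[f fP] (p : nat * nat) : exists u, forall x : local_lifts, P p.1 x ->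
    forall v, sval x false p.2 = v.+1 -> u = v.
  have [[x [v [Px xv]]]|nx] := pselect (exists x v, P p.1 x /\
      sval (x : local_lifts) false p.2 = v.+1).
    exists v => y Py w yw; apply: contrapT => vw.
    apply: (PC _ x y (p.2).*2 Px Py); split; rewrite /ll_val odd_double doubleK.
    - by rewrite xv.
    - by rewrite yw.
    - by rewrite xv yw => -[].
  by exists 0 => x Px v xv; case: nx; exists x, v.
have /choice[a aP] (k : nat) : exists a : bitfun, unbounded (fun n => F a n != a (f (k, n))).
  apply: contrapT => /forallNP na; apply: (nof (fun n => f (k, n))) => a.
  have /not_unbounded/almost_mono := na a; apply => n.
  by move=> /negbFE /eqP.
pose D k : bitfun := fun n => F (a k) n != a k (f (k, n)).
have [|A [g [gA AD]]] := @local_point_map R oca (fun k => G (D k)).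
  by move=> k; apply: (fi_unbounded GF FG); exact: aP.
have [m m_inj] := lift_injective gA.
pose x0 n := if (m <= n)%N && F A n then (g n).+1 else 0.
have x0P n p : x0 n = p.+1 <-> [/\ (m <= n)%N, F A n & g n = p].
  rewrite /x0; split=> [|[-> -> ->]//].
  by case: ifP => // /andP[mn An] [<-].
have /choice[x1 x1P] (p : nat) : exists v, forall n, v = n.+1 <-> x0 n = p.+1.
  have [[n np]|nn] := pselect (exists n, x0 n = p.+1); last first.
    by exists 0 => n; split=> // np; case: nn; exists n.
  exists n.+1 => n'; split=> [[<-//]|n'p]; congr S.
  have [mn An gn] := (x0P _ _).1 np; have [mn' An' gn'] := (x0P _ _).1 n'p.
  by apply: m_inj => //; rewrite gn.
have xP : local_lift_spec (fun b => if b then x1 else x0).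
  split=> [[] n p|b] /=; first by move/x1P.
    by move=> np; apply/x1P.
  split.
    have /almost_mono := gA b; apply => n gn p /x0P[_ An <-]; exact: gn.
  have [M MP] : almost (fun n => F A n -> b n = G b (g n)).
    have /almost_mono := almost_and (gA (G b)) (fi_FG FG b).
    by apply => n [h <-] /h.
  (* A point beyond the images of the first [M] coordinates comes only from coordinates at which
     [MP] applies. *)
  exists (\max_(n < M) g n).+1 => p pM n /x1P /x0P[mn An gn].
  have [nM|Mn] := ltnP n M; last by rewrite -gn MP.
  have := @leq_bigmax _ (fun n : 'I_M => g n) (Ordinal nM).
  by rewrite /= gn leqNgt pM.
pose x : local_lifts := exist _ _ xP.
have [k Px] := Pcov x.
have unb : unbounded (fun n => F A n && D k n).
  have uFA : unbounded (F (andf A (G (D k)))) by exact: (fi_unbounded FG GF (AD k)).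
  move=> n; have [n' n'P] := almost_and (fi_and FG A (G (D k))) (fi_FG FG (D k)).
  have [i] := uFA (maxn n n'); rewrite geq_max => /andP[ni n'i].
  by have [-> ->] := n'P i n'i; exists i.
have [m' m'P] := gA (a k).
have [n] := unb (maxn m m'); rewrite geq_max => /andP[mn m'n] /andP[An].
rewrite /D m'P// (fP (k, n) x Px (g n)) ?eqxx//.
exact/x0P.
Qed.

End GlobalPointMap.

(** * The main theorem *)

Definition bits_class (a : bitfun) : pow_fin := \pi_pow_fin [set n | a n].

Definition pow_fin_lift (alpha : pow_fin -> pow_fin) (a : bitfun) : bitfun :=
  fun n => `[< repr (alpha (bits_class a)) n >].

Lemma bits_classP a b : bits_class a = bits_class b <-> almost (fun n => a n = b n).
Proof.
rewrite pow_finP almostP (_ : _ `+` _ = [set n | a n <> b n])//.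
apply/seteqP; split=> n /=; case: (a n); case: (b n) => //=.
- by case=> -[].
- by case=> -[].
- by left.
- by right.
Qed.

Lemma bits_class_lift alpha a : bits_class (pow_fin_lift alpha a) = alpha (bits_class a).
Proof.
rewrite -[RHS]reprK; congr (\pi_pow_fin _).
by apply/seteqP; split=> n /= /asboolP.
Qed.

Lemma pow_fin_lift_iso (alpha alpha' : pow_fin -> pow_fin) :
  boolean_isomorphism alpha -> cancel alpha alpha' -> cancel alpha' alpha ->
  fin_iso (pow_fin_lift alpha) (pow_fin_lift alpha').
Proof.
move=> [_ [alphaI _ alphaC _ _]] alphaK alphaK'.
have andE a b : bits_class (andf a b) = Order.meet (bits_class a) (bits_class b).
  rewrite [RHS]pi_meet; congr (\pi_pow_fin _).
  by apply/seteqP; split=> n /= /andP.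
have notE a : bits_class (notf a) = Order.compl (bits_class a).
  rewrite [RHS]pi_compl; congr (\pi_pow_fin _).
  by apply/seteqP; split=> n /= /negP.
split.
- by move=> a b /bits_classP ab; apply/bits_classP; rewrite !bits_class_lift ab.
- move=> a b.
  have : bits_class (pow_fin_lift alpha (andf a b)) =
      bits_class (andf (pow_fin_lift alpha a) (pow_fin_lift alpha b)).
    by rewrite andE !bits_class_lift andE alphaI.
  by move/bits_classP.
- move=> a; have : bits_class (pow_fin_lift alpha (notf a)) =
      bits_class (notf (pow_fin_lift alpha a)).
    by rewrite notE !bits_class_lift notE alphaC.
  by move/bits_classP.
- by move=> a; apply/bits_classP; rewrite !bits_class_lift alphaK'.
- by move=> a; apply/bits_classP; rewrite !bits_class_lift alphaK.
Qed.

Theorem theorem5p1 (R : realType)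
    (oca : OCA_T R) (ma : MA_aleph1_sigma_linked)
    (M N : nat -> Type)
    (countM : forall n, countable [set: M n])
    (countN : forall n, countable [set: N n])
    (twoM : forall n, exists x y : M n, x <> y)
    (twoN : forall n, exists x y : N n, x <> y)
    (Phi : reduced_prod M -> reduced_prod N)
    (respPhi : coordinate_respecting Phi) :
  twisted_product_form Phi.
Proof.
have [alpha alpha_iso resp] := respPhi.
have [[alpha' alphaK alphaK'] _] := alpha_iso.
have FG := pow_fin_lift_iso alpha_iso alphaK alphaK'.
have GF : fin_iso (pow_fin_lift alpha') (pow_fin_lift alpha).
  apply: fin_iso_sym FG _ => a b /bits_classP ab.
  by apply/bits_classP; rewrite !bits_class_lift ab.
have [f fP] := iso_point_map FG GF oca ma.
(* [f] is injective on almost all integers by the local statement, applied to a set [A] whose image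
   is almost everything. *)
have [m0 f_inj] : exists m, forall n n', (m <= n)%N -> (m <= n')%N ->
    f n = f n' -> n = n'.
  have [A A1] : exists A, almost (fun n => pow_fin_lift alpha A n).
    exists (fun=> true); have /almost_mono := fP (fun=> true); exact.
  have [|m mP] := @lift_injective _ _ FG A f.
    by move=> a; have /almost_mono := fP a; apply.
  have [m' m'P] := A1; exists (maxn m m') => n n'.
  rewrite !geq_max => /andP[mn m'n] /andP[mn' m'n'].
  by apply: mP => //; exact: m'P.
have coding (L : nat -> Type) : (forall n, countable [set: L n]) ->
    (forall n, exists x y : L n, x <> y) ->
    exists (enc : forall n, L n -> nat) (dec : forall n, nat -> L n),
      forall n, cancel (enc n) (dec n).
  move=> countL twoL.
  have /all_sig[ed edP] n : {p : (L n -> nat) * (nat -> L n) | cancel p.1 p.2}.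
    apply: cid; have /countable_injP[enc enc_inj] := countL n.
    have [x0 _] := twoL n.
    have /choice[dec decP] (v : nat) : exists x, forall y, enc y = v -> y = x.
      have [[x xv]|nx] := pselect (exists x, enc x = v).
        by exists x => y; rewrite -xv => /enc_inj; apply; rewrite inE.
      by exists x0 => y yv; case: nx; exists y.
    by exists (enc, dec) => x /=; exact/esym/decP.
  by exists (fun n => (ed n).1), (fun n => (ed n).2).
have [encM [decM decMK]] := coding M countM twoM.
have [encN [decN decNK]] := coding N countN twoN.
pose lift (a : forall n, M n) : forall n, N n := repr (Phi (class_fin a)).
have liftP a : class_fin (lift a) = Phi (class_fin a) by rewrite /class_fin reprK.
(* [alpha] sends the class of [s] to that of its preimage under [f], so agreement on [s] passes to
   agreement of the images on this preimage. *)
have lift_resp (s : bitfun) a b : (forall n, s n -> a n = b n) ->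
    almost (fun n => s (f n) -> lift a n = lift b n).
  move=> ab.
  have : eq_on (bits_class s) (class_fin a) (class_fin b).
    apply/eq_onP; apply: (@sub_finite_set _ _ set0) => // n [sn].
    by case; exact: ab.
  move=> /resp; rewrite -bits_class_lift -!liftP => /eq_onP fin.
  have h : almost (fun n => ~ (pow_fin_lift alpha s n /\ lift a n <> lift b n)).
    apply/almostP; apply: sub_finite_set fin => n /= /contrapT; exact.
  have /almost_mono := almost_and h (fP s); apply => n [nab sE] sn.
  by apply: contrapT => neq; apply: nab; rewrite sE.
have /choice[g gP] (p : nat) : exists n, forall n', (m0 <= n')%N -> f n' = p -> n' = n.
  have [[n [mn np]]|nn] := pselect (exists n, (m0 <= n)%N /\ f n = p).
    by exists n => n' mn' n'p; apply: f_inj => //; rewrite np.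
  by exists 0 => n' mn' n'p; case: nn; exists n'.
(* [g] inverts [f] on large arguments; thus [pull b] decodes [b n] at coordinate [f n], and [F]
   below is a map over the identity. *)
pose pull (b : nat -> nat) (p : nat) : M p := decM p (b (g p)).
have pull_f b n : (m0 <= n)%N -> pull b (f n) = decM (f n) (b n).
  by move=> mn; rewrite /pull -(gP (f n) n mn erefl).
pose F (b : nat -> nat) n := encN n (lift (pull b) n).
have Fcoh : coherent F.
  move=> b b'; pose s p := b (g p) == b' (g p).
  have bb' p : s p -> pull b p = pull b' p by rewrite /s /pull => /eqP ->.
  have /almost_mono := almost_and (almost_ge m0) (lift_resp s _ _ bb').
  apply => n [mn lbb'] bn; rewrite /F lbb'//.
  by rewrite /s -(gP (f n) n mn erefl) bn.
have [h hP] := coherent_lift oca ma Fcoh.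
exists f, (fun n v => decN n (h n (encM (f n) v))) => a.
rewrite -liftP; apply/class_finP/almostP.
pose b n := encM (f n) (a (f n)).
(* [pull b] and [a] agree at [f n] for all large [n], but possibly not outside the range of [f]; the
   set [s] confines the comparison to where they agree. *)
pose s (p : nat) : bool := `[< pull b p = a p >].
have sP p : s p -> pull b p = a p by move=> /asboolP.
have := almost_and (almost_ge m0) (almost_and (hP b) (lift_resp s _ _ sP)).
move=> /almost_mono; apply => n [mn [Fb lb]].
rewrite -/(b n) -Fb /F decNK lb//.
by apply/asboolP; rewrite pull_f// /b decMK.
Qed.
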